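(* Let $\lambda>0$ and let $g\in APW$ be given by $g=g_-+g_+$ with $g_\pm\in AP^\pm$, $0\notin\Omega(g_\pm)$. Let $\eta_{1-}=-\sup\Omega(g_-)$, $\eta_{1+}=\inf\Omega(g_+)$, and suppose $\eta_{1+}+\eta_{1-}\ge\lambda$. Then the matrix function $$G=\begin{bmatrix}e_{-\lambda}&0\\ g&e_\lambda\end{bmatrix}$$ is $AP$ factorable if and only if $$\big(\eta_{1+}\in\Omega(g_+)\ \text{ or }\ \eta_{1+}\ge\lambda\big)\quad\text{and}\quad\big(-\eta_{1-}\in\Omega(g_-)\ \text{ or }\ \eta_{1-}\ge\lambda\big).$$ In this case $G$ actually admits an $APW$ factorization and its partial $AP$ indices are $\pm\mu$ with $$\mu=\min\{\lambda,\ \eta_{1+},\ \eta_{1-},\ \eta_{1+}+\eta_{1-}-\lambda\}.$$ In particular, the factorization is canonical if and only if $\eta_{1+}=0$ or $\eta_{1-}=0$ or $\eta_{1+}+\eta_{1-}=\lambda$.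
   Context: $e_\lambda(x)=e^{i\lambda x}$. $AP$ is the uniform closure of the set of finite linear combinations of the $e_\alpha$, $\alpha\in\mathbb{R}$; for $f\in AP$, $M(f)=\lim_{T\to\infty}\frac1{2T}\int_{-T}^Tf(t)\,dt$, $\widehat f(\alpha)=M(e_{-\alpha}f)$, $\Omega(f)=\{\alpha\in\mathbb{R}:\widehat f(\alpha)\ne0\}$. $APW$ is the set of $f\in AP$ with absolutely convergent Bohr-Fourier series $\sum_{\alpha\in\Omega(f)}\widehat f(\alpha)e_\alpha$. $AP^\pm=\{f\in AP:\Omega(f)\subset\mathbb{R}_\pm\}$, $\mathbb{R}_\pm=\{x:\pm x\ge0\}$, $APW^\pm=AP^\pm\cap APW$. The sets $\Omega(g_\pm)$ may be empty, with $\inf\emptyset=+\infty$, $\sup\emptyset=-\infty$, so $\eta_{1\pm}\in[0,+\infty]$. An $AP$ (respectively $APW$) factorization of $G$ is a representation $G=G_-DG_+^{-1}$ with $G_+^{\pm1}\in(AP^+)^{2\times2}$, $G_-^{\pm1}\in(AP^-)^{2\times2}$ (respectively with $APW^\pm$ in place of $AP^\pm$) and $D=\mathrm{diag}[e_{\delta_1},e_{\delta_2}]$, $\delta_j\in\mathbb{R}$; the $\delta_j$ are the partial $AP$ indices. The factorization is canonical if $D=I$. *)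

(* Defs.v *)
From Stdlib Require Import Reals List.
From Coquelicot Require Import Coquelicot.
Import ListNotations.

Open Scope R_scope.

(* Euler's form of exp (i lam x). *)
Definition e (lam : R) (x : R) : C := (cos (lam * x), sin (lam * x)).

Definition trig_poly (l : list (C * R)) (x : R) : C :=
  fold_right Cplus (RtoC 0) (map (fun p => Cmult (fst p) (e (snd p) x)) l).

Definition AP (f : R -> C) : Prop :=
  forall eps : R, 0 < eps ->
    exists l : list (C * R), forall x : R,
      Cmod (Cminus (f x) (trig_poly l x)) < eps.

Definition is_mean (f : R -> C) (m : C_R_CompleteNormedModule) : Prop :=
  filterlim
    (fun T : R => scal (/ (2 * T)) (RInt (V := C_R_CompleteNormedModule) f (- T) T))
    (Rbar_locally p_infty) (locally m).

(* [iota] selects the unique limit when it exists, as it does on [AP]; elsewhere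
   the value is irrelevant (same convention as [RInt]). *)
Definition M (f : R -> C) : C := iota (is_mean f).

Definition bohr (f : R -> C) (alpha : R) : C :=
  M (fun x => Cmult (e (- alpha) x) (f x)).

Definition Omega (f : R -> C) : R -> Prop := fun alpha => bohr f alpha <> RtoC 0.

(* Absolute convergence of a series over the unordered index set [Omega f]:
   the finite partial sums of moduli are bounded. *)
Definition abs_convergent_bohr (f : R -> C) : Prop :=
  exists B : R, forall s : list R,
    NoDup s -> (forall alpha, In alpha s -> Omega f alpha) ->
    fold_right Rplus 0 (map (fun alpha => Cmod (bohr f alpha)) s) <= B.

Definition APW (f : R -> C) : Prop := AP f /\ abs_convergent_bohr f.

Definition APplus (f : R -> C) : Prop :=
  AP f /\ forall alpha, Omega f alpha -> 0 <= alpha.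
Definition APminus (f : R -> C) : Prop :=
  AP f /\ forall alpha, Omega f alpha -> alpha <= 0.
Definition APWplus (f : R -> C) : Prop := APplus f /\ APW f.
Definition APWminus (f : R -> C) : Prop := APminus f /\ APW f.

(* [Lub_Rbar] of the empty set is [m_infty] and [Glb_Rbar] of it is [p_infty]. *)
Definition eta_minus (g_minus : R -> C) : Rbar := Rbar_opp (Lub_Rbar (Omega g_minus)).
Definition eta_plus (g_plus : R -> C) : Rbar := Glb_Rbar (Omega g_plus).

Definition Rbar_in (x : Rbar) (E : R -> Prop) : Prop :=
  exists a : R, x = Finite a /\ E a.

Definition mx2 (a b c d : C) : @matrix C 2 2 :=
  mk_matrix 2 2 (fun i j =>
    match i, j with
    | O, O => a | O, _ => b
    | _, O => c | _, _ => d
    end).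

Definition entries_in (X : (R -> C) -> Prop) (A : R -> @matrix C 2 2) : Prop :=
  forall i j : nat, (i < 2)%nat -> (j < 2)%nat ->
    X (fun x => coeff_mat (RtoC 0) (A x) i j).

Definition is_inverse (A B : R -> @matrix C 2 2) : Prop :=
  forall x : R, Mmult (A x) (B x) = Mone /\ Mmult (B x) (A x) = Mone.

Definition diag_e (d1 d2 : R) (x : R) : @matrix C 2 2 :=
  mx2 (e d1 x) (RtoC 0) (RtoC 0) (e d2 x).

(* [G = Gm * diag [e_d1, e_d2] * Gp^-1], where [Gmi], [Gpi] are the inverses of
   [Gm], [Gp], and the entries of [Gm], [Gmi] (resp. [Gp], [Gpi]) are in
   [Xm] (resp. [Xp]). *)
Definition is_factorization (Xm Xp : (R -> C) -> Prop)
    (G : R -> @matrix C 2 2) (d1 d2 : R) : Prop :=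
  exists Gm Gmi Gp Gpi : R -> @matrix C 2 2,
    entries_in Xm Gm /\ entries_in Xm Gmi /\ is_inverse Gm Gmi /\
    entries_in Xp Gp /\ entries_in Xp Gpi /\ is_inverse Gp Gpi /\
    forall x : R, G x = Mmult (Mmult (Gm x) (diag_e d1 d2 x)) (Gpi x).

Definition AP_factorization := is_factorization APminus APplus.
Definition APW_factorization := is_factorization APWminus APWplus.

Definition AP_factorable (G : R -> @matrix C 2 2) : Prop :=
  exists d1 d2 : R, AP_factorization G d1 d2.
Definition APW_factorable (G : R -> @matrix C 2 2) : Prop :=
  exists d1 d2 : R, APW_factorization G d1 d2.

Definition canonical (d1 d2 : R) : Prop := forall x : R, diag_e d1 d2 x = Mone.

Definition G_mat (lam : R) (g : R -> C) (x : R) : @matrix C 2 2 :=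
  mx2 (e (- lam) x) (RtoC 0) (g x) (e lam x).

Definition mu_index (lam : R) (ep em : Rbar) : Rbar :=
  Rbar_min (Finite lam)
    (Rbar_min ep (Rbar_min em (Rbar_minus (Rbar_plus ep em) (Finite lam)))).

(* Main.v *)
(** The Bohr means are controlled by one device, the tensor power trick: the [n]-th power of a
    trigonometric polynomial with [N] terms has at most [(n+1)^N] frequencies, so estimates that
    lose a factor equal to the number of frequencies become sharp after taking [n]-th roots.  It
    gives Bochner-Fejer approximation (hence uniqueness and the calculus of spectra) and the bound
    [|P (t + i y)| <= e^(A |y|) sup |P|] for [P] with frequencies in [[-A, A]].

    Write [a], [b] for [eta_1+], [eta_1-] cut at [lam], [g = e_a p + e_(-b) q] and
    [mu = a + b - lam].  The vector [Phi = (e_(lam-a), -p)] satisfies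
    [G Phi = e_(-mu) (e_(b-lam), q)], so it is a candidate for a column of [G_+].  If [p] has a
    nonzero mean (or [a = lam]), a Bezout identity [p chi + e_(lam-a) psi = 1] in APW+ completes
    [Phi] to a unimodular matrix; the same identity for [q] corrects its second column so that
    both partial indices are [-mu] and [mu].  Conversely, if [a < lam] and [p] has mean zero, the
    coordinates of [Phi] in any factorization have positive frequencies, which forces
    [Phi = u Phi_j] for a column [Phi_j] of [G_+].  Then [u] divides [e_(lam-a)] and has bounded
    spectrum, so it is a pure exponential [c e_k] with [k > 0] (a zero-free entire function of
    exponential type), and the spectrum of [p] stays above [k], contrary to the choice of [a]. *)
Require Import Defs.
From Stdlib Require Import Reals List Lia Lra FunctionalExtensionality ClassicalEpsilon.
From Coquelicot Require Import Coquelicot.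
Import ListNotations.
Open Scope R_scope.

(** * Trigonometric polynomials *)

(** All functions live on the real line. Analytic arguments are run on finite coefficient lists,
    with bounds free of the number of terms, and only then passed to uniform limits; moving to a
    horizontal line of height [y] just rescales coefficients. In this form Hadamard's theorem is
    quantitative: if [x phi = e_tau] with bounded spectra, polynomial approximants of [x] have an
    approximate logarithmic derivative whose nonzero frequencies fade out, so that [x' = c x] in the
    limit.

    Having spectrum in a set is treated as approximability by polynomials with frequencies in that
    set, which makes products automatic. Two such conditions with disjoint sets force a function to
    vanish; this takes the place of Liouville's theorem.

    The cut at [lam] explains the alternatives in the criterion: if [a = lam], the first entry of
    [Phi] is 1 and [Phi] is unimodular whatever [p] is. The Bezout cofactor [chi] is sought with
    spectrum in [[0, lam - a]], not merely in the half-line, because it also enters [G_-] after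
    multiplication by a negative exponential. *)

Lemma e_plus (a b x : R) : e (a + b) x = (e a x * e b x)%C.
Proof.
  unfold e, Cmult; cbn [fst snd].
  rewrite Rmult_plus_distr_r, cos_plus, sin_plus; f_equal; ring.
Qed.

Lemma e_zero (x : R) : e 0 x = RtoC 1.
Proof. unfold e; rewrite Rmult_0_l, cos_0, sin_0; reflexivity. Qed.

Lemma e_add_arg (a x y : R) : e a (x + y) = (e a x * e a y)%C.
Proof.
  unfold e, Cmult; cbn [fst snd].
  rewrite Rmult_plus_distr_l, cos_plus, sin_plus; f_equal; ring.
Qed.

Lemma e_opp_arg (a x : R) : e a (- x) = e (- a) x.
Proof. unfold e; do 2 f_equal; ring. Qed.

Lemma Cconj_e (a x : R) : Cconj (e a x) = e (- a) x.
Proof.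
  unfold e, Cconj; cbn [fst snd].
  replace (- a * x) with (- (a * x)) by ring.
  rewrite cos_neg, sin_neg; reflexivity.
Qed.

Lemma Cmod_e (a x : R) : Cmod (e a x) = 1.
Proof.
  unfold e, Cmod; cbn [fst snd].
  rewrite <- sqrt_1; f_equal.
  generalize (sin2_cos2 (a * x)); unfold Rsqr; lra.
Qed.

Lemma e_neq_0 (a x : R) : e a x <> RtoC 0.
Proof. apply Cmod_gt_0; rewrite Cmod_e; lra. Qed.

Lemma e_opp (a x : R) : e (- a) x = (/ e a x)%C.
Proof.
  assert (H : (e a x * e (- a) x)%C = RtoC 1)
    by (rewrite <- e_plus, Rplus_opp_r; apply e_zero).
  rewrite <- (Cmult_1_r (/ e a x)), <- H; field; apply e_neq_0.
Qed.

Lemma e_minus (a b x : R) : e (a - b) x = (e a x / e b x)%C.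
Proof. unfold Rminus; rewrite e_plus, e_opp; reflexivity. Qed.

Lemma trig_poly_cons (p : C * R) (l : list (C * R)) (x : R) :
  trig_poly (p :: l) x = (fst p * e (snd p) x + trig_poly l x)%C.
Proof. reflexivity. Qed.

Lemma trig_poly_app (l1 l2 : list (C * R)) (x : R) :
  trig_poly (l1 ++ l2) x = (trig_poly l1 x + trig_poly l2 x)%C.
Proof.
  induction l1 as [|p l1 IH]; cbn [app].
  - unfold trig_poly at 2; cbn; ring.
  - rewrite !trig_poly_cons, IH; ring.
Qed.

Definition freqs (l : list (C * R)) : list R := map snd l.

Definition tmono (p : C * R) (l : list (C * R)) : list (C * R) :=
  map (fun q => ((fst p * fst q)%C, snd p + snd q)) l.

Lemma trig_poly_tmono (p : C * R) (l : list (C * R)) (x : R) :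
  trig_poly (tmono p l) x = (fst p * e (snd p) x * trig_poly l x)%C.
Proof.
  induction l as [|q l IH].
  - cbn; ring.
  - cbn [tmono map]; rewrite !trig_poly_cons; fold (tmono p l); rewrite IH.
    cbn [fst snd]; rewrite e_plus; ring.
Qed.

Definition tmul (l1 l2 : list (C * R)) : list (C * R) :=
  flat_map (fun p => tmono p l2) l1.

Lemma trig_poly_tmul (l1 l2 : list (C * R)) (x : R) :
  trig_poly (tmul l1 l2) x = (trig_poly l1 x * trig_poly l2 x)%C.
Proof.
  induction l1 as [|p l1 IH].
  - cbn; ring.
  - cbn [tmul flat_map]; rewrite trig_poly_app; fold (tmul l1 l2).
    rewrite IH, trig_poly_tmono, trig_poly_cons; ring.
Qed.

Lemma in_tmul (l1 l2 : list (C * R)) (p : C * R) :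
  In p (tmul l1 l2) ->
  exists q r, In q l1 /\ In r l2 /\ fst p = (fst q * fst r)%C /\ snd p = snd q + snd r.
Proof.
  unfold tmul; rewrite in_flat_map; intros [q [Hq Hp]].
  apply in_map_iff in Hp; destruct Hp as [r [Hr Hin]].
  exists q, r; subst p; auto.
Qed.

Definition tconst (c : C) : list (C * R) := [(c, 0)].

Lemma trig_poly_tconst (c : C) (x : R) : trig_poly (tconst c) x = c.
Proof.
  unfold tconst; rewrite trig_poly_cons; cbn [fst snd].
  rewrite e_zero; cbn; ring.
Qed.

Fixpoint tpow (l : list (C * R)) (n : nat) : list (C * R) :=
  match n with O => tconst (RtoC 1) | S n => tmul l (tpow l n) end.

Lemma trig_poly_tpow (l : list (C * R)) (n : nat) (x : R) :
  trig_poly (tpow l n) x = (trig_poly l x ^ n)%C.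
Proof.
  induction n as [|n IH]; cbn [tpow].
  - apply trig_poly_tconst.
  - rewrite trig_poly_tmul, IH; reflexivity.
Qed.

Definition tconj (l : list (C * R)) : list (C * R) :=
  map (fun p => (Cconj (fst p), - snd p)) l.

Lemma Cconj_0 : Cconj (RtoC 0) = RtoC 0.
Proof. unfold Cconj, RtoC; cbn; f_equal; ring. Qed.

Lemma trig_poly_tconj (l : list (C * R)) (x : R) :
  trig_poly (tconj l) x = Cconj (trig_poly l x).
Proof.
  induction l as [|p l IH].
  - symmetry; apply Cconj_0.
  - cbn [tconj map]; rewrite !trig_poly_cons; fold (tconj l); rewrite IH.
    cbn [fst snd]; rewrite Cplus_conj, Cmult_conj, Cconj_e; reflexivity.
Qed.

(** Attached to the list, repeated frequencies included, so for the function it is only an upper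
    bound of the Wiener norm. In exchange it is exactly additive under [++] and multiplicative under
    [tmul]. *)
Definition wnorm (l : list (C * R)) : R :=
  fold_right Rplus 0 (map (fun p => Cmod (fst p)) l).

Lemma wnorm_ge_0 (l : list (C * R)) : 0 <= wnorm l.
Proof.
  induction l as [|p l IH]; unfold wnorm in *; cbn.
  - lra.
  - generalize (Cmod_ge_0 (fst p)); lra.
Qed.

Lemma wnorm_cons (p : C * R) (l : list (C * R)) : wnorm (p :: l) = Cmod (fst p) + wnorm l.
Proof. reflexivity. Qed.

Lemma wnorm_app (l1 l2 : list (C * R)) : wnorm (l1 ++ l2) = wnorm l1 + wnorm l2.
Proof.
  induction l1 as [|p l1 IH]; cbn [app].
  - unfold wnorm at 2; cbn; ring.
  - rewrite !wnorm_cons, IH; ring.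
Qed.

Lemma wnorm_tmono (p : C * R) (l : list (C * R)) :
  wnorm (tmono p l) = Cmod (fst p) * wnorm l.
Proof.
  induction l as [|q l IH]; cbn [tmono map].
  - unfold wnorm; cbn; ring.
  - fold (tmono p l); rewrite !wnorm_cons, IH; cbn [fst]; rewrite Cmod_mult; ring.
Qed.

Lemma wnorm_tmul (l1 l2 : list (C * R)) : wnorm (tmul l1 l2) = wnorm l1 * wnorm l2.
Proof.
  induction l1 as [|p l1 IH]; cbn [tmul flat_map].
  - unfold wnorm; cbn; ring.
  - fold (tmul l1 l2); rewrite wnorm_app, IH, wnorm_tmono, wnorm_cons; ring.
Qed.

Lemma Cmod_trig_poly_le (l : list (C * R)) (x : R) : Cmod (trig_poly l x) <= wnorm l.
Proof.
  induction l as [|p l IH].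
  - unfold wnorm, trig_poly; cbn; rewrite Cmod_0; lra.
  - rewrite trig_poly_cons, wnorm_cons.
    eapply Rle_trans; [apply Cmod_triangle|].
    rewrite Cmod_mult, Cmod_e; lra.
Qed.

(** Entries with equal frequency are added up, which makes this the Bohr coefficient of
    [trig_poly l] for every list, with or without repetitions. *)
Definition coef (l : list (C * R)) (beta : R) : C :=
  fold_right Cplus (RtoC 0)
    (map (fun p => if Req_dec_T (snd p) beta then fst p else RtoC 0) l).

Lemma coef_cons (p : C * R) (l : list (C * R)) (beta : R) :
  coef (p :: l) beta = ((if Req_dec_T (snd p) beta then fst p else RtoC 0) + coef l beta)%C.
Proof. reflexivity. Qed.

Lemma coef_notin (l : list (C * R)) (beta : R) :
  ~ In beta (freqs l) -> coef l beta = RtoC 0.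
Proof.
  induction l as [|p l IH]; intros H.
  - reflexivity.
  - rewrite coef_cons; destruct (Req_dec_T (snd p) beta) as [E|E].
    + exfalso; apply H; left; exact E.
    + rewrite IH; [ring|intros K; apply H; right; exact K].
Qed.

Lemma coef_in (l : list (C * R)) (p : C * R) :
  NoDup (freqs l) -> In p l -> coef l (snd p) = fst p.
Proof.
  induction l as [|q l IH]; intros Hnd Hin; [destruct Hin|].
  cbn in Hnd; inversion Hnd as [|? ? Hq Hnd']; subst.
  rewrite coef_cons; destruct Hin as [->|Hin].
  - destruct (Req_dec_T (snd p) (snd p)); [|congruence].
    rewrite coef_notin by exact Hq; ring.
  - destruct (Req_dec_T (snd q) (snd p)) as [E|E].
    + exfalso; apply Hq; rewrite E; apply in_map; exact Hin.
    + rewrite IH by assumption; ring.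
Qed.

Definition tlist (k : R -> C) (s : list R) : list (C * R) := map (fun b => (k b, b)) s.

Lemma freqs_tlist (k : R -> C) (s : list R) : freqs (tlist k s) = s.
Proof. unfold freqs, tlist; rewrite map_map; cbn; apply map_id. Qed.

Lemma trig_poly_tlist_delta (c : C) (g : R) (s : list R) (x : R) :
  NoDup s -> In g s ->
  trig_poly (tlist (fun b => if Req_dec_T g b then c else RtoC 0) s) x = (c * e g x)%C.
Proof.
  set (k := fun b => if Req_dec_T g b then c else RtoC 0).
  assert (Hout : forall s, ~ In g s -> trig_poly (tlist k s) x = RtoC 0).
  { clear s; induction s as [|b s IH]; intros H; [reflexivity|].
    cbn [tlist map]; rewrite trig_poly_cons; fold (tlist k s); cbn [fst snd].
    rewrite IH by (intros K; apply H; right; exact K).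
    unfold k; destruct (Req_dec_T g b) as [E|E]; [exfalso; apply H; left; auto|ring]. }
  induction s as [|b s IH]; intros Hnd Hin; [destruct Hin|].
  inversion Hnd as [|? ? Hb Hnd']; subst.
  cbn [tlist map]; rewrite trig_poly_cons; fold (tlist k s); cbn [fst snd].
  unfold k at 1; destruct (Req_dec_T g b) as [E|E].
  - subst b; rewrite Hout by exact Hb; ring.
  - destruct Hin as [E'|Hin]; [congruence|]; rewrite IH by assumption; ring.
Qed.

Lemma trig_poly_tlist_plus (k1 k2 : R -> C) (s : list R) (x : R) :
  trig_poly (tlist (fun b => (k1 b + k2 b)%C) s) x
  = (trig_poly (tlist k1 s) x + trig_poly (tlist k2 s) x)%C.
Proof.
  induction s as [|b s IH]; [cbn; ring|].
  cbn [tlist map]; rewrite !trig_poly_cons.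
  fold (tlist (fun b => (k1 b + k2 b)%C) s) (tlist k1 s) (tlist k2 s).
  rewrite IH; cbn [fst snd]; ring.
Qed.

Lemma trig_poly_collect (l : list (C * R)) (s : list R) (x : R) :
  NoDup s -> incl (freqs l) s -> trig_poly (tlist (coef l) s) x = trig_poly l x.
Proof.
  intros Hnd; induction l as [|p l IH]; intros Hincl.
  - clear Hincl Hnd; induction s as [|b s IH]; [reflexivity|].
    cbn [tlist map]; rewrite trig_poly_cons; fold (tlist (coef []) s).
    rewrite IH; cbn; ring.
  - change (coef (p :: l)) with
      (fun b => ((if Req_dec_T (snd p) b then fst p else RtoC 0) + coef l b)%C).
    rewrite trig_poly_tlist_plus, trig_poly_tlist_delta, IH; [reflexivity| |exact Hnd|].
    + intros b Hb; apply Hincl; right; exact Hb.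
    + apply Hincl; left; reflexivity.
Qed.

(** Since [e^(i b (x + i y)) = e^(- b y) e^(i b x)], these are the coefficients of the entire
    extension on the line of height [y]. *)
Definition shiftE (y : R) (l : list (C * R)) : list (C * R) :=
  map (fun p => ((fst p * RtoC (exp (- (snd p * y))))%C, snd p)) l.

(** * Uniform approximation and the Bohr mean *)

Local Notation CV := C_R_CompleteNormedModule (only parsing).

Lemma norm_CR (z : C) : norm (K := R_AbsRing) (V := C_R_NormedModule) z = Cmod z.
Proof.
  unfold norm; cbn; unfold prod_norm, Cmod, norm; cbn; unfold abs; cbn.
  f_equal; rewrite !Rmult_1_r, <- !Rabs_mult, !Rabs_pos_eq; try reflexivity; apply Rle_0_sqr.
Qed.

Lemma continuous_pairC (f : R -> C) (x : R) :
  continuous (fun t => fst (f t)) x -> continuous (fun t => snd (f t)) x ->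
  continuous (U := CV) f x.
Proof.
  intros H1 H2; apply filterlim_locally; intros eps.
  assert (K1 := proj1 (filterlim_locally _ _) H1 eps).
  assert (K2 := proj1 (filterlim_locally _ _) H2 eps).
  generalize (filter_and _ _ K1 K2); apply filter_imp.
  intros t [Ht1 Ht2]; split; assumption.
Qed.

Lemma is_derive_pairC (f : R -> C) (x : R) (a b : R) :
  is_derive (fun t => fst (f t)) x a -> is_derive (fun t => snd (f t)) x b ->
  is_derive (V := C_R_NormedModule) f x (a, b).
Proof.
  intros Ha Hb.
  assert (H := is_derive_plus (V := C_R_NormedModule) _ _ _ _ _
    (is_derive_scal_l (V := C_R_NormedModule) _ _ _ (RtoC 1) Ha)
    (is_derive_scal_l (V := C_R_NormedModule) _ _ _ Ci Hb)).
  assert (E : forall u v : R, plus (scal (K := R_AbsRing) (V := C_R_NormedModule) u (RtoC 1))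
    (scal (K := R_AbsRing) (V := C_R_NormedModule) v Ci) = (u, v)).
  { intros u v; apply injective_projections; cbn; unfold mult, plus; cbn; ring. }
  rewrite E in H; revert H; apply is_derive_ext; intros t; rewrite E.
  symmetry; apply surjective_pairing.
Qed.

Lemma continuous_fstC (f : R -> C) (x : R) :
  continuous (U := CV) f x -> continuous (fun t => fst (f t)) x.
Proof.
  intros H; apply filterlim_locally; intros eps.
  generalize (proj1 (filterlim_locally _ _) H eps); apply filter_imp.
  intros t [Ht1 Ht2]; assumption.
Qed.

Lemma continuous_sndC (f : R -> C) (x : R) :
  continuous (U := CV) f x -> continuous (fun t => snd (f t)) x.
Proof.
  intros H; apply filterlim_locally; intros eps.
  generalize (proj1 (filterlim_locally _ _) H eps); apply filter_imp.
  intros t [Ht1 Ht2]; assumption.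
Qed.

Lemma continuous_CV_iff (f : R -> C) (x : R) :
  continuous (U := CV) f x <->
  forall eps : posreal, locally x (fun t => Cmod (f t - f x)%C < eps).
Proof.
  unfold continuous. rewrite (filterlim_locally_ball_norm (U:=C_R_NormedModule)).
  split; intros H eps; generalize (H eps); apply filter_imp; intros t Ht;
  unfold ball_norm in *; [rewrite norm_CR in Ht|rewrite norm_CR]; exact Ht.
Qed.

Lemma continuous_Cmult (f g : R -> C) (x : R) :
  continuous (U := CV) f x -> continuous (U := CV) g x ->
  continuous (U := CV) (fun t => (f t * g t)%C) x.
Proof.
  intros Hf Hg; apply continuous_pairC; cbn.
  - apply (continuous_minus (V:=R_NormedModule)); apply (continuous_mult (K:=R_AbsRing));
    first [apply continuous_fstC|apply continuous_sndC]; assumption.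
  - apply (continuous_plus (V:=R_NormedModule)); apply (continuous_mult (K:=R_AbsRing));
    first [apply continuous_fstC|apply continuous_sndC]; assumption.
Qed.

Lemma is_derive_e (a x : R) :
  is_derive (V := C_R_NormedModule) (e a) x (RtoC a * Ci * e a x)%C.
Proof.
  replace (RtoC a * Ci * e a x)%C with ((- a * sin (a * x), a * cos (a * x)) : C).
  - apply is_derive_pairC; cbn; auto_derive; auto; ring.
  - unfold e, Ci, RtoC, Cmult; cbn; f_equal; ring.
Qed.

Lemma continuous_e (a x : R) : continuous (U := CV) (e a) x.
Proof.
  apply (ex_derive_continuous (V := C_R_NormedModule)).
  eexists; apply is_derive_e.
Qed.

Lemma continuous_trig_poly (l : list (C * R)) (x : R) : continuous (U := CV) (trig_poly l) x.
Proof.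
  induction l as [|p l IH].
  - apply continuous_const.
  - change (trig_poly (p :: l)) with (fun t => plus (fst p * e (snd p) t)%C (trig_poly l t)).
    apply (continuous_plus (V := C_R_NormedModule)); [|exact IH].
    apply continuous_Cmult; [apply continuous_const|apply continuous_e].
Qed.

Lemma continuous_AP (f : R -> C) : AP f -> forall x, continuous (U := CV) f x.
Proof.
  intros Hf x; apply continuous_CV_iff; intros eps.
  assert (H3 : 0 < eps / 3) by (generalize (cond_pos eps); lra).
  destruct (Hf _ H3) as [l Hl].
  generalize (proj1 (continuous_CV_iff _ _) (continuous_trig_poly l x) (mkposreal _ H3)).
  apply filter_imp; intros t Ht; cbn in Ht.
  replace (f t - f x)%C with ((f t - trig_poly l t) + ((trig_poly l t - trig_poly l x)
    + - (f x - trig_poly l x)))%C by ring.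
  eapply Rle_lt_trans; [apply Cmod_triangle|].
  eapply Rle_lt_trans; [apply Rplus_le_compat_l, Cmod_triangle|].
  rewrite Cmod_opp. generalize (Hl t) (Hl x); unfold Cminus in *; lra.
Qed.

Lemma ex_RInt_AP (f : R -> C) (a b : R) : AP f -> ex_RInt (V := CV) f a b.
Proof.
  intros Hf; apply (ex_RInt_continuous (V := CV)); intros; apply continuous_AP, Hf.
Qed.

Lemma bounded_AP (f : R -> C) : AP f -> exists B, 0 < B /\ forall x, Cmod (f x) <= B.
Proof.
  intros Hf; destruct (Hf 1 Rlt_0_1) as [l Hl].
  exists (wnorm l + 1); split; [generalize (wnorm_ge_0 l); lra|]; intros x.
  replace (f x) with ((f x - trig_poly l x) + trig_poly l x)%C by ring.
  eapply Rle_trans; [apply Cmod_triangle|].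
  generalize (Hl x) (Cmod_trig_poly_le l x); lra.
Qed.

(** One closure operator for all classes below: [K] restricts the frequencies for [APin], and also
    the norm for [WBin], and sums and products are treated once. *)
Definition Approx (K : list (C * R) -> Prop) (f : R -> C) : Prop :=
  forall eps, 0 < eps -> exists l, K l /\ forall x, Cmod (f x - trig_poly l x)%C < eps.

Lemma Approx_AP (K : list (C * R) -> Prop) (f : R -> C) : Approx K f -> AP f.
Proof. intros H eps Heps; destruct (H eps Heps) as [l [_ Hl]]; exists l; exact Hl. Qed.

Lemma AP_Approx (f : R -> C) : AP f -> Approx (fun _ => True) f.
Proof. intros H eps Heps; destruct (H eps Heps) as [l Hl]; exists l; auto. Qed.

Lemma Approx_mono (K K' : list (C * R) -> Prop) (f : R -> C) :
  (forall l, K l -> K' l) -> Approx K f -> Approx K' f.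
Proof. intros HK H eps Heps; destruct (H eps Heps) as [l [H1 H2]]; exists l; auto. Qed.

Lemma Approx_ext (K : list (C * R) -> Prop) (f g : R -> C) :
  (forall x, f x = g x) -> Approx K f -> Approx K g.
Proof. intros H; replace g with f; [auto|apply functional_extensionality, H]. Qed.

Lemma Approx_trig_poly (K : list (C * R) -> Prop) (l : list (C * R)) :
  K l -> Approx K (trig_poly l).
Proof.
  intros H eps Heps; exists l; split; [exact H|].
  intros x; unfold Cminus; rewrite Cplus_opp_r, Cmod_0; exact Heps.
Qed.

Lemma Approx_plus (K1 K2 K3 : list (C * R) -> Prop) (f g : R -> C) :
  Approx K1 f -> Approx K2 g -> (forall l m, K1 l -> K2 m -> K3 (l ++ m)) ->
  Approx K3 (fun x => (f x + g x)%C).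
Proof.
  intros Hf Hg HK eps Heps.
  destruct (Hf (eps / 2)) as [l [Hl1 Hl]]; [lra|]; destruct (Hg (eps / 2)) as [m [Hm1 Hm]]; [lra|].
  exists (l ++ m); split; [auto|]; intros x; rewrite trig_poly_app.
  replace (f x + g x - (trig_poly l x + trig_poly m x))%C
    with ((f x - trig_poly l x) + (g x - trig_poly m x))%C by ring.
  eapply Rle_lt_trans; [apply Cmod_triangle|]; generalize (Hl x) (Hm x); lra.
Qed.

Lemma Cmod_prod_diff (a b c d : C) (F d1 d2 : R) :
  Cmod a <= F -> Cmod d <= F -> Cmod (a - c)%C <= d1 -> Cmod (b - d)%C <= d2 ->
  Cmod (a * b - c * d)%C <= F * (d1 + d2).
Proof.
  intros Ha Hd H1 H2.
  replace (a * b - c * d)%C with (a * (b - d) + (a - c) * d)%C by ring.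
  eapply Rle_trans; [apply Cmod_triangle|]; rewrite !Cmod_mult.
  generalize (Cmod_ge_0 a) (Cmod_ge_0 d) (Cmod_ge_0 (a - c)) (Cmod_ge_0 (b - d)); intros.
  assert (Cmod a * Cmod (b - d) <= F * d2) by (apply Rmult_le_compat; lra).
  assert (Cmod (a - c) * Cmod d <= d1 * F) by (apply Rmult_le_compat; lra).
  lra.
Qed.

Lemma Approx_mult (K1 K2 K3 : list (C * R) -> Prop) (f g : R -> C) :
  Approx K1 f -> Approx K2 g -> (forall l m, K1 l -> K2 m -> K3 (tmul l m)) ->
  Approx K3 (fun x => (f x * g x)%C).
Proof.
  intros Hf Hg HK eps Heps.
  destruct (bounded_AP f (Approx_AP _ _ Hf)) as [B1 [HB1 Hf1]].
  destruct (bounded_AP g (Approx_AP _ _ Hg)) as [B2 [HB2 Hg2]].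
  set (F := B1 + B2 + 1).
  assert (HF : 0 < F) by (unfold F; lra).
  (* [d <= 1] keeps the approximant of [g] below [F]; the product error [F * (d + d)] is then at
     most two thirds of [eps]. *)
  set (d := Rmin 1 (eps / (3 * F))).
  assert (Hd : 0 < d).
  { apply Rmin_pos; [lra|]; apply Rdiv_lt_0_compat; lra. }
  assert (Hd1 : d <= 1) by apply Rmin_l.
  assert (Hd2 : d * (3 * F) <= eps).
  { apply Rle_trans with (eps / (3 * F) * (3 * F));
      [apply Rmult_le_compat_r; [lra|apply Rmin_r]|right; field; lra]. }
  destruct (Hf d Hd) as [l [Hl1 Hl]]; destruct (Hg d Hd) as [m [Hm1 Hm]].
  exists (tmul l m); split; [auto|]; intros x; rewrite trig_poly_tmul.
  apply Rle_lt_trans with (F * (d + d)).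
  - apply Cmod_prod_diff.
    + generalize (Hf1 x); unfold F; lra.
    + replace (trig_poly m x) with (g x + - (g x - trig_poly m x))%C by ring.
      eapply Rle_trans; [apply Cmod_triangle|]; rewrite Cmod_opp.
      generalize (Hg2 x) (Hm x); unfold F; lra.
    + apply Rlt_le, Hl.
    + apply Rlt_le, Hm.
  - generalize (Rmult_lt_0_compat _ _ Hd HF); lra.
Qed.

Lemma AP_trig_poly (l : list (C * R)) : AP (trig_poly l).
Proof. apply (Approx_AP (fun _ => True)), Approx_trig_poly; exact I. Qed.

Lemma AP_ext (f g : R -> C) : (forall x, f x = g x) -> AP f -> AP g.
Proof. intros H Hf; apply (Approx_AP _ _ (Approx_ext _ _ _ H (AP_Approx f Hf))). Qed.

Lemma AP_plus (f g : R -> C) : AP f -> AP g -> AP (fun x => (f x + g x)%C).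
Proof.
  intros Hf Hg; apply (Approx_AP (fun _ => True)).
  apply (Approx_plus _ _ _ _ _ (AP_Approx f Hf) (AP_Approx g Hg)); auto.
Qed.

Lemma AP_mult (f g : R -> C) : AP f -> AP g -> AP (fun x => (f x * g x)%C).
Proof.
  intros Hf Hg; apply (Approx_AP (fun _ => True)).
  apply (Approx_mult _ _ _ _ _ (AP_Approx f Hf) (AP_Approx g Hg)); auto.
Qed.

(** * Averages over [[-T, T]] and their limit *)

Definition meanT (f : R -> C) (T : R) : C :=
  scal (K := R_AbsRing) (V := C_R_NormedModule) (/ (2 * T)) (RInt (V := CV) f (- T) T).

Lemma Cmod_scal (a : R) (z : C) :
  Cmod (scal (K := R_AbsRing) (V := C_R_NormedModule) a z) = Rabs a * Cmod z.
Proof.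
  replace (scal (K := R_AbsRing) (V := C_R_NormedModule) a z) with (RtoC a * z)%C.
  - rewrite Cmod_mult, Cmod_R; reflexivity.
  - apply injective_projections; cbn; unfold mult; cbn; ring.
Qed.

(* [W] is a bounded approximate primitive of [h]: its boundary terms are killed by [1 / (2 T)]. *)
Lemma meanT_parts (h W dW g : R -> C) (T B : R) :
  0 < T -> AP h -> AP g ->
  (forall x, Cmod (W x) <= B) ->
  (forall x, is_derive (V := C_R_NormedModule) W x (dW x)) ->
  (forall x, continuous (U := CV) dW x) ->
  (forall x, Cmod (h x - dW x)%C <= fst (g x)) ->
  Cmod (meanT h T) <= fst (meanT g T) + B / T.
Proof.
  intros HT Hh Hg HB HW HdW Hle.
  assert (I1 := RInt_correct (V := CV) _ _ _ (ex_RInt_AP h (- T) T Hh)).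
  assert (I2 : is_RInt (V := CV) dW (- T) T (minus (W T) (W (- T)))).
  { apply (is_RInt_derive (V := CV)); intros; [apply HW|apply HdW]. }
  assert (I3 := is_RInt_minus (V := C_R_NormedModule) _ _ _ _ _ _ I1 I2).
  assert (I4 := RInt_correct (V := CV) _ _ _ (ex_RInt_AP g (- T) T Hg)).
  apply (is_RInt_fct_extend_fst (U := R_NormedModule) (V := R_NormedModule)) in I4.
  assert (K := norm_RInt_le (V := C_R_NormedModule) _ _ (- T) T _ _ ltac:(lra)
    (fun x _ => eq_ind_r (fun z => z <= _) (Hle x) (norm_CR _)) I3 I4).
  rewrite norm_CR in K.
  set (J := RInt (V := CV) h (- T) T) in *.
  change (Cmod (J - (W T - W (- T)%R))%C <= fst (RInt (V:=CV) g (- T) T)) in K.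
  unfold meanT; rewrite Cmod_scal; fold J.
  assert (HTi : 0 < / (2 * T)) by (apply Rinv_0_lt_compat; lra).
  rewrite Rabs_pos_eq by lra.
  change (fst (scal (K := R_AbsRing) (V := C_R_NormedModule) (/ (2 * T)) (RInt (V := CV) g (- T) T)))
    with (/ (2 * T) * fst (RInt (V := CV) g (- T) T)).
  replace (B / T) with (/ (2 * T) * (2 * B)) by (field; lra).
  rewrite <- Rmult_plus_distr_l; apply Rmult_le_compat_l; [lra|].
  replace J with ((J - (W T - W (- T)%R)) + (W T + - W (- T)%R))%C by ring.
  eapply Rle_trans; [apply Cmod_triangle|].
  apply Rplus_le_compat; [exact K|].
  eapply Rle_trans; [apply Cmod_triangle|]; rewrite Cmod_opp.
  generalize (HB T) (HB (- T)); lra.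
Qed.

Lemma is_mean_iff (f : R -> C) (m : C) :
  is_mean f m <->
  forall eps, 0 < eps -> exists T0, forall T, T0 < T -> Cmod (meanT f T - m)%C < eps.
Proof.
  unfold is_mean; rewrite (filterlim_locally_ball_norm (U := C_R_NormedModule)).
  split.
  - intros H eps Heps; destruct (H (mkposreal _ Heps)) as [T0 HT].
    exists T0; intros T HT'; specialize (HT T HT'); unfold ball_norm in HT.
    rewrite norm_CR in HT; exact HT.
  - intros H eps; destruct (H eps (cond_pos eps)) as [T0 HT].
    exists T0; intros T HT'; unfold ball_norm; rewrite norm_CR; apply HT, HT'.
Qed.

Lemma is_mean_unique (f : R -> C) (m : C) : is_mean f m -> M f = m.
Proof.
  intros H; unfold M; apply (iota_filterlim_locally (V := CV)); exact H.
Qed.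

Lemma meanT_plus (f g : R -> C) (T : R) :
  AP f -> AP g -> meanT (fun x => (f x + g x)%C) T = (meanT f T + meanT g T)%C.
Proof.
  intros Hf Hg; unfold meanT.
  replace (RInt (V := CV) (fun x => (f x + g x)%C) (- T) T)
    with (plus (RInt (V := CV) f (- T) T) (RInt (V := CV) g (- T) T)).
  - apply (scal_distr_l (V := C_R_NormedModule)).
  - symmetry; apply (RInt_plus (V := CV)); apply ex_RInt_AP; assumption.
Qed.

Lemma meanT_Cmult (c : C) (f : R -> C) (T : R) :
  AP f -> meanT (fun x => (c * f x)%C) T = (c * meanT f T)%C.
Proof.
  intros Hf; unfold meanT.
  assert (I := RInt_correct (V := CV) _ _ _ (ex_RInt_AP f (- T) T Hf)).
  assert (E : is_RInt (V := CV) (fun x => (c * f x)%C) (- T) T (c * RInt (V := CV) f (- T) T)%C).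
  { generalize (is_RInt_fct_extend_fst (U := R_NormedModule) (V := R_NormedModule) _ _ _ _ I)
      (is_RInt_fct_extend_snd (U := R_NormedModule) (V := R_NormedModule) _ _ _ _ I).
    generalize (RInt (V := CV) f (- T) T); intros J I1 I2.
    apply (is_RInt_fct_extend_pair (U := R_NormedModule) (V := R_NormedModule)); cbn.
    - apply (is_RInt_minus (V := R_NormedModule)); apply (is_RInt_scal (V := R_NormedModule)); assumption.
    - apply (is_RInt_plus (V := R_NormedModule)); apply (is_RInt_scal (V := R_NormedModule)); assumption. }
  rewrite (is_RInt_unique (V := CV) _ _ _ _ E).
  generalize (RInt (V := CV) f (- T) T); intros J.
  apply injective_projections; cbn; unfold mult; cbn; ring.
Qed.

Lemma AP_zero : AP (fun _ => RtoC 0).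
Proof. apply (AP_trig_poly []). Qed.

Lemma AP_const (c : C) : AP (fun _ => c).
Proof. apply (AP_ext (trig_poly (tconst c))); [apply trig_poly_tconst|apply AP_trig_poly]. Qed.

Lemma AP_e (a : R) : AP (e a).
Proof.
  apply (AP_ext (trig_poly [(RtoC 1, a)])); [|apply AP_trig_poly].
  intros x; cbn; ring.
Qed.

Lemma meanT_const (c : C) (T : R) : 0 < T -> meanT (fun _ => c) T = c.
Proof.
  intros HT; unfold meanT; rewrite (RInt_const (V := CV)).
  apply injective_projections; cbn; unfold mult; cbn; field; lra.
Qed.

(** The case [W = 0] of [meanT_parts]. The majorant is a complex function read through its real
    part, so that the same averages apply to it. *)
Lemma meanT_le (h g : R -> C) (T : R) :
  0 < T -> AP h -> AP g -> (forall x, Cmod (h x) <= fst (g x)) ->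
  Cmod (meanT h T) <= fst (meanT g T).
Proof.
  intros HT Hh Hg Hle.
  replace (fst (meanT g T)) with (fst (meanT g T) + 0 / T) by (field; lra).
  apply (meanT_parts h (fun _ => RtoC 0) (fun _ => RtoC 0)); auto.
  - intros _; rewrite Cmod_0; lra.
  - intros x; apply (is_derive_const (V := C_R_NormedModule)).
  - intros x; apply continuous_const.
  - intros x; replace (h x - 0)%C with (h x) by ring; apply Hle.
Qed.

Lemma is_mean_plus (f g : R -> C) (m n : C) :
  AP f -> AP g -> is_mean f m -> is_mean g n -> is_mean (fun x => (f x + g x)%C) (m + n)%C.
Proof.
  intros Hf Hg Hm Hn; apply is_mean_iff; intros eps Heps.
  destruct (proj1 (is_mean_iff _ _) Hm (eps / 2)) as [T1 H1]; [lra|].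
  destruct (proj1 (is_mean_iff _ _) Hn (eps / 2)) as [T2 H2]; [lra|].
  exists (Rmax T1 T2); intros T HT.
  assert (T1 < T) by (eapply Rle_lt_trans; [apply Rmax_l|exact HT]).
  assert (T2 < T) by (eapply Rle_lt_trans; [apply Rmax_r|exact HT]).
  rewrite meanT_plus by assumption.
  replace (meanT f T + meanT g T - (m + n))%C
    with ((meanT f T - m) + (meanT g T - n))%C by ring.
  eapply Rle_lt_trans; [apply Cmod_triangle|].
  generalize (H1 T H) (H2 T H0); lra.
Qed.

Lemma is_mean_Cmult (c : C) (f : R -> C) (m : C) :
  AP f -> is_mean f m -> is_mean (fun x => (c * f x)%C) (c * m)%C.
Proof.
  intros Hf Hm; apply is_mean_iff; intros eps Heps.
  assert (Hc := Cmod_ge_0 c).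
  destruct (proj1 (is_mean_iff _ _) Hm (eps / (Cmod c + 1))) as [T1 H1].
  { apply Rdiv_lt_0_compat; lra. }
  exists T1; intros T HT; rewrite meanT_Cmult by assumption.
  replace (c * meanT f T - c * m)%C with (c * (meanT f T - m))%C by ring.
  rewrite Cmod_mult; specialize (H1 T HT).
  apply Rle_lt_trans with ((Cmod c) * (eps / (Cmod c + 1))).
  - apply Rmult_le_compat_l; lra.
  - apply Rlt_le_trans with ((Cmod c + 1) * (eps / (Cmod c + 1))).
    + apply Rmult_lt_compat_r; [apply Rdiv_lt_0_compat|]; lra.
    + right; field; lra.
Qed.

Lemma is_mean_e (a : R) : is_mean (e a) (if Req_dec_T a 0 then RtoC 1 else RtoC 0).
Proof.
  apply is_mean_iff; intros eps Heps; destruct (Req_dec_T a 0) as [->|Ha].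
  - exists 0; intros T HT.
    replace (e 0) with (fun _ : R => RtoC 1)
      by (apply functional_extensionality; intros x; symmetry; apply e_zero).
    rewrite meanT_const by exact HT.
    replace (RtoC 1 - RtoC 1)%C with (RtoC 0) by ring; rewrite Cmod_0; exact Heps.
  - assert (HA : 0 < Rabs a) by (apply Rabs_pos_lt; exact Ha).
    exists (/ Rabs a / eps); intros T HT.
    assert (HT0 : 0 < T).
    { eapply Rlt_trans; [|exact HT]; apply Rdiv_lt_0_compat; [apply Rinv_0_lt_compat|]; assumption. }
    replace (meanT (e a) T - 0)%C with (meanT (e a) T) by ring.
    apply Rle_lt_trans with (fst (meanT (fun _ => RtoC 0) T) + / Rabs a / T).
    (* The primitive of [e_a] used here is [- i e_a / a], of constant modulus [1 / |a|]. *)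
    + apply (meanT_parts (e a) (fun x => (RtoC (/ a) * ((sin (a * x), - cos (a * x))%R : C))%C) (e a)).
      * exact HT0.
      * apply AP_e.
      * apply AP_zero.
      * intros x; rewrite Cmod_mult, Cmod_R, Rabs_inv.
        replace (Cmod (sin (a * x), - cos (a * x))) with 1; [lra|].
        unfold Cmod; cbn [fst snd]; rewrite <- sqrt_1; f_equal.
        generalize (sin2_cos2 (a * x)); unfold Rsqr; lra.
      * intros x; apply is_derive_pairC; cbn; auto_derive; auto; field; exact Ha.
      * intros x; apply continuous_e.
      * intros x; replace (e a x - e a x)%C with (RtoC 0) by ring; rewrite Cmod_0; cbn; lra.
    + rewrite meanT_const by exact HT0; cbn.
      apply (Rmult_lt_compat_r eps) in HT; [|exact Heps].
      replace (/ Rabs a / eps * eps) with (/ Rabs a) in HT by (field; lra).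
      apply (Rmult_lt_reg_r T); [exact HT0|].
      replace ((0 + / Rabs a / T) * T) with (/ Rabs a) by (field; lra); lra.
Qed.

Lemma ball_CV (a b : C) (eps : R) :
  Cmod (b - a)%C < eps -> ball (M := CV) a eps b.
Proof.
  intros H; apply (norm_compat1 (V := C_R_NormedModule)); rewrite norm_CR; exact H.
Qed.

Lemma is_mean_trig_poly (l : list (C * R)) : is_mean (trig_poly l) (coef l 0).
Proof.
  induction l as [|p l IH].
  - apply is_mean_iff; intros eps Heps; exists 0; intros T HT.
    change (trig_poly []) with (fun _ : R => RtoC 0).
    rewrite meanT_const by exact HT.
    replace (0 - coef [] 0)%C with (RtoC 0) by (cbn; ring); rewrite Cmod_0; exact Heps.
  - rewrite coef_cons; apply (is_mean_plus (fun x => (fst p * e (snd p) x)%C)).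
    + apply AP_mult; [apply AP_const|apply AP_e].
    + apply AP_trig_poly.
    + replace (if Req_dec_T (snd p) 0 then fst p else RtoC 0)
        with (fst p * (if Req_dec_T (snd p) 0 then RtoC 1 else RtoC 0))%C
        by (destruct (Req_dec_T (snd p) 0); ring).
      apply is_mean_Cmult; [apply AP_e|apply is_mean_e].
    + exact IH.
Qed.

Lemma AP_Copp (f : R -> C) : AP f -> AP (fun x => (- f x)%C).
Proof.
  intros Hf; apply (AP_ext (fun x => (RtoC (-1) * f x)%C)).
  - intros x; apply injective_projections; cbn; ring.
  - apply AP_mult; [apply AP_const|exact Hf].
Qed.

Lemma AP_minus (f g : R -> C) : AP f -> AP g -> AP (fun x => (f x - g x)%C).
Proof. intros Hf Hg; apply AP_plus; [exact Hf|apply AP_Copp, Hg]. Qed.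

Lemma meanT_Cmod_le (h : R -> C) (B T : R) :
  0 < T -> AP h -> (forall x, Cmod (h x) <= B) -> Cmod (meanT h T) <= B.
Proof.
  intros HT Hh HB.
  generalize (meanT_le h (fun _ => RtoC B) T HT Hh (AP_const _) HB).
  rewrite meanT_const by exact HT; auto.
Qed.

(** Averages of [f] stay within [eps / 4] of those of a trigonometric polynomial for every [T > 0],
    and the latter converge; hence the Cauchy criterion. *)
Lemma ex_mean (f : R -> C) : AP f -> exists m, is_mean f m.
Proof.
  intros Hf; apply (proj1 (filterlim_locally_cauchy (U := CV) (F := Rbar_locally p_infty) _)).
  intros eps; assert (He : 0 < eps / 4) by (generalize (cond_pos eps); lra).
  destruct (Hf _ He) as [l Hl].
  destruct (proj1 (is_mean_iff _ _) (is_mean_trig_poly l) _ He) as [T0 HT0].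
  exists (fun T => Rmax 0 T0 < T); split.
  - exists (Rmax 0 T0); auto.
  - assert (K : forall T, Rmax 0 T0 < T -> Cmod (meanT f T - coef l 0)%C < eps / 2).
    { intros T HT.
      assert (0 < T) by (eapply Rle_lt_trans; [apply Rmax_l|exact HT]).
      assert (T0 < T) by (eapply Rle_lt_trans; [apply Rmax_r|exact HT]).
      assert (E : meanT f T
        = (meanT (fun x => (f x - trig_poly l x)%C) T + meanT (trig_poly l) T)%C).
      { rewrite <- meanT_plus.
        - f_equal; apply functional_extensionality; intros x; ring.
        - apply AP_minus; [exact Hf|apply AP_trig_poly].
        - apply AP_trig_poly. }
      rewrite E.
      replace (meanT (fun x => f x - trig_poly l x) T + meanT (trig_poly l) T - coef l 0)%C
        with (meanT (fun x => f x - trig_poly l x)%C T + (meanT (trig_poly l) T - coef l 0))%C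
        by ring.
      eapply Rle_lt_trans; [apply Cmod_triangle|].
      assert (K1 := meanT_Cmod_le (fun x => f x - trig_poly l x)%C (eps / 4) T H
        (AP_minus _ _ Hf (AP_trig_poly l)) (fun x => Rlt_le _ _ (Hl x))).
      specialize (HT0 T H0); lra. }
    intros u v Hu Hv; apply ball_CV.
    change (Cmod (meanT f v - meanT f u)%C < eps).
    replace (meanT f v - meanT f u)%C
      with ((meanT f v - coef l 0) + - (meanT f u - coef l 0))%C by ring.
    eapply Rle_lt_trans; [apply Cmod_triangle|]; rewrite Cmod_opp.
    generalize (K u Hu) (K v Hv); lra.
Qed.

Lemma M_correct (f : R -> C) : AP f -> is_mean f (M f).
Proof.
  intros Hf; destruct (ex_mean f Hf) as [m Hm]; rewrite (is_mean_unique _ _ Hm); exact Hm.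
Qed.

Lemma M_plus (f g : R -> C) :
  AP f -> AP g -> M (fun x => (f x + g x)%C) = (M f + M g)%C.
Proof.
  intros Hf Hg; apply is_mean_unique, is_mean_plus; auto using M_correct.
Qed.

Lemma M_Cmult (c : C) (f : R -> C) : AP f -> M (fun x => (c * f x)%C) = (c * M f)%C.
Proof. intros Hf; apply is_mean_unique, is_mean_Cmult; auto using M_correct. Qed.

Lemma M_trig_poly (l : list (C * R)) : M (trig_poly l) = coef l 0.
Proof. apply is_mean_unique, is_mean_trig_poly. Qed.

Lemma M_ext (f g : R -> C) : (forall x, f x = g x) -> M f = M g.
Proof. intros H; f_equal; apply functional_extensionality, H. Qed.

Lemma M_const (c : C) : M (fun _ => c) = c.
Proof.
  rewrite (M_ext _ (trig_poly (tconst c))) by (intros; symmetry; apply trig_poly_tconst).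
  rewrite M_trig_poly; cbn; destruct (Req_dec_T 0 0); [ring|congruence].
Qed.

Lemma Cmod_fst_le (z : C) : Rabs (fst z) <= Cmod z.
Proof. exact (re_le_Cmod z). Qed.

(** As [T] tends to infinity the boundary term [B / T] disappears: a mean is controlled by the
    distance of the function to any derivative of a bounded function. Later [W] is [ln |P|] times an
    exponential. *)
Lemma M_parts (h W dW g : R -> C) (B : R) :
  AP h -> AP g ->
  (forall x, Cmod (W x) <= B) ->
  (forall x, is_derive (V := C_R_NormedModule) W x (dW x)) ->
  (forall x, continuous (U := CV) dW x) ->
  (forall x, Cmod (h x - dW x)%C <= fst (g x)) ->
  Cmod (M h) <= fst (M g).
Proof.
  intros Hh Hg HB HW HdW Hle.
  apply Rle_plus_epsilon; intros eps Heps.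
  destruct (proj1 (is_mean_iff _ _) (M_correct h Hh) (eps / 3)) as [T1 H1]; [lra|].
  destruct (proj1 (is_mean_iff _ _) (M_correct g Hg) (eps / 3)) as [T2 H2]; [lra|].
  assert (HB0 : 0 <= B) by (eapply Rle_trans; [apply (Cmod_ge_0 (W 0))|apply HB]).
  set (T := 1 + Rmax (Rmax 0 T1) (Rmax T2 (B / (eps / 3)))).
  assert (HT : 0 < T /\ T1 < T /\ T2 < T /\ B / (eps / 3) < T).
  { unfold T; generalize (Rmax_l (Rmax 0 T1) (Rmax T2 (B / (eps / 3))))
      (Rmax_r (Rmax 0 T1) (Rmax T2 (B / (eps / 3)))) (Rmax_l 0 T1) (Rmax_r 0 T1)
      (Rmax_l T2 (B / (eps / 3))) (Rmax_r T2 (B / (eps / 3))); set (u := B / (eps / 3)); intros; repeat split; lra. }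
  clearbody T; destruct HT as [HT [HT1 [HT2 HT3]]].
  assert (K := meanT_parts h W dW g T B HT Hh Hg HB HW HdW Hle).
  assert (K3 : B / T < eps / 3).
  { apply (Rmult_lt_reg_r T); [exact HT|].
    apply (Rmult_lt_compat_r (eps / 3)) in HT3; [|lra].
    replace (B / (eps / 3) * (eps / 3)) with B in HT3 by (field; lra).
    replace (B / T * T) with B by (field; lra); lra. }
  specialize (H1 T HT1); specialize (H2 T HT2).
  assert (K4 := Cmod_fst_le (meanT g T - M g)%C).
  assert (K5 : fst (meanT g T) <= fst (M g) + eps / 3).
  { apply (Rle_trans _ _ _ (Rle_abs _)) in K4; revert H2 K4; unfold Cminus, Cplus, Copp; cbn [fst].
    intros; lra. }
  replace (M h) with (meanT h T + - (meanT h T - M h))%C by ring.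
  eapply Rle_trans; [apply Cmod_triangle|]; rewrite Cmod_opp; lra.
Qed.

Lemma M_le (h g : R -> C) :
  AP h -> AP g -> (forall x, Cmod (h x) <= fst (g x)) -> Cmod (M h) <= fst (M g).
Proof.
  intros Hh Hg Hle; apply (M_parts h (fun _ => RtoC 0) (fun _ => RtoC 0) g 0); auto.
  - intros _; rewrite Cmod_0; lra.
  - intros x; apply (is_derive_const (V := C_R_NormedModule)).
  - intros x; apply continuous_const.
  - intros x; replace (h x - 0)%C with (h x) by ring; apply Hle.
Qed.

(** * Bohr coefficients: linearity, continuity, modulation, translation, reflection *)

Lemma bohr_ext (f g : R -> C) (a : R) : (forall x, f x = g x) -> bohr f a = bohr g a.
Proof. intros H; apply M_ext; intros x; rewrite H; reflexivity. Qed.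

Lemma bohr_le_M (f g : R -> C) (a : R) :
  AP f -> AP g -> (forall x, Cmod (f x) <= fst (g x)) -> Cmod (bohr f a) <= fst (M g).
Proof.
  intros Hf Hg H; apply M_le; [apply AP_mult; [apply AP_e|exact Hf]|exact Hg|].
  intros x; rewrite Cmod_mult, Cmod_e, Rmult_1_l; apply H.
Qed.

Lemma bohr_le (f : R -> C) (B a : R) :
  AP f -> (forall x, Cmod (f x) <= B) -> Cmod (bohr f a) <= B.
Proof.
  intros Hf H; change B with (fst (RtoC B)); rewrite <- (M_const (RtoC B)).
  apply bohr_le_M; [exact Hf|apply AP_const|exact H].
Qed.

Lemma bohr_plus (f g : R -> C) (a : R) :
  AP f -> AP g -> bohr (fun x => (f x + g x)%C) a = (bohr f a + bohr g a)%C.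
Proof.
  intros Hf Hg; unfold bohr; rewrite <- M_plus.
  - apply M_ext; intros x; ring.
  - apply AP_mult; [apply AP_e|exact Hf].
  - apply AP_mult; [apply AP_e|exact Hg].
Qed.

Lemma bohr_Cmult (c : C) (f : R -> C) (a : R) :
  AP f -> bohr (fun x => (c * f x)%C) a = (c * bohr f a)%C.
Proof.
  intros Hf; unfold bohr; rewrite <- M_Cmult.
  - apply M_ext; intros x; ring.
  - apply AP_mult; [apply AP_e|exact Hf].
Qed.

Lemma bohr_minus (f g : R -> C) (a : R) :
  AP f -> AP g -> bohr (fun x => (f x - g x)%C) a = (bohr f a - bohr g a)%C.
Proof.
  intros Hf Hg; rewrite (bohr_ext _ (fun x => (f x + (RtoC (-1)) * g x)%C)).
  - rewrite bohr_plus, bohr_Cmult; auto.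
    + apply injective_projections; cbn; ring.
    + apply AP_mult; [apply AP_const|exact Hg].
  - intros x; apply injective_projections; cbn; ring.
Qed.

Lemma bohr_e_mult (b : R) (f : R -> C) (a : R) :
  bohr (fun x => (e b x * f x)%C) a = bohr f (a - b).
Proof.
  unfold bohr; apply M_ext; intros x.
  replace (- (a - b)) with (- a + b) by ring; rewrite e_plus; ring.
Qed.

Lemma coef_tmono (p : C * R) (l : list (C * R)) (a : R) :
  coef (tmono p l) a = (fst p * coef l (a - snd p))%C.
Proof.
  induction l as [|q l IH].
  - cbn; ring.
  - cbn [tmono map]; fold (tmono p l); rewrite !coef_cons, IH; cbn [fst snd].
    destruct (Req_dec_T (snd p + snd q) a), (Req_dec_T (snd q) (a - snd p)); try ring; exfalso; lra.
Qed.

Lemma bohr_trig_poly (l : list (C * R)) (a : R) : bohr (trig_poly l) a = coef l a.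
Proof.
  unfold bohr; rewrite (M_ext _ (trig_poly (tmono (RtoC 1, - a) l))).
  - rewrite M_trig_poly, coef_tmono; cbn [fst snd].
    replace (0 - - a) with a by ring; ring.
  - intros x; rewrite trig_poly_tmono; cbn [fst snd]; ring.
Qed.

Lemma bohr_approx (f g : R -> C) (eps a : R) :
  AP f -> AP g -> (forall x, Cmod (f x - g x)%C <= eps) ->
  Cmod (bohr f a - bohr g a)%C <= eps.
Proof.
  intros Hf Hg H; rewrite <- bohr_minus by assumption.
  apply bohr_le; [apply AP_minus; assumption|exact H].
Qed.

Lemma Cmod_eq_eps (a b : C) : (forall eps, 0 < eps -> Cmod (a - b)%C <= eps) -> a = b.
Proof.
  intros H; assert (E : Cmod (a - b)%C <= 0).
  { apply Rle_plus_epsilon; intros eps Heps; rewrite Rplus_0_l; auto. }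
  assert (E' : (a - b)%C = RtoC 0)
    by (apply Cmod_eq_0; generalize (Cmod_ge_0 (a - b)%C); lra).
  replace a with ((a - b) + b)%C by ring; rewrite E'; ring.
Qed.

(* Checks an identity between Bohr coefficients on trigonometric polynomials only. *)
Lemma bohr_transform (Phi : (R -> C) -> R -> C) (k : C) (a b : R) :
  Cmod k = 1 ->
  (forall f, AP f -> AP (Phi f)) ->
  (forall f g eps, (forall x, Cmod (f x - g x)%C <= eps) ->
    forall x, Cmod (Phi f x - Phi g x)%C <= eps) ->
  (forall l, bohr (Phi (trig_poly l)) a = (k * coef l b)%C) ->
  forall f, AP f -> bohr (Phi f) a = (k * bohr f b)%C.
Proof.
  intros Hk HAP Hle Hl f Hf; apply Cmod_eq_eps; intros eps Heps.
  destruct (Hf (eps / 2)) as [l H]; [lra|].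
  assert (H' := fun x => Rlt_le _ _ (H x)).
  replace (bohr (Phi f) a - k * bohr f b)%C
    with ((bohr (Phi f) a - bohr (Phi (trig_poly l)) a)
      + - (k * (bohr f b - bohr (trig_poly l) b)))%C.
  - eapply Rle_trans; [apply Cmod_triangle|]; rewrite Cmod_opp, Cmod_mult, Hk, Rmult_1_l.
    assert (K1 := bohr_approx (Phi f) (Phi (trig_poly l)) (eps / 2) a (HAP _ Hf)
      (HAP _ (AP_trig_poly l)) (Hle _ _ _ H')).
    assert (K2 := bohr_approx f (trig_poly l) (eps / 2) b Hf (AP_trig_poly l) H').
    lra.
  - rewrite Hl, bohr_trig_poly; ring.
Qed.

Lemma AP_translate (f : R -> C) (x : R) : AP f -> AP (fun t => f (x + t)).
Proof.
  intros Hf eps Heps; destruct (Hf eps Heps) as [l Hl].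
  exists (map (fun p => ((fst p * e (snd p) x)%C, snd p)) l); intros t.
  replace (trig_poly (map (fun p => ((fst p * e (snd p) x)%C, snd p)) l) t)
    with (trig_poly l (x + t)); [apply Hl|].
  clear Hl; induction l as [|p l IH]; [reflexivity|].
  cbn [map]; rewrite !trig_poly_cons, IH; cbn [fst snd]; rewrite e_add_arg; ring.
Qed.

Lemma bohr_translate (f : R -> C) (x a : R) :
  AP f -> bohr (fun t => f (x + t)) a = (e a x * bohr f a)%C.
Proof.
  revert f; apply (bohr_transform (fun f t => f (x + t))).
  - apply Cmod_e.
  - intros f; apply AP_translate.
  - intros f g eps H t; apply H.
  - intros l.
    rewrite (bohr_ext _ (trig_poly (map (fun p => ((fst p * e (snd p) x)%C, snd p)) l))).
    + rewrite bohr_trig_poly; induction l as [|p l IH]; [cbn; ring|].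
      cbn [map]; rewrite !coef_cons, IH; cbn [fst snd].
      destruct (Req_dec_T (snd p) a) as [<-|_]; ring.
    + intros t; induction l as [|p l IH]; [reflexivity|].
      cbn [map]; rewrite !trig_poly_cons, IH; cbn [fst snd]; rewrite e_add_arg; ring.
Qed.

Definition trefl (l : list (C * R)) : list (C * R) := map (fun p => (fst p, - snd p)) l.

Lemma trig_poly_trefl (l : list (C * R)) (x : R) : trig_poly (trefl l) x = trig_poly l (- x).
Proof.
  induction l as [|p l IH]; [reflexivity|].
  cbn [trefl map]; rewrite !trig_poly_cons; fold (trefl l); rewrite IH; cbn [fst snd].
  rewrite e_opp_arg; reflexivity.
Qed.

Lemma coef_trefl (l : list (C * R)) (a : R) : coef (trefl l) a = coef l (- a).
Proof.
  induction l as [|p l IH]; [reflexivity|].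
  cbn [trefl map]; rewrite !coef_cons; fold (trefl l); rewrite IH; cbn [fst snd].
  destruct (Req_dec_T (- snd p) a), (Req_dec_T (snd p) (- a)); try reflexivity; exfalso; lra.
Qed.

Lemma AP_reflect (f : R -> C) : AP f -> AP (fun t => f (- t)).
Proof.
  intros Hf eps Heps; destruct (Hf eps Heps) as [l Hl]; exists (trefl l); intros x.
  rewrite trig_poly_trefl; apply Hl.
Qed.

Lemma bohr_reflect (f : R -> C) (a : R) : AP f -> bohr (fun t => f (- t)) a = bohr f (- a).
Proof.
  intros Hf; rewrite (bohr_transform (fun f t => f (- t)) (RtoC 1) a (- a)); auto.
  - ring.
  - apply Cmod_1.
  - apply AP_reflect.
  - intros l; rewrite (bohr_ext _ (trig_poly (trefl l)))
      by (intros; symmetry; apply trig_poly_trefl).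
    rewrite bohr_trig_poly, coef_trefl; ring.
Qed.

(** * The tensor power trick *)

(** With [r = sqrt q], one factor [n + 1] is absorbed by [r ^ n], and the other [r ^ n] contained in
    [q ^ n] serves the induction. *)
Lemma poly_exp_bounded (N : nat) (q : R) :
  0 <= q < 1 -> exists B, 0 < B /\ forall n, INR (S n) ^ N * q ^ n <= B.
Proof.
  revert q; induction N as [|N IH]; intros q Hq.
  - exists 1; split; [lra|]; intros n; rewrite pow_O, Rmult_1_l.
    rewrite <- (pow1 n); apply pow_incr; lra.
  - set (r := sqrt q).
    assert (Hr : 0 <= r < 1).
    { split; [apply sqrt_pos|]; unfold r; rewrite <- sqrt_1; apply sqrt_lt_1; lra. }
    assert (Hrr : r * r = q) by (apply sqrt_sqrt; lra).
    destruct (IH r Hr) as [B [HB H]].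
    assert (L : exists c, 0 < c /\ forall n, INR (S n) * r ^ n <= c).
    { destruct (Req_dec_T r 0) as [->|Hr0].
      - exists 1; split; [lra|]; intros [|n]; [cbn; lra|]; rewrite pow_i by lia; lra.
      (* Chosen so that [(1 + d) ^ n = / r ^ n]; Bernoulli's inequality then bounds [n r ^ n] by
         [/ d]. *)
      - set (d := / r - 1).
        assert (Hd : 0 < d).
        { unfold d; assert (1 < / r) by (rewrite <- Rinv_1; apply Rinv_lt_contravar; lra); lra. }
        exists (1 + / d); split; [generalize (Rinv_0_lt_compat _ Hd); lra|]; intros n.
        assert (K := poly n d Hd).
        replace (1 + d) with (/ r) in K by (unfold d; ring).
        rewrite pow_inv in K.
        assert (Hrn : 0 < r ^ n) by (apply pow_lt; lra).
        apply (Rmult_le_compat_r (r ^ n)) in K; [|lra].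
        rewrite Rinv_l in K by lra.
        rewrite S_INR.
        assert (Hn := pos_INR n).
        assert (0 <= INR n * d) by (apply Rmult_le_pos; lra).
        assert (0 <= INR n * d * r ^ n) by (apply Rmult_le_pos; lra).
        assert (INR n * r ^ n <= / d).
        { apply (Rmult_le_reg_l d); [exact Hd|]; rewrite Rinv_r by lra; lra. }
        lra. }
    destruct L as [c [Hc L]].
    exists (c * B); split; [nra|]; intros n.
    replace (INR (S n) ^ S N * q ^ n) with ((INR (S n) * r ^ n) * (INR (S n) ^ N * r ^ n))
      by (rewrite <- Hrr, Rpow_mult_distr, <- (tech_pow_Rmult (INR (S n)) N); ring).
    assert (Hn := pos_INR (S n)).
    assert (0 <= r ^ n) by (apply pow_le; lra).
    apply Rmult_le_compat; auto; [apply Rmult_le_pos; assumption|].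
    apply Rmult_le_pos; [apply pow_le|]; assumption.
Qed.

Lemma poly_exp_small (N : nat) (q eps : R) :
  0 <= q < 1 -> 0 < eps -> exists n, INR (S n) ^ N * q ^ n < eps.
Proof.
  intros Hq Heps; set (r := sqrt q).
  assert (Hr : 0 <= r < 1).
  { split; [apply sqrt_pos|]; unfold r; rewrite <- sqrt_1; apply sqrt_lt_1; lra. }
  assert (Hrr : r * r = q) by (apply sqrt_sqrt; lra).
  destruct (poly_exp_bounded N r Hr) as [B [HB H]].
  destruct (pow_lt_1_zero r) with (y := eps / B) as [n Hn].
  { rewrite Rabs_pos_eq; lra. }
  { apply Rdiv_lt_0_compat; assumption. }
  exists n; specialize (Hn n (le_n n)); specialize (H n).
  assert (0 <= r ^ n) by (apply pow_le; lra).
  rewrite Rabs_pos_eq in Hn by assumption.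
  replace (INR (S n) ^ N * q ^ n) with ((INR (S n) ^ N * r ^ n) * r ^ n)
    by (rewrite <- Hrr, Rpow_mult_distr; ring).
  apply Rle_lt_trans with (B * r ^ n); [apply Rmult_le_compat_r; assumption|].
  apply (Rmult_lt_compat_l B) in Hn; [|exact HB].
  replace (B * (eps / B)) with eps in Hn by (field; lra); exact Hn.
Qed.

(** Sums in which each element of [s] has its own multiplicity between 0 and [n]. This contains all
    frequencies of an [n]-th power, and more, but its size [(n + 1) ^ length s] is polynomial in
    [n], which is all that matters. *)
Fixpoint grid (s : list R) (n : nat) : list R :=
  match s with
  | [] => [0]
  | a :: s => flat_map (fun k => map (Rplus (INR k * a)) (grid s n)) (seq 0 (S n))
  end.

Lemma length_grid (s : list R) (n : nat) : length (grid s n) = (S n ^ length s)%nat.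
Proof.
  induction s as [|a s IH]; [reflexivity|]; cbn [grid length].
  rewrite (flat_map_constant_length _ (c := (S n ^ length s)%nat)).
  - rewrite length_seq; cbn; lia.
  - intros k _; rewrite length_map; exact IH.
Qed.

Lemma in_grid_cons (a b : R) (s : list R) (n : nat) :
  In b (grid (a :: s) n) <-> exists k c, (k <= n)%nat /\ In c (grid s n) /\ b = INR k * a + c.
Proof.
  cbn [grid]; rewrite in_flat_map; split.
  - intros [k [Hk Hb]]; apply in_seq in Hk; apply in_map_iff in Hb.
    destruct Hb as [c [Hc Hin]]; exists k, c; repeat split; auto; lia.
  - intros [k [c [Hk [Hc ->]]]]; exists k; split; [apply in_seq; lia|].
    apply in_map_iff; exists c; auto.
Qed.

Lemma grid_incl_S (s : list R) (n : nat) : incl (grid s n) (grid s (S n)).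
Proof.
  induction s as [|a s IH]; intros b; [auto|]; rewrite !in_grid_cons.
  intros [k [c [Hk [Hc ->]]]]; exists k, c; repeat split; auto.
Qed.

Lemma grid_add (s : list R) (n : nat) (a b : R) :
  In a s -> In b (grid s n) -> In (a + b) (grid s (S n)).
Proof.
  revert b; induction s as [|a' s IH]; intros b Ha; [destruct Ha|].
  rewrite !in_grid_cons; intros [k [c [Hk [Hc ->]]]].
  destruct Ha as [->|Ha].
  - exists (S k), c; repeat split; [lia|apply grid_incl_S, Hc|rewrite S_INR; ring].
  - exists k, (a + c); repeat split; [lia|apply IH; assumption|ring].
Qed.

Lemma grid_zero (s : list R) (n : nat) : In 0 (grid s n).
Proof.
  induction s as [|a s IH]; [left; reflexivity|].
  apply in_grid_cons; exists O, 0; repeat split; [lia|exact IH|cbn; ring].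
Qed.

Lemma freqs_tpow_grid (l : list (C * R)) (n : nat) :
  incl (freqs (tpow l n)) (grid (freqs l) n).
Proof.
  induction n as [|n IH]; intros b Hb.
  - cbn in Hb; destruct Hb as [<-|[]]; apply grid_zero.
  - apply in_map_iff in Hb; destruct Hb as [p [<- Hp]]; cbn [tpow] in Hp.
    apply in_tmul in Hp; destruct Hp as [q [r [Hq [Hr [_ ->]]]]].
    apply grid_add; [apply in_map, Hq|apply IH, in_map, Hr].
Qed.

Lemma freqs_tpow_bound (l : list (C * R)) (A : R) (n : nat) (b : R) :
  (forall a, In a (freqs l) -> Rabs a <= A) -> In b (freqs (tpow l n)) -> Rabs b <= INR n * A.
Proof.
  intros HA; revert b; induction n as [|n IH]; intros b Hb.
  - cbn in Hb; destruct Hb as [<-|[]]; rewrite Rabs_R0; cbn; lra.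
  - apply in_map_iff in Hb; destruct Hb as [p [<- Hp]]; cbn [tpow] in Hp.
    apply in_tmul in Hp; destruct Hp as [q [r [Hq [Hr [_ ->]]]]].
    eapply Rle_trans; [apply Rabs_triang|]; rewrite S_INR.
    generalize (HA _ (in_map snd _ _ Hq)) (IH _ (in_map snd _ _ Hr)); lra.
Qed.

Lemma wnorm_le_length (l : list (C * R)) (B : R) :
  (forall p, In p l -> Cmod (fst p) <= B) -> wnorm l <= INR (length l) * B.
Proof.
  induction l as [|p l IH]; intros H.
  - cbn; unfold wnorm; cbn; lra.
  - rewrite wnorm_cons; cbn [length]; rewrite S_INR.
    generalize (H p (or_introl eq_refl)) (IH (fun q Hq => H q (or_intror Hq))); lra.
Qed.

Lemma exp_le_mono (a b : R) : a <= b -> exp a <= exp b.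
Proof. intros [H| ->]; [apply Rlt_le, exp_increasing, H|apply Rle_refl]. Qed.

Lemma exp_INR_mult (n : nat) (a : R) : exp (INR n * a) = exp a ^ n.
Proof.
  induction n as [|n IH]; [cbn; rewrite Rmult_0_l; apply exp_0|].
  rewrite S_INR, Rmult_plus_distr_r, exp_plus, IH, Rmult_1_l; cbn; ring.
Qed.

Definition spectrum (l : list (C * R)) : list R := nodup Req_dec_T (freqs l).

Lemma spectrum_incl (l : list (C * R)) : incl (freqs l) (spectrum l).
Proof. intros b Hb; apply nodup_In, Hb. Qed.

Lemma length_spectrum_tpow (l : list (C * R)) (n : nat) :
  INR (length (spectrum (tpow l n))) <= INR (S n) ^ length l.
Proof.
  rewrite <- pow_INR; apply le_INR.
  replace (length l) with (length (freqs l)) by apply length_map.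
  rewrite <- length_grid; apply NoDup_incl_length; [apply NoDup_nodup|].
  intros b Hb; apply freqs_tpow_grid; apply nodup_In in Hb; exact Hb.
Qed.

Lemma coef_shiftE (y : R) (l : list (C * R)) (a : R) :
  coef (shiftE y l) a = (coef l a * RtoC (exp (- (a * y))))%C.
Proof.
  induction l as [|p l IH]; [cbn; ring|].
  cbn [shiftE map]; fold (shiftE y l); rewrite !coef_cons, IH; cbn [fst snd].
  destruct (Req_dec_T (snd p) a) as [<-|]; ring.
Qed.

Lemma freqs_shiftE (y : R) (l : list (C * R)) : freqs (shiftE y l) = freqs l.
Proof. unfold freqs, shiftE; rewrite map_map; reflexivity. Qed.

Lemma shiftE_app (y : R) (l m : list (C * R)) : shiftE y (l ++ m) = shiftE y l ++ shiftE y m.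
Proof. apply map_app. Qed.

Lemma shiftE_tmono (y : R) (p : C * R) (l : list (C * R)) :
  shiftE y (tmono p l)
  = tmono ((fst p * RtoC (exp (- (snd p * y))))%C, snd p) (shiftE y l).
Proof.
  unfold tmono, shiftE; rewrite !map_map; apply map_ext; intros q; cbn [fst snd].
  f_equal; rewrite Rmult_plus_distr_r, Ropp_plus_distr, exp_plus, RtoC_mult; ring.
Qed.

Lemma shiftE_tmul (y : R) (l m : list (C * R)) :
  shiftE y (tmul l m) = tmul (shiftE y l) (shiftE y m).
Proof.
  induction l as [|p l IH]; [reflexivity|].
  change (shiftE y (tmono p m ++ tmul l m)
    = tmono ((fst p * RtoC (exp (- (snd p * y))))%C, snd p) (shiftE y m)
      ++ tmul (shiftE y l) (shiftE y m)).
  rewrite shiftE_app, shiftE_tmono, IH; reflexivity.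
Qed.

Lemma shiftE_tpow (y : R) (l : list (C * R)) (n : nat) : shiftE y (tpow l n) = tpow (shiftE y l) n.
Proof.
  induction n as [|n IH].
  - unfold tpow, tconst, shiftE; cbn [map fst snd]; rewrite Rmult_0_l, Ropp_0, exp_0.
    do 2 f_equal; ring.
  - cbn [tpow]; rewrite shiftE_tmul, IH; reflexivity.
Qed.

(* Tensor power trick: the [n]-th power has at most [(n+1)^(length l)] frequencies, so the
   triangle inequality loses only a factor that disappears after taking [n]-th roots. *)
Lemma shiftE_bound (l : list (C * R)) (A F y : R) :
  (forall a, In a (freqs l) -> Rabs a <= A) ->
  (forall x, Cmod (trig_poly l x) <= F) ->
  forall x, Cmod (trig_poly (shiftE y l) x) <= F * exp (A * Rabs y).
Proof.
  intros HA HF x; set (Z := Cmod (trig_poly (shiftE y l) x)); set (Y := F * exp (A * Rabs y)).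
  assert (HF0 : 0 <= F) by (eapply Rle_trans; [apply Cmod_ge_0|apply (HF 0)]).
  assert (HY : 0 <= Y) by (apply Rmult_le_pos; [exact HF0|apply Rlt_le, exp_pos]).
  assert (HZ : 0 <= Z) by apply Cmod_ge_0.
  (* Each coefficient of the [n]-th power is a mean, hence at most [F ^ n], and its frequency is at
     most [n A], so the shift costs at most [exp (A |y|) ^ n]. Only the number of distinct
     frequencies is lost. *)
  assert (K : forall n, Z ^ n <= INR (S n) ^ length l * Y ^ n).
  { intros n; unfold Z; rewrite <- Cmod_pow, <- trig_poly_tpow, <- shiftE_tpow.
    rewrite <- (trig_poly_collect _ (spectrum (tpow l n))).
    - eapply Rle_trans; [apply Cmod_trig_poly_le|].
      eapply Rle_trans; [apply (wnorm_le_length _ (Y ^ n))|].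
      + intros p Hp; apply in_map_iff in Hp; destruct Hp as [b [<- Hb]]; cbn [fst].
        rewrite coef_shiftE, Cmod_mult, Cmod_R, Rabs_pos_eq by (apply Rlt_le, exp_pos).
        unfold Y; rewrite Rpow_mult_distr; apply Rmult_le_compat.
        * apply Cmod_ge_0.
        * apply Rlt_le, exp_pos.
        * rewrite <- bohr_trig_poly; apply bohr_le; [apply AP_trig_poly|].
          intros t; rewrite trig_poly_tpow, Cmod_pow; apply pow_incr.
          split; [apply Cmod_ge_0|apply HF].
        * rewrite <- exp_INR_mult; apply exp_le_mono.
          apply nodup_In in Hb.
          apply (freqs_tpow_bound l A n b HA) in Hb.
          assert (- (b * y) <= Rabs b * Rabs y).
          { rewrite <- Rabs_mult, <- Rabs_Ropp; apply Rle_abs. }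
          assert (Rabs b * Rabs y <= INR n * A * Rabs y)
            by (apply Rmult_le_compat_r; [apply Rabs_pos|exact Hb]).
          lra.
      + unfold tlist; rewrite length_map; apply Rmult_le_compat_r.
        * apply pow_le, HY.
        * apply length_spectrum_tpow.
    - apply NoDup_nodup.
    - rewrite freqs_shiftE; apply spectrum_incl. }
  (* If [Y < Z], the geometric decay of [(Y / Z) ^ n] beats the polynomial factor. *)
  destruct (Rle_or_lt Z Y) as [|HZY]; [assumption|exfalso].
  destruct (poly_exp_small (length l) (Y / Z) 1) as [n Hn].
  { split; [apply Rdiv_le_0_compat; lra|].
    apply (Rmult_lt_reg_r Z); [lra|]; unfold Rdiv; rewrite Rmult_assoc, Rinv_l; lra. }
  { lra. }
  specialize (K n).
  assert (HZn : 0 < Z ^ n) by (apply pow_lt; lra).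
  unfold Rdiv in Hn; rewrite Rpow_mult_distr, pow_inv, <- Rmult_assoc in Hn.
  apply (Rmult_lt_compat_r (Z ^ n)) in Hn; [|exact HZn].
  rewrite Rmult_assoc, Rinv_l in Hn; lra.
Qed.

(** * Bochner-Fejer approximation *)

Definition cos_sum (s : list R) (t : R) : R :=
  fold_right Rplus 0 (map (fun a => (1 + cos (a * t)) / 2) s).

(** An average of 1 and the functions [(1 + cos (a t)) / 2]: it lies in [[0, 1]] and is close to 1
    only where every [e_a] with [a] in [s] is close to 1. Its high powers, divided by their mean, do
    the work of a product of Fejer kernels. *)
Definition kernel (s : list R) (t : R) : R := (1 + cos_sum s t) / INR (S (length s)).

Definition kernel_poly (s : list R) : list (C * R) :=
  tmono (RtoC (/ INR (S (length s))), 0)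
    ((RtoC 1, 0) :: flat_map
      (fun a => [(RtoC (1 / 2), 0); (RtoC (1 / 4), a); (RtoC (1 / 4), - a)]) s).

Lemma trig_poly_kernel (s : list R) (t : R) : trig_poly (kernel_poly s) t = RtoC (kernel s t).
Proof.
  unfold kernel_poly; rewrite trig_poly_tmono, trig_poly_cons; cbn [fst snd].
  replace (kernel s t) with (/ INR (S (length s)) * (1 + cos_sum s t))
    by (unfold kernel, Rdiv; ring).
  rewrite RtoC_mult, !e_zero, RtoC_plus.
  match goal with |- (_ * (_ + ?u))%C = _ => replace u with (RtoC (cos_sum s t)); [ring|] end.
  symmetry; induction s as [|a s IH]; [reflexivity|].
  cbn [flat_map]; rewrite trig_poly_app, IH, !trig_poly_cons; cbn [fst snd].
  rewrite e_zero, <- Cconj_e; unfold cos_sum; cbn [map fold_right].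
  apply injective_projections; unfold e, Cconj, trig_poly; cbn; field.
Qed.

Lemma cos_sum_bounds (s : list R) (t : R) :
  0 <= cos_sum s t <= INR (length s) /\
  forall a, In a s -> (1 - cos (a * t)) / 2 <= INR (length s) - cos_sum s t.
Proof.
  induction s as [|b s [IH1 IH2]].
  - split; [cbn; lra|intros a []].
  - change (cos_sum (b :: s) t) with ((1 + cos (b * t)) / 2 + cos_sum s t).
    cbn [length]; rewrite S_INR; generalize (COS_bound (b * t)); intros Hb.
    split; [lra|]; intros a [->|Ha]; [lra|specialize (IH2 a Ha); lra].
Qed.

Lemma kernel_bounds (s : list R) (t : R) : 0 <= kernel s t <= 1.
Proof.
  destruct (cos_sum_bounds s t) as [[H1 H2] _]; unfold kernel.
  rewrite S_INR; assert (Hn := pos_INR (length s)); split.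
  - apply Rdiv_le_0_compat; lra.
  - apply (Rmult_le_reg_r (INR (length s) + 1)); [lra|].
    unfold Rdiv; rewrite Rmult_assoc, Rinv_l; lra.
Qed.

Lemma kernel_zero (s : list R) : kernel s 0 = 1.
Proof.
  unfold kernel; replace (cos_sum s 0) with (INR (length s)).
  - rewrite S_INR; field; generalize (pos_INR (length s)); lra.
  - induction s as [|b s IH]; [reflexivity|].
    change (cos_sum (b :: s) 0) with ((1 + cos (b * 0)) / 2 + cos_sum s 0).
    cbn [length]; rewrite S_INR, <- IH, Rmult_0_r, cos_0; field.
Qed.

(** [|e_a - 1|^2] is four times [(1 - cos (a t)) / 2], which is one of the nonnegative terms summing
    up to [length s - cos_sum s t]. *)
Lemma kernel_almost_period (s : list R) (t a : R) :
  In a s -> Cmod (e a t - 1)%C ^ 2 <= 4 * INR (S (length s)) * (1 - kernel s t).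
Proof.
  intros Ha; destruct (cos_sum_bounds s t) as [_ H]; specialize (H a Ha).
  rewrite Cmod2_alt.
  replace (4 * INR (S (length s)) * (1 - kernel s t)) with (4 * (INR (length s) - cos_sum s t)).
  - unfold e, Cminus, Cplus, Copp, RtoC, Re, Im; cbn [fst snd].
    generalize (sin2_cos2 (a * t)); unfold Rsqr; intros; nra.
  - unfold kernel; rewrite S_INR; field; generalize (pos_INR (length s)); lra.
Qed.

Lemma trig_poly_diff_bound (l : list (C * R)) (x t D : R) :
  (forall a, In a (freqs l) -> Cmod (e a t - 1)%C <= D) ->
  Cmod (trig_poly l (x + t) - trig_poly l x)%C <= wnorm l * D.
Proof.
  induction l as [|p l IH]; intros H.
  - unfold trig_poly, wnorm; cbn; replace (0 - 0)%C with (RtoC 0) by ring; rewrite Cmod_0; lra.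
  - rewrite !trig_poly_cons, wnorm_cons, e_add_arg.
    replace (fst p * (e (snd p) x * e (snd p) t) + trig_poly l (x + t)%R
      - (fst p * e (snd p) x + trig_poly l x))%C
      with (fst p * e (snd p) x * (e (snd p) t - 1) + (trig_poly l (x + t)%R - trig_poly l x))%C
      by ring.
    eapply Rle_trans; [apply Cmod_triangle|]; rewrite !Cmod_mult, Cmod_e, Rmult_1_r.
    assert (K := IH (fun a Ha => H a (or_intror Ha))).
    assert (Cmod (fst p) * Cmod (e (snd p) t - 1)%C <= Cmod (fst p) * D).
    { apply Rmult_le_compat_l; [apply Cmod_ge_0|apply H; left; reflexivity]. }
    lra.
Qed.

Lemma trig_poly_filter (keep : C * R -> bool) (l : list (C * R)) (x : R) :
  (forall p, In p l -> keep p = false -> fst p = RtoC 0) ->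
  trig_poly (filter keep l) x = trig_poly l x.
Proof.
  induction l as [|p l IH]; intros H; [reflexivity|].
  cbn [filter]; rewrite trig_poly_cons.
  destruct (keep p) eqn:E.
  - rewrite trig_poly_cons, IH; [reflexivity|intros q Hq; apply H; right; exact Hq].
  - rewrite (H p (or_introl eq_refl) E), IH;
      [ring|intros q Hq; apply H; right; exact Hq].
Qed.

Lemma NoDup_freqs_filter (keep : C * R -> bool) (l : list (C * R)) :
  NoDup (freqs l) -> NoDup (freqs (filter keep l)).
Proof.
  induction l as [|p l IH]; intros H; [constructor|].
  cbn in H; inversion H as [|? ? Hp Hl]; subst; cbn [filter].
  destruct (keep p); [|apply IH, Hl]; cbn; constructor; [|apply IH, Hl].
  intros K; apply Hp; apply in_map_iff in K; destruct K as [q [E Hq]].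
  apply filter_In in Hq; rewrite <- E; apply in_map, Hq.
Qed.

Lemma M_Cmult_trig_poly (h : R -> C) (l : list (C * R)) :
  AP h ->
  M (fun t => (trig_poly l t * h t)%C)
  = fold_right Cplus (RtoC 0) (map (fun p => (fst p * bohr h (- snd p))%C) l).
Proof.
  intros Hh; induction l as [|p l IH].
  - rewrite (M_ext _ (fun _ => RtoC 0)) by (intros; cbn; ring); apply M_const.
  - cbn [map fold_right]; rewrite <- IH.
    rewrite (M_ext _ (fun t => (fst p * (e (snd p) t * h t) + trig_poly l t * h t)%C))
      by (intros; rewrite trig_poly_cons; ring).
    rewrite M_plus.
    + rewrite M_Cmult by (apply AP_mult; [apply AP_e|exact Hh]).
      unfold bohr; rewrite Ropp_involutive; reflexivity.
    + apply AP_mult; [apply AP_const|apply AP_mult; [apply AP_e|exact Hh]].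
    + apply AP_mult; [apply AP_trig_poly|exact Hh].
Qed.

Lemma Cmod_le_fst (z : C) : Cmod z <= fst z -> z = RtoC (fst z).
Proof.
  intros H; apply injective_projections; [reflexivity|]; cbn.
  assert (H2 := Cmod2_alt z); unfold Re, Im in H2; assert (H3 := Cmod_ge_0 z).
  assert (snd z ^ 2 <= 0) by nra; nra.
Qed.

(** The approximant is the mean over [t] of [K(t) f(x + t)], divided by the mean [m] of
    [K = kernel ^ n]. As [K >= 0], its coefficients are at most [m], so each coefficient of the
    approximant is dominated by that of [f]. The mass of [K] away from the almost periods is at most
    [(1 - eta) ^ n], whereas counting frequencies shows that [m] decreases only polynomially. *)
Lemma bochner_fejer (f : R -> C) (eps : R) :
  AP f -> 0 < eps ->
  exists l : list (C * R),
    NoDup (freqs l) /\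
    (forall p, In p l -> Omega f (snd p) /\ Cmod (fst p) <= Cmod (bohr f (snd p))) /\
    forall x, Cmod (f x - trig_poly l x)%C < eps.
Proof.
  (* Three parts serve the almost periods, one the remaining [t], and the fifth makes the inequality
     strict. *)
  intros Hf Heps; set (d := eps / 5).
  assert (Hd : 0 < d) by (unfold d; lra).
  destruct (Hf d Hd) as [l0 Hl0]; destruct (bounded_AP f Hf) as [F [HF0 HF]].
  set (s := freqs l0); set (N1 := INR (S (length s))).
  assert (HN1 : 0 < N1) by (apply lt_0_INR; lia).
  set (D := d / (wnorm l0 + 1)).
  assert (Hw := wnorm_ge_0 l0).
  assert (HD : 0 < D) by (apply Rdiv_lt_0_compat; lra).
  assert (HDw : wnorm l0 * D <= d).
  { apply Rle_trans with ((wnorm l0 + 1) * D); [nra|right; unfold D; field; lra]. }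
  (* By [kernel_almost_period], [1 - kernel <= eta] gives [|e_a - 1| <= D] for all frequencies of
     [l0], so [l0] moves by at most [d] under the translation. *)
  set (eta := Rmin (1 / 2) (D ^ 2 / (4 * N1))).
  assert (Heta : 0 < eta <= 1 / 2).
  { split; [|apply Rmin_l]; apply Rmin_pos; [lra|].
    apply Rdiv_lt_0_compat; [apply pow_lt, HD|lra]. }
  assert (Heta2 : 4 * N1 * eta <= D ^ 2).
  { apply Rle_trans with (4 * N1 * (D ^ 2 / (4 * N1))); [|right; field; lra].
    apply Rmult_le_compat_l; [lra|apply Rmin_r]. }
  destruct (poly_exp_small (length (kernel_poly s)) (1 - eta) (d / (2 * F))) as [n Hn].
  { lra. }
  { apply Rdiv_lt_0_compat; lra. }
  set (K := tpow (kernel_poly s) n).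
  assert (HK : forall t, trig_poly K t = RtoC (kernel s t ^ n)).
  { intros t; unfold K; rewrite trig_poly_tpow, trig_poly_kernel, RtoC_pow; reflexivity. }
  assert (HKpos : forall t, 0 <= kernel s t ^ n) by (intros t; apply pow_le, kernel_bounds).
  set (m := fst (M (trig_poly K))).
  assert (HKle : forall t, Cmod (trig_poly K t) <= fst (trig_poly K t)).
  { intros t; rewrite HK, Cmod_R, Rabs_pos_eq by apply HKpos; cbn; lra. }
  assert (Hm : M (trig_poly K) = RtoC m).
  { apply Cmod_le_fst; apply M_le; auto using AP_trig_poly. }
  assert (HKc : forall b, Cmod (coef K b) <= m).
  { intros b; rewrite <- bohr_trig_poly; apply bohr_le_M; auto using AP_trig_poly. }
  assert (Hm0 : 0 <= m) by (eapply Rle_trans; [apply (Cmod_ge_0 (coef K 0))|apply HKc]).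
  set (P := INR (S n) ^ length (kernel_poly s)) in *.
  (* [K] equals 1 at 0 and is there a sum of at most [P] coefficients, each at most [m]. *)
  assert (Hm1 : 1 <= P * m).
  { assert (E : trig_poly (tlist (coef K) (spectrum K)) 0 = RtoC 1).
    { rewrite trig_poly_collect; [|apply NoDup_nodup|apply spectrum_incl].
      rewrite HK, kernel_zero, pow1; reflexivity. }
    rewrite <- Cmod_1, <- E.
    eapply Rle_trans; [apply Cmod_trig_poly_le|].
    eapply Rle_trans; [apply (wnorm_le_length _ m)|].
    - intros p Hp; apply in_map_iff in Hp; destruct Hp as [b [<- _]]; apply HKc.
    - unfold tlist; rewrite length_map; apply Rmult_le_compat_r; [exact Hm0|].
      apply length_spectrum_tpow. }
  assert (HP : 0 < P) by (apply pow_lt, lt_0_INR; lia).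
  assert (Hm2 : 0 < m) by nra.
  set (q := (1 - eta) ^ n) in *.
  assert (Hq : 0 < q) by (apply pow_lt; lra).
  (* Either [t] is an almost period and [f] moves by at most [3 d], or [kernel ^ n <= q] and the
     trivial bound [2 F] is enough. *)
  assert (Hpt : forall x t,
    Cmod (trig_poly K t * (f (x + t)%R - f x))%C <= 3 * d * kernel s t ^ n + 2 * F * q).
  { intros x t; rewrite Cmod_mult, HK, Cmod_R, Rabs_pos_eq by apply HKpos.
    specialize (HKpos t).
    destruct (Rle_or_lt (1 - kernel s t) eta) as [Hk|Hk].
    - assert (Cmod (f (x + t)%R - f x)%C <= 3 * d).
      { replace (f (x + t)%R - f x)%C with ((f (x + t)%R - trig_poly l0 (x + t)%R)
          + ((trig_poly l0 (x + t)%R - trig_poly l0 x) + - (f x - trig_poly l0 x)))%C by ring.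
        eapply Rle_trans; [apply Cmod_triangle|].
        eapply Rle_trans; [apply Rplus_le_compat_l, Cmod_triangle|]; rewrite Cmod_opp.
        assert (Cmod (trig_poly l0 (x + t)%R - trig_poly l0 x)%C <= wnorm l0 * D).
        { apply trig_poly_diff_bound; intros a Ha.
          assert (Ka := kernel_almost_period s t a Ha); fold N1 in Ka.
          assert (Cmod (e a t - 1)%C ^ 2 <= D ^ 2).
          { eapply Rle_trans; [exact Ka|]; eapply Rle_trans; [|exact Heta2].
            apply Rmult_le_compat_l; lra. }
          generalize (Cmod_ge_0 (e a t - 1)%C); intros; nra. }
        generalize (Hl0 (x + t)) (Hl0 x); lra. }
      assert (kernel s t ^ n * Cmod (f (x + t)%R - f x)%C <= kernel s t ^ n * (3 * d))
        by (apply Rmult_le_compat_l; assumption).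
      assert (0 <= 2 * F * q) by (apply Rmult_le_pos; lra).
      lra.
    - assert (kernel s t ^ n <= q).
      { apply pow_incr; generalize (kernel_bounds s t); lra. }
      assert (Cmod (f (x + t)%R - f x)%C <= 2 * F).
      { unfold Cminus; eapply Rle_trans; [apply Cmod_triangle|]; rewrite Cmod_opp.
        generalize (HF (x + t)) (HF x); lra. }
      assert (kernel s t ^ n * Cmod (f (x + t)%R - f x)%C <= q * (2 * F)).
      { apply Rmult_le_compat; auto; apply Cmod_ge_0. }
      assert (0 <= 3 * d * kernel s t ^ n) by (apply Rmult_le_pos; lra).
      lra. }
  (* A frequency [b] of [K] picks out the coefficient of [f] at [- b], whence the signs. *)
  set (full := map (fun b => ((coef K b * bohr f (- b) / RtoC m)%C, - b)) (spectrum K)).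
  assert (HmC : RtoC m <> RtoC 0) by (intros E; injection E; lra).
  assert (Hfull : forall x,
    M (fun t => (trig_poly K t * f (x + t)%R)%C) = (RtoC m * trig_poly full x)%C).
  { intros x.
    rewrite (M_ext _ (fun t => (trig_poly (tlist (coef K) (spectrum K)) t * f (x + t)%R)%C)).
    - rewrite M_Cmult_trig_poly by apply AP_translate, Hf.
      unfold full, tlist, trig_poly; rewrite !map_map; cbn [fst snd].
      induction (spectrum K) as [|b u IH]; [cbn; ring|].
      cbn [map fold_right]; rewrite IH, bohr_translate by exact Hf; field; exact HmC.
    - intros t; rewrite trig_poly_collect; [reflexivity|apply NoDup_nodup|apply spectrum_incl]. }
  assert (Hfin : forall x, Cmod (f x - trig_poly full x)%C < eps).
  { intros x.
    assert (HAP : AP (fun t => (f (x + t)%R - f x)%C))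
      by (apply AP_minus; [apply AP_translate, Hf|apply AP_const]).
    assert (E : M (fun t => (trig_poly K t * (f (x + t)%R - f x))%C)
      = (RtoC m * (trig_poly full x - f x))%C).
    { rewrite (M_ext _ (fun t => (trig_poly K t * f (x + t)%R + (- f x) * trig_poly K t)%C))
        by (intros t; ring).
      rewrite M_plus, Hfull, M_Cmult, Hm; [ring|apply AP_trig_poly| |].
      - apply AP_mult; [apply AP_trig_poly|apply AP_translate, Hf].
      - apply AP_mult; [apply AP_const|apply AP_trig_poly]. }
    assert (Hb : Cmod (RtoC m * (trig_poly full x - f x))%C <= 3 * d * m + 2 * F * q).
    { rewrite <- E.
      replace (3 * d * m + 2 * F * q)
        with (fst (M (fun t => (RtoC (3 * d) * trig_poly K t + RtoC (2 * F * q))%C))).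
      - apply M_le.
        + apply AP_mult; [apply AP_trig_poly|exact HAP].
        + apply AP_plus; [|apply AP_const].
          apply AP_mult; [apply AP_const|apply AP_trig_poly].
        + intros t; eapply Rle_trans; [apply Hpt|]; rewrite HK; cbn; lra.
      - rewrite M_plus, M_Cmult, M_const, Hm; [cbn; ring|apply AP_trig_poly| |apply AP_const].
        apply AP_mult; [apply AP_const|apply AP_trig_poly]. }
    rewrite Cmod_mult, Cmod_R, Rabs_pos_eq in Hb by lra.
    replace (f x - trig_poly full x)%C with (- (trig_poly full x - f x))%C by ring.
    rewrite Cmod_opp.
    assert (Hq2 : 2 * F * q <= m * d).
    { apply (Rmult_lt_compat_l (2 * F)) in Hn; [|lra].
      replace (2 * F * (d / (2 * F))) with d in Hn by (field; lra).
      assert (q <= P * m * q) by nra.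
      assert (2 * F * q <= m * (2 * F * (P * q))) by nra.
      nra. }
    apply (Rmult_lt_reg_l m); [exact Hm2|].
    assert (m * eps = 5 * (m * d)) by (unfold d; field).
    assert (0 < m * d) by (apply Rmult_lt_0_compat; lra).
    lra. }
  (* Discarding the zero terms leaves the function unchanged and puts every frequency in
     [Omega f]. *)
  exists (filter (fun p => if excluded_middle_informative (bohr f (snd p) = RtoC 0)
    then false else true) full).
  assert (Hfreq : NoDup (freqs full)).
  { unfold full, freqs; rewrite map_map; cbn [snd].
    apply NoDup_map_NoDup_ForallPairs; [|apply NoDup_nodup].
    intros a b _ _ E; lra. }
  split; [apply NoDup_freqs_filter, Hfreq|split].
  - intros p Hp; apply filter_In in Hp; destruct Hp as [Hp Hkeep].
    split; [unfold Omega; destruct (excluded_middle_informative (bohr f (snd p) = RtoC 0));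
      congruence|].
    apply in_map_iff in Hp; destruct Hp as [b [<- _]]; cbn [fst snd].
    rewrite Cmod_div, Cmod_mult, Cmod_R, Rabs_pos_eq by (assumption || lra).
    apply (Rmult_le_reg_r m); [exact Hm2|].
    unfold Rdiv; rewrite Rmult_assoc, Rinv_l, Rmult_1_r by lra.
    rewrite Rmult_comm; apply Rmult_le_compat_l; [apply Cmod_ge_0|apply HKc].
  - intros x; rewrite trig_poly_filter; [apply Hfin|].
    intros p Hp Hkeep.
    destruct (excluded_middle_informative (bohr f (snd p) = RtoC 0)) as [E|E]; [|discriminate].
    apply in_map_iff in Hp; destruct Hp as [b [<- _]]; cbn [fst snd] in *.
    rewrite E; field; exact HmC.
Qed.

(** * Spectra and the Wiener algebra *)

Definition freqs_in (S : R -> Prop) (l : list (C * R)) : Prop := forall p, In p l -> S (snd p).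

Lemma freqs_in_app (S : R -> Prop) (l m : list (C * R)) :
  freqs_in S l -> freqs_in S m -> freqs_in S (l ++ m).
Proof. intros Hl Hm p Hp; apply in_app_iff in Hp; destruct Hp; auto. Qed.

Lemma freqs_in_tmul (S1 S2 S3 : R -> Prop) (l m : list (C * R)) :
  (forall a b, S1 a -> S2 b -> S3 (a + b)) ->
  freqs_in S1 l -> freqs_in S2 m -> freqs_in S3 (tmul l m).
Proof.
  intros HS Hl Hm p Hp; apply in_tmul in Hp; destruct Hp as [q [r [Hq [Hr [_ ->]]]]]; auto.
Qed.

(** Spectral inclusion stated by approximation, so that sums and products need no computation of
    Bohr coefficients; [APin_intro] and [APin_Omega] give the agreement with [Omega]. *)
Definition APin (S : R -> Prop) : (R -> C) -> Prop := Approx (freqs_in S).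

Lemma APin_AP (S : R -> Prop) (f : R -> C) : APin S f -> AP f.
Proof. apply Approx_AP. Qed.

(** Arbitrary uniform approximants may have frequencies anywhere; those of [bochner_fejer] stay in
    [Omega f]. *)
Lemma APin_intro (S : R -> Prop) (f : R -> C) :
  AP f -> (forall a, Omega f a -> S a) -> APin S f.
Proof.
  intros Hf HS eps Heps; destruct (bochner_fejer f eps Hf Heps) as [l [_ [H1 H2]]].
  exists l; split; [intros p Hp; apply HS, H1, Hp|exact H2].
Qed.

Lemma APin_Omega (S : R -> Prop) (f : R -> C) (a : R) : APin S f -> Omega f a -> S a.
Proof.
  intros H Ha; destruct (excluded_middle_informative (S a)) as [|Hn]; [assumption|exfalso].
  apply Ha, Cmod_eq_eps; intros eps Heps.
  destruct (H eps Heps) as [l [Hl1 Hl2]].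
  replace (RtoC 0) with (bohr (trig_poly l) a).
  - apply bohr_approx; [apply (APin_AP S), H|apply AP_trig_poly|].
    intros x; apply Rlt_le, Hl2.
  - rewrite bohr_trig_poly; apply coef_notin; intros K; apply Hn.
    apply in_map_iff in K; destruct K as [p [<- Hp]]; apply Hl1, Hp.
Qed.

Lemma APin_ext (S : R -> Prop) (f g : R -> C) : (forall x, f x = g x) -> APin S f -> APin S g.
Proof. apply Approx_ext. Qed.

Lemma APin_mono (S S' : R -> Prop) (f : R -> C) :
  (forall a, S a -> S' a) -> APin S f -> APin S' f.
Proof. intros HS; apply Approx_mono; intros l Hl p Hp; apply HS, Hl, Hp. Qed.

(** The uniqueness theorem: the spectrum is empty, so the Bochner-Fejer approximants are empty
    sums. *)
Lemma APin_disjoint (S S' : R -> Prop) (f : R -> C) :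
  APin S f -> APin S' f -> (forall a, S a -> S' a -> False) -> forall x, f x = RtoC 0.
Proof.
  intros H H' Hd x; apply Cmod_eq_eps; intros eps Heps.
  destruct (bochner_fejer f eps (APin_AP _ _ H) Heps) as [[|p l] [_ [H1 H2]]].
  - apply Rlt_le, (H2 x).
  - exfalso; destruct (H1 p (or_introl eq_refl)) as [HO _].
    apply (Hd (snd p)); eapply APin_Omega; eassumption.
Qed.

Lemma APin_plus (S : R -> Prop) (f g : R -> C) :
  APin S f -> APin S g -> APin S (fun x => (f x + g x)%C).
Proof. intros Hf Hg; apply (Approx_plus _ _ _ _ _ Hf Hg), freqs_in_app. Qed.

Lemma APin_mult (S1 S2 S3 : R -> Prop) (f g : R -> C) :
  APin S1 f -> APin S2 g -> (forall a b, S1 a -> S2 b -> S3 (a + b)) ->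
  APin S3 (fun x => (f x * g x)%C).
Proof.
  intros Hf Hg HS; apply (Approx_mult _ _ _ _ _ Hf Hg).
  intros l m; apply freqs_in_tmul, HS.
Qed.

Lemma APin_trig_poly (S : R -> Prop) (l : list (C * R)) : freqs_in S l -> APin S (trig_poly l).
Proof. apply Approx_trig_poly. Qed.

Lemma APin_const (S : R -> Prop) (c : C) : S 0 -> APin S (fun _ => c).
Proof.
  intros H; apply (APin_ext _ (trig_poly (tconst c))); [apply trig_poly_tconst|].
  apply APin_trig_poly; intros p [<-|[]]; exact H.
Qed.

Lemma APin_e (S : R -> Prop) (a : R) : S a -> APin S (e a).
Proof.
  intros H; apply (APin_ext _ (trig_poly [(RtoC 1, a)])); [intros x; cbn; ring|].
  apply APin_trig_poly; intros p [<-|[]]; exact H.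
Qed.

Lemma APin_Cmult (S : R -> Prop) (c : C) (f : R -> C) :
  APin S f -> APin S (fun x => (c * f x)%C).
Proof.
  intros H; apply (APin_mult (fun a => a = 0) S S (fun _ => c)); [apply APin_const; reflexivity|exact H|].
  intros a b -> Hb; rewrite Rplus_0_l; exact Hb.
Qed.

Lemma APin_opp (S : R -> Prop) (f : R -> C) : APin S f -> APin S (fun x => (- f x)%C).
Proof.
  intros H; apply (APin_ext _ (fun x => (RtoC (-1) * f x)%C)); [|apply APin_Cmult, H].
  intros x; apply injective_projections; cbn; ring.
Qed.

Lemma APin_minus (S : R -> Prop) (f g : R -> C) :
  APin S f -> APin S g -> APin S (fun x => (f x - g x)%C).
Proof. intros Hf Hg; apply APin_plus; [exact Hf|apply APin_opp, Hg]. Qed.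

Lemma APin_e_mult (S S' : R -> Prop) (b : R) (f : R -> C) :
  APin S f -> (forall a, S a -> S' (b + a)) -> APin S' (fun x => (e b x * f x)%C).
Proof.
  intros H HS; apply (APin_mult (fun a => a = b) S); [apply APin_e; reflexivity|exact H|].
  intros a a' ->; apply HS.
Qed.

(* A closed ball of the Wiener algebra, as the uniform closure of trigonometric polynomials. *)
Definition WBin (S : R -> Prop) (B : R) : (R -> C) -> Prop :=
  Approx (fun l => freqs_in S l /\ wnorm l <= B).

Lemma WBin_APin (S : R -> Prop) (B : R) (f : R -> C) : WBin S B f -> APin S f.
Proof. apply Approx_mono; intros l [H _]; exact H. Qed.

Lemma WBin_AP (S : R -> Prop) (B : R) (f : R -> C) : WBin S B f -> AP f.
Proof. apply Approx_AP. Qed.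

Lemma WBin_ge_0 (S : R -> Prop) (B : R) (f : R -> C) : WBin S B f -> 0 <= B.
Proof.
  intros H; destruct (H 1 Rlt_0_1) as [l [[_ Hl] _]]; generalize (wnorm_ge_0 l); lra.
Qed.

Lemma WBin_ext (S : R -> Prop) (B : R) (f g : R -> C) :
  (forall x, f x = g x) -> WBin S B f -> WBin S B g.
Proof. apply Approx_ext. Qed.

Lemma WBin_mono (S S' : R -> Prop) (B B' : R) (f : R -> C) :
  (forall a, S a -> S' a) -> B <= B' -> WBin S B f -> WBin S' B' f.
Proof.
  intros HS HB; apply Approx_mono; intros l [H1 H2]; split; [|lra].
  intros p Hp; apply HS, H1, Hp.
Qed.

(** A Wiener ball is closed even for the weaker uniform norm. Inverses and spectral pieces can thus
    be built as uniform limits without losing the norm bound. *)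
Lemma WBin_unif_closed (S : R -> Prop) (B : R) (f : R -> C) :
  (forall eps, 0 < eps -> exists g, WBin S B g /\ forall x, Cmod (f x - g x)%C < eps) ->
  WBin S B f.
Proof.
  intros H eps Heps; destruct (H (eps / 2)) as [g [Hg Hfg]]; [lra|].
  destruct (Hg (eps / 2)) as [l [H1 H3]]; [lra|]; exists l; split; [exact H1|]; intros x.
  replace (f x - trig_poly l x)%C with ((f x - g x) + (g x - trig_poly l x))%C by ring.
  eapply Rle_lt_trans; [apply Cmod_triangle|]; generalize (Hfg x) (H3 x); lra.
Qed.

Lemma WBin_bound (S : R -> Prop) (B : R) (f : R -> C) :
  WBin S B f -> forall x, Cmod (f x) <= B.
Proof.
  intros H x; apply Rle_plus_epsilon; intros eps Heps.
  destruct (H eps Heps) as [l [[_ H2] H3]].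
  replace (f x) with (trig_poly l x + (f x - trig_poly l x))%C by ring.
  eapply Rle_trans; [apply Cmod_triangle|].
  generalize (H3 x) (Cmod_trig_poly_le l x); lra.
Qed.

Lemma WBin_trig_poly (S : R -> Prop) (l : list (C * R)) :
  freqs_in S l -> WBin S (wnorm l) (trig_poly l).
Proof. intros H; apply Approx_trig_poly; split; [exact H|apply Rle_refl]. Qed.

Lemma WBin_plus (S : R -> Prop) (B1 B2 : R) (f g : R -> C) :
  WBin S B1 f -> WBin S B2 g -> WBin S (B1 + B2) (fun x => (f x + g x)%C).
Proof.
  intros Hf Hg; apply (Approx_plus _ _ _ _ _ Hf Hg); intros l m [Hl1 Hl2] [Hm1 Hm2].
  split; [apply freqs_in_app; assumption|rewrite wnorm_app; lra].
Qed.

Lemma WBin_mult (S1 S2 S3 : R -> Prop) (B1 B2 : R) (f g : R -> C) :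
  WBin S1 B1 f -> WBin S2 B2 g -> (forall a b, S1 a -> S2 b -> S3 (a + b)) ->
  WBin S3 (B1 * B2) (fun x => (f x * g x)%C).
Proof.
  intros Hf Hg HS; apply (Approx_mult _ _ _ _ _ Hf Hg); intros l m [Hl1 Hl2] [Hm1 Hm2].
  split; [apply (freqs_in_tmul S1 S2); assumption|rewrite wnorm_tmul].
  apply Rmult_le_compat; auto using wnorm_ge_0.
Qed.

Lemma WBin_const (S : R -> Prop) (c : C) : S 0 -> WBin S (Cmod c) (fun _ => c).
Proof.
  intros H; apply (WBin_ext _ _ (trig_poly (tconst c))); [apply trig_poly_tconst|].
  apply (WBin_mono S S (wnorm (tconst c))); auto.
  - unfold wnorm; cbn; lra.
  - apply WBin_trig_poly; intros p [<-|[]]; exact H.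
Qed.

Lemma WBin_Cmult (S : R -> Prop) (B : R) (c : C) (f : R -> C) :
  WBin S B f -> WBin S (Cmod c * B) (fun x => (c * f x)%C).
Proof.
  intros H; apply (WBin_mult (fun a => a = 0) S S _ _ (fun _ => c)).
  - apply WBin_const; reflexivity.
  - exact H.
  - intros a b -> Hb; rewrite Rplus_0_l; exact Hb.
Qed.

Lemma WBin_opp (S : R -> Prop) (B : R) (f : R -> C) : WBin S B f -> WBin S B (fun x => (- f x)%C).
Proof.
  intros H; apply (WBin_ext _ _ (fun x => (RtoC (-1) * f x)%C)).
  - intros x; apply injective_projections; cbn; ring.
  - apply (WBin_mono S S (Cmod (RtoC (-1)) * B)); auto.
    + rewrite Cmod_R, Rabs_left; lra.
    + apply WBin_Cmult, H.
Qed.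

Lemma WBin_reflect (S : R -> Prop) (B : R) (f : R -> C) :
  WBin S B f -> WBin (fun a => S (- a)) B (fun x => f (- x)).
Proof.
  intros H eps Heps; destruct (H eps Heps) as [l [[H1 H2] H3]]; exists (trefl l); repeat split.
  - intros p Hp; apply in_map_iff in Hp; destruct Hp as [q [<- Hq]]; cbn [snd].
    rewrite Ropp_involutive; apply H1, Hq.
  - replace (wnorm (trefl l)) with (wnorm l); [exact H2|].
    unfold wnorm, trefl; rewrite map_map; reflexivity.
  - intros x; rewrite trig_poly_trefl; apply H3.
Qed.

Definition bohr_sum (f : R -> C) (s : list R) : R :=
  fold_right Rplus 0 (map (fun a => Cmod (bohr f a)) s).

Lemma bohr_sum_cons (f : R -> C) (a : R) (s : list R) :
  bohr_sum f (a :: s) = Cmod (bohr f a) + bohr_sum f s.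
Proof. reflexivity. Qed.

Lemma bohr_sum_app (f : R -> C) (s t : list R) :
  bohr_sum f (s ++ t) = bohr_sum f s + bohr_sum f t.
Proof.
  induction s as [|a s IH]; cbn [app]; [unfold bohr_sum at 2; cbn; ring|].
  rewrite !bohr_sum_cons, IH; ring.
Qed.

Lemma bohr_sum_ext (f g : R -> C) (s : list R) :
  (forall a, In a s -> bohr f a = bohr g a) -> bohr_sum f s = bohr_sum g s.
Proof.
  intros H; unfold bohr_sum; rewrite (map_ext_in _ (fun a => Cmod (bohr g a)) s); [reflexivity|].
  intros a Ha; apply (f_equal Cmod), H, Ha.
Qed.

Lemma coef_sum_le (l : list (C * R)) (s : list R) :
  NoDup s -> fold_right Rplus 0 (map (fun a => Cmod (coef l a)) s) <= wnorm l.
Proof.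
  intros Hs; induction l as [|p l IH].
  - clear Hs; change (wnorm []) with 0; induction s as [|a s IH]; [cbn; lra|].
    cbn [map fold_right]; change (coef [] a) with (RtoC 0); rewrite Cmod_0; lra.
  - rewrite wnorm_cons.
    assert (K : forall s, fold_right Rplus 0 (map (fun a => Cmod (coef (p :: l) a)) s)
      <= fold_right Rplus 0 (map (fun a => if Req_dec_T (snd p) a then Cmod (fst p) else 0) s)
         + fold_right Rplus 0 (map (fun a => Cmod (coef l a)) s)).
    { clear; induction s as [|a s IH]; cbn [map fold_right]; [lra|].
      assert (Cmod (coef (p :: l) a) <= (if Req_dec_T (snd p) a then Cmod (fst p) else 0)
        + Cmod (coef l a)).
      { rewrite coef_cons; eapply Rle_trans; [apply Cmod_triangle|].
        destruct (Req_dec_T (snd p) a); [|rewrite Cmod_0]; lra. }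
      lra. }
    assert (K2 : fold_right Rplus 0
      (map (fun a => if Req_dec_T (snd p) a then Cmod (fst p) else 0) s) <= Cmod (fst p)).
    { assert (K0 : forall s, ~ In (snd p) s -> fold_right Rplus 0
        (map (fun a => if Req_dec_T (snd p) a then Cmod (fst p) else 0) s) = 0).
      { clear; induction s as [|a s IH]; cbn; intros H; [reflexivity|].
        destruct (Req_dec_T (snd p) a) as [E|E]; [exfalso; apply H; auto|rewrite IH; auto; ring]. }
      generalize (Cmod_ge_0 (fst p)); intros Hp.
      clear IH K; induction s as [|a s IH]; cbn; [exact Hp|].
      inversion Hs as [|? ? Ha Hs']; subst; specialize (IH Hs').
      destruct (Req_dec_T (snd p) a) as [E|E]; [rewrite K0 by (rewrite E; exact Ha)|]; lra. }
    specialize (K s); lra.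
Qed.

Lemma WBin_bohr_sum (S : R -> Prop) (B : R) (f : R -> C) (s : list R) :
  WBin S B f -> NoDup s -> bohr_sum f s <= B.
Proof.
  intros H Hs; apply Rle_plus_epsilon; intros eps Heps.
  set (n := INR (length s) + 1).
  assert (Hn : 0 < n) by (unfold n; generalize (pos_INR (length s)); lra).
  destruct (H (eps / n)) as [l [[_ H2] H3]]; [apply Rdiv_lt_0_compat; lra|].
  assert (K : bohr_sum f s <= fold_right Rplus 0 (map (fun a => Cmod (coef l a)) s)
    + INR (length s) * (eps / n)).
  { clear Hs; unfold bohr_sum; clearbody n; induction s as [|a s IH].
    - cbn; lra.
    - cbn [map fold_right length]; rewrite S_INR.
      assert (Cmod (bohr f a) <= Cmod (coef l a) + eps / n); [|lra].
      rewrite <- bohr_trig_poly.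
      replace (bohr f a) with (bohr (trig_poly l) a + (bohr f a - bohr (trig_poly l) a))%C by ring.
      eapply Rle_trans; [apply Cmod_triangle|]; apply Rplus_le_compat_l.
      apply bohr_approx; [apply (WBin_AP S B), H|apply AP_trig_poly|].
      intros x; apply Rlt_le, H3. }
  assert (K2 := coef_sum_le l s Hs).
  assert (K3 : INR (length s) * (eps / n) <= eps).
  { apply Rle_trans with (n * (eps / n)); [|right; field; lra].
    apply Rmult_le_compat_r; [apply Rlt_le, Rdiv_lt_0_compat; lra|unfold n; lra]. }
  lra.
Qed.

Lemma WBin_APW (S : R -> Prop) (B : R) (f : R -> C) : WBin S B f -> APW f.
Proof.
  intros H; split; [apply (WBin_AP S B), H|].
  exists B; intros s Hs _; apply (WBin_bohr_sum S B f s H Hs).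
Qed.

(** Bochner-Fejer approximants have distinct frequencies and coefficients dominated by those of [f],
    so their norms are bounded by partial sums of the Bohr-Fourier series. *)
Lemma WBin_intro (f : R -> C) (B : R) :
  AP f -> (forall s, NoDup s -> (forall a, In a s -> Omega f a) -> bohr_sum f s <= B) ->
  WBin (Omega f) B f.
Proof.
  intros Hf HB eps Heps; destruct (bochner_fejer f eps Hf Heps) as [l [H0 [H1 H2]]].
  exists l; repeat split; [intros p Hp; apply H1, Hp| |exact H2].
  apply Rle_trans with (bohr_sum f (freqs l)).
  - clear H0 H2; induction l as [|p l IH]; [unfold wnorm, bohr_sum; cbn; lra|].
    rewrite wnorm_cons; cbn [freqs map]; rewrite bohr_sum_cons.
    apply Rplus_le_compat; [apply H1; left; reflexivity|].
    apply IH; intros q Hq; apply H1; right; exact Hq.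
  - apply HB; [exact H0|]; intros a Ha; apply in_map_iff in Ha.
    destruct Ha as [p [<- Hp]]; apply H1, Hp.
Qed.

(** A finite [s] whose partial sum is within [eps] of the supremum leaves a remainder whose
    coefficients sum to at most [eps], for a further finite set could otherwise be added to exceed
    the supremum. *)
Lemma APW_tail (f : R -> C) (eps : R) :
  APW f -> 0 < eps ->
  exists s : list R, NoDup s /\ (forall a, In a s -> Omega f a) /\
    WBin (Omega f) eps (fun x => (f x - trig_poly (tlist (bohr f) s) x)%C).
Proof.
  intros [Hf [B HB]] Heps.
  set (E := fun r => exists s, NoDup s /\ (forall a, In a s -> Omega f a) /\ r = bohr_sum f s).
  destruct (completeness E) as [b [Hub Hlub]].
  { exists B; intros r [s [H1 [H2 ->]]]; apply HB; assumption. }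
  { exists 0, []; repeat split; [constructor|intros a []]. }
  assert (K : exists s, NoDup s /\ (forall a, In a s -> Omega f a) /\ b - eps < bohr_sum f s).
  { destruct (excluded_middle_informative
      (exists s, NoDup s /\ (forall a, In a s -> Omega f a) /\ b - eps < bohr_sum f s))
      as [|Hn]; [assumption|exfalso].
    assert (b <= b - eps); [|lra]; apply Hlub; intros r [s [H1 [H2 ->]]].
    apply Rnot_lt_le; intros H3; apply Hn; exists s; auto. }
  destruct K as [s [Hs1 [Hs2 Hs3]]]; exists s; split; [exact Hs1|split; [exact Hs2|]].
  set (r := fun x => (f x - trig_poly (tlist (bohr f) s) x)%C).
  assert (HrAP : AP r) by (apply AP_minus; [exact Hf|apply AP_trig_poly]).
  assert (Hr : forall a, bohr r a = (bohr f a - coef (tlist (bohr f) s) a)%C).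
  { intros a; unfold r; rewrite bohr_minus, bohr_trig_poly; auto using AP_trig_poly. }
  assert (Hin : forall a, In a s -> bohr r a = RtoC 0).
  { intros a Ha; rewrite Hr.
    assert (E1 := coef_in (tlist (bohr f) s) (bohr f a, a)).
    cbn [fst snd] in E1; rewrite E1; [ring|rewrite freqs_tlist; exact Hs1|].
    apply in_map_iff; exists a; auto. }
  assert (Hout : forall a, ~ In a s -> bohr r a = bohr f a).
  { intros a Ha; rewrite Hr, coef_notin; [ring|rewrite freqs_tlist; exact Ha]. }
  assert (Hsub : forall a, Omega r a -> ~ In a s /\ Omega f a).
  { intros a Ha.
    assert (Hn : ~ In a s) by (intros Hn; apply Ha, Hin, Hn).
    split; [exact Hn|]; unfold Omega; rewrite <- Hout by exact Hn; exact Ha. }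
  apply (WBin_mono (Omega r) _ eps); [intros a Ha; apply Hsub, Ha|lra|].
  apply WBin_intro; [exact HrAP|]; intros t Ht1 Ht2.
  rewrite (bohr_sum_ext r f) by (intros a Ha; apply Hout; apply Hsub, Ht2, Ha).
  assert (K : bohr_sum f (s ++ t) <= b).
  { apply Hub; exists (s ++ t); repeat split.
    - apply NoDup_app; [exact Hs1|exact Ht1|].
      intros a Ha Ha'; apply Ht2 in Ha'; apply Hsub in Ha'; apply (proj1 Ha'), Ha.
    - intros a Ha; apply in_app_iff in Ha; destruct Ha as [Ha|Ha]; [apply Hs2, Ha|].
      apply Hsub, Ht2, Ha. }
  rewrite bohr_sum_app in K; lra.
Qed.

(** * Bezout identities in the Wiener algebra *)

Definition tfilter (T : R -> bool) (l : list (C * R)) : list (C * R) :=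
  filter (fun p => T (snd p)) l.

Lemma coef_tfilter (T : R -> bool) (l : list (C * R)) (b : R) :
  T b = true -> coef (tfilter T l) b = coef l b.
Proof.
  intros Hb; induction l as [|p l IH]; [reflexivity|].
  unfold tfilter in *; cbn [filter]; destruct (T (snd p)) eqn:E.
  - rewrite !coef_cons, IH; reflexivity.
  - rewrite coef_cons, IH; destruct (Req_dec_T (snd p) b) as [<-|]; [congruence|ring].
Qed.

Lemma trig_poly_tfilter_split (T : R -> bool) (l : list (C * R)) (x : R) :
  (trig_poly (tfilter T l) x + trig_poly (tfilter (fun a => negb (T a)) l) x)%C = trig_poly l x.
Proof.
  induction l as [|p l IH]; [cbn; ring|].
  unfold tfilter in *; cbn [filter]; rewrite trig_poly_cons, <- IH.
  destruct (T (snd p)); cbn [negb]; rewrite !trig_poly_cons; ring.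
Qed.

(** Dropping frequencies is a contraction of the Wiener norm, though not of the uniform norm; hence
    the Wiener bound in the hypothesis. *)
Lemma trig_poly_tfilter_bound (T : R -> bool) (S : R -> Prop) (B : R) (l : list (C * R)) (x : R) :
  WBin S B (trig_poly l) -> Cmod (trig_poly (tfilter T l) x) <= B.
Proof.
  intros H.
  rewrite <- (trig_poly_collect _ (spectrum (tfilter T l)));
    [|apply NoDup_nodup|apply spectrum_incl].
  eapply Rle_trans; [apply Cmod_trig_poly_le|].
  eapply Rle_trans; [|apply (WBin_bohr_sum S B _ (spectrum (tfilter T l)) H), NoDup_nodup].
  right; unfold wnorm, tlist, bohr_sum; rewrite map_map; cbn [fst].
  f_equal; apply map_ext_in; intros b Hb.
  rewrite bohr_trig_poly, coef_tfilter; [reflexivity|].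
  apply nodup_In, in_map_iff in Hb; destruct Hb as [p [<- Hp]].
  apply filter_In in Hp; apply Hp.
Qed.

Lemma inv_S_small (eps : R) : 0 < eps -> exists N, forall n, (N <= n)%nat -> / INR (S n) < eps.
Proof.
  intros Heps; destruct (archimed_cor1 eps Heps) as [N [HN HN0]].
  exists N; intros n Hn; eapply Rle_lt_trans; [|exact HN].
  apply Rinv_le_contravar; [apply lt_0_INR; lia|apply le_INR; lia].
Qed.

Lemma unif_limit (P : nat -> R -> C) :
  (forall n m x, Cmod (P n x - P m x)%C <= / INR (S n) + / INR (S m)) ->
  exists f : R -> C, forall n x, Cmod (f x - P n x)%C <= / INR (S n).
Proof.
  intros H.
  assert (K : forall x, exists z : C, forall n, Cmod (z - P n x)%C <= / INR (S n)).
  { intros x.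
    destruct (proj1 (filterlim_locally_cauchy (U := CV) (F := eventually) (fun n => P n x)))
      as [z Hz].
    - intros eps; destruct (inv_S_small (eps / 2)) as [N HN];
        [generalize (cond_pos eps); lra|].
      exists (fun n => (N <= n)%nat); split; [exists N; auto|].
      intros u v Hu Hv; apply ball_CV.
      eapply Rle_lt_trans; [apply H|]; generalize (HN u Hu) (HN v Hv); lra.
    - exists z; intros n; apply Rle_plus_epsilon; intros eps Heps.
      rewrite (filterlim_locally_ball_norm (U := C_R_NormedModule)) in Hz.
      destruct (Hz (mkposreal (eps / 2) ltac:(lra))) as [N1 HN1].
      destruct (inv_S_small (eps / 2)) as [N2 HN2]; [lra|].
      specialize (HN1 (N1 + N2)%nat ltac:(lia)); specialize (HN2 (N1 + N2)%nat ltac:(lia)).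
      unfold ball_norm in HN1; rewrite norm_CR in HN1; cbn [pos] in HN1.
      change (Cmod (P (N1 + N2)%nat x - z)%C < eps / 2) in HN1.
      replace (z - P n x)%C
        with (- (P (N1 + N2)%nat x - z) + (P (N1 + N2)%nat x - P n x))%C by ring.
      eapply Rle_trans; [apply Cmod_triangle|]; rewrite Cmod_opp.
      generalize (H (N1 + N2)%nat n x); lra. }
  exists (fun x => proj1_sig (constructive_indefinite_description _ (K x))).
  intros n x; apply (proj2_sig (constructive_indefinite_description _ (K x))).
Qed.

Lemma tfilter_tlist (T : R -> bool) (k : R -> C) (s : list R) :
  tfilter T (tlist k s) = tlist k (filter T s).
Proof.
  induction s as [|a s IH]; [reflexivity|].
  unfold tfilter, tlist in *; cbn [map filter snd].
  destruct (T a); cbn [map]; rewrite IH; reflexivity.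
Qed.

(** The partial sums with tails at most [/ INR (S n)] are Cauchy in the Wiener norm, so their
    restrictions to any set of frequencies are uniformly Cauchy by [trig_poly_tfilter_bound]. *)
Lemma APW_split (f : R -> C) (T : R -> bool) :
  APW f ->
  exists f1 f2 B,
    WBin (fun a => Omega f a /\ T a = true) B f1 /\
    WBin (fun a => Omega f a /\ T a = false) B f2 /\
    forall x, f x = (f1 x + f2 x)%C.
Proof.
  intros Hf; assert (Hf' := Hf); destruct Hf' as [HAP [B HB]].
  assert (HIS : forall n, 0 < / INR (S n)) by (intros n; apply Rinv_0_lt_compat, lt_0_INR; lia).
  set (s := fun n => proj1_sig (constructive_indefinite_description _
    (APW_tail f (/ INR (S n)) Hf (HIS n)))).
  assert (Hs : forall n, NoDup (s n) /\ (forall a, In a (s n) -> Omega f a) /\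
    WBin (Omega f) (/ INR (S n)) (fun x => (f x - trig_poly (tlist (bohr f) (s n)) x)%C))
    by (intros n; apply (proj2_sig (constructive_indefinite_description _
      (APW_tail f (/ INR (S n)) Hf (HIS n))))).
  clearbody s.
  assert (K : forall T : R -> bool, exists f1,
    WBin (fun a => Omega f a /\ T a = true) B f1 /\
    forall n x, Cmod (f1 x - trig_poly (tfilter T (tlist (bohr f) (s n))) x)%C <= / INR (S n)).
  { clear T; intros T.
    destruct (unif_limit (fun n => trig_poly (tfilter T (tlist (bohr f) (s n))))) as [f1 Hf1].
    - intros n m x.
      replace (trig_poly (tfilter T (tlist (bohr f) (s n))) x
        - trig_poly (tfilter T (tlist (bohr f) (s m))) x)%C
        with (trig_poly (tfilter T (tlist (bohr f) (s n)
          ++ tmono (RtoC (-1), 0) (tlist (bohr f) (s m)))) x).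
      + apply (trig_poly_tfilter_bound T (Omega f)).
        apply (WBin_ext _ _ (fun x =>
          ((f x - trig_poly (tlist (bohr f) (s m)) x)
           + - (f x - trig_poly (tlist (bohr f) (s n)) x))%C)).
        * intros t; rewrite trig_poly_app, trig_poly_tmono; cbn [fst snd]; rewrite e_zero.
          apply injective_projections; cbn; ring.
        * rewrite Rplus_comm; apply WBin_plus; [apply Hs|apply WBin_opp, Hs].
      + unfold tfilter; rewrite filter_app, trig_poly_app.
        replace (filter (fun p => T (snd p)) (tmono (RtoC (-1), 0) (tlist (bohr f) (s m))))
          with (tmono (RtoC (-1), 0) (filter (fun p => T (snd p)) (tlist (bohr f) (s m)))).
        * rewrite trig_poly_tmono; cbn [fst snd]; rewrite e_zero.
          apply injective_projections; cbn; ring.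
        * generalize (tlist (bohr f) (s m)); intros l; induction l as [|p l IH]; [reflexivity|].
          unfold tmono in *; cbn [map filter fst snd]; rewrite Rplus_0_l.
          destruct (T (snd p)); cbn [map fst snd]; rewrite ?Rplus_0_l; [f_equal|]; exact IH.
    - exists f1; split; [|exact Hf1].
      apply WBin_unif_closed; intros eps Heps; destruct (inv_S_small eps Heps) as [n Hn].
      exists (trig_poly (tfilter T (tlist (bohr f) (s n)))); split.
      + rewrite tfilter_tlist.
        apply (WBin_mono (fun a => Omega f a /\ T a = true) _
          (wnorm (tlist (bohr f) (filter T (s n))))); [auto| |].
        * unfold wnorm, tlist; rewrite map_map; cbn [fst]; apply HB.
          { apply NoDup_filter, Hs. }
          { intros a Ha; apply filter_In in Ha; apply (Hs n), Ha. }
        * apply WBin_trig_poly; intros p Hp; apply in_map_iff in Hp.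
          destruct Hp as [a [<- Ha]]; apply filter_In in Ha; split; [apply (Hs n), Ha|apply Ha].
      + intros x; eapply Rle_lt_trans; [apply Hf1|apply Hn; lia]. }
  destruct (K T) as [f1 [Hf1 Kf1]]; destruct (K (fun a => negb (T a))) as [f2 [Hf2 Kf2]].
  exists f1, f2, B; split; [exact Hf1|split].
  - apply (WBin_mono _ _ B B) with (3 := Hf2); [|lra].
    intros a [H1 H2]; split; [exact H1|]; destruct (T a); [discriminate|reflexivity].
  - intros x; apply Cmod_eq_eps; intros eps Heps.
    destruct (inv_S_small (eps / 3)) as [n Hn]; [lra|]; specialize (Hn n (le_n n)).
    destruct (Hs n) as [_ [_ Hr]]; apply WBin_bound with (x := x) in Hr.
    specialize (Kf1 n x); specialize (Kf2 n x).
    set (l := tlist (bohr f) (s n)) in *.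
    replace (f x - (f1 x + f2 x))%C with ((f x - trig_poly l x)
      + - ((f1 x - trig_poly (tfilter T l) x)
        + (f2 x - trig_poly (tfilter (fun a => negb (T a)) l) x)))%C.
    + eapply Rle_trans; [apply Cmod_triangle|]; rewrite Cmod_opp.
      eapply Rle_trans; [apply Rplus_le_compat_l, Cmod_triangle|]; lra.
    + rewrite <- (trig_poly_tfilter_split T l x); ring.
Qed.

(** * The Wiener algebra with restricted spectrum, and its Neumann series *)

Definition Win (S : R -> Prop) (f : R -> C) : Prop := exists B, WBin S B f.

Lemma Win_ext (S : R -> Prop) (f g : R -> C) : (forall x, f x = g x) -> Win S f -> Win S g.
Proof. intros E [B H]; exists B; apply (WBin_ext _ _ _ _ E H). Qed.

Lemma Win_mono (S S' : R -> Prop) (f : R -> C) :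
  (forall a, S a -> S' a) -> Win S f -> Win S' f.
Proof. intros HS [B H]; exists B; apply (WBin_mono S S' B B); auto; lra. Qed.

Lemma Win_APW (S : R -> Prop) (f : R -> C) : Win S f -> APW f.
Proof. intros [B H]; apply (WBin_APW S B f H). Qed.

Lemma Win_APin (S : R -> Prop) (f : R -> C) : Win S f -> APin S f.
Proof. intros [B H]; apply (WBin_APin S B f H). Qed.

Lemma Win_const (S : R -> Prop) (c : C) : S 0 -> Win S (fun _ => c).
Proof. intros H; exists (Cmod c); apply WBin_const, H. Qed.

Lemma Win_zero (S : R -> Prop) : Win S (fun _ => RtoC 0).
Proof. exists 0; apply (WBin_trig_poly S []); intros p []. Qed.

Lemma Win_trig_poly (S : R -> Prop) (l : list (C * R)) : freqs_in S l -> Win S (trig_poly l).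
Proof. intros H; exists (wnorm l); apply WBin_trig_poly, H. Qed.

Lemma Win_e (S : R -> Prop) (a : R) : S a -> Win S (e a).
Proof.
  intros H; apply (Win_ext _ (trig_poly [(RtoC 1, a)])); [intros x; cbn; ring|].
  apply Win_trig_poly; intros p [<-|[]]; exact H.
Qed.

Lemma Win_plus (S : R -> Prop) (f g : R -> C) :
  Win S f -> Win S g -> Win S (fun x => (f x + g x)%C).
Proof. intros [B1 H1] [B2 H2]; exists (B1 + B2); apply WBin_plus; assumption. Qed.

Lemma Win_opp (S : R -> Prop) (f : R -> C) : Win S f -> Win S (fun x => (- f x)%C).
Proof. intros [B H]; exists B; apply WBin_opp, H. Qed.

Lemma Win_minus (S : R -> Prop) (f g : R -> C) :
  Win S f -> Win S g -> Win S (fun x => (f x - g x)%C).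
Proof. intros Hf Hg; apply Win_plus; [exact Hf|apply Win_opp, Hg]. Qed.

Lemma Win_mult (S1 S2 S3 : R -> Prop) (f g : R -> C) :
  Win S1 f -> Win S2 g -> (forall a b, S1 a -> S2 b -> S3 (a + b)) ->
  Win S3 (fun x => (f x * g x)%C).
Proof. intros [B1 H1] [B2 H2] H; exists (B1 * B2); apply (WBin_mult S1 S2 S3); assumption. Qed.

Lemma Win_e_mult (S S' : R -> Prop) (b : R) (f : R -> C) :
  Win S f -> (forall a, S a -> S' (b + a)) -> Win S' (fun x => (e b x * f x)%C).
Proof.
  intros H HS; apply (Win_mult (fun a => a = b) S); [apply Win_e; reflexivity|exact H|].
  intros a a' ->; apply HS.
Qed.

Lemma Win_reflect (S : R -> Prop) (f : R -> C) :
  Win S f -> Win (fun a => S (- a)) (fun x => f (- x)).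
Proof. intros [B H]; exists B; apply WBin_reflect, H. Qed.

(** The Neumann sum of [(- r) ^ k] for [k <= n], in Horner form. *)
Fixpoint geom (r : R -> C) (n : nat) (x : R) : C :=
  match n with O => RtoC 1 | S n => (1 - r x * geom r n x)%C end.

Lemma geom_eq (r : R -> C) (n : nat) (x : R) :
  ((1 + r x) * geom r n x)%C = (1 - (- r x) ^ S n)%C.
Proof.
  induction n as [|n IH]; cbn [geom]; [cbn; ring|].
  replace ((1 + r x) * (1 - r x * geom r n x))%C
    with (1 + r x - r x * ((1 + r x) * geom r n x))%C by ring.
  rewrite IH; cbn [Cpow]; ring.
Qed.

Definition Rnonneg (a : R) : Prop := 0 <= a.

(** The radius is the fixed point of the recursion: [1 + rho / (1 - rho) = / (1 - rho)]. *)
Lemma WBin_geom (r : R -> C) (rho : R) (n : nat) :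
  WBin Rnonneg rho r -> rho < 1 -> WBin Rnonneg (/ (1 - rho)) (geom r n).
Proof.
  intros Hr Hrho; assert (H0 := WBin_ge_0 _ _ _ Hr).
  induction n as [|n IH].
  - apply (WBin_mono Rnonneg Rnonneg (Cmod (RtoC 1))); [auto| |apply WBin_const; unfold Rnonneg; lra].
    rewrite Cmod_1, <- Rinv_1 at 1; apply Rinv_le_contravar; lra.
  - replace (/ (1 - rho)) with (Cmod (RtoC 1) + rho * / (1 - rho))
      by (rewrite Cmod_1; field; lra).
    apply (WBin_plus Rnonneg _ _ (fun _ => RtoC 1)); [apply WBin_const; unfold Rnonneg; lra|].
    apply WBin_opp, (WBin_mult Rnonneg Rnonneg); [exact Hr|exact IH|].
    unfold Rnonneg; intros; lra.
Qed.

Lemma one_plus_neq_0 (z : C) (rho : R) : Cmod z <= rho -> rho < 1 -> (1 + z)%C <> RtoC 0.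
Proof.
  intros H1 H2 E; assert (K : z = (- RtoC 1)%C).
  { replace z with ((1 + z) - 1)%C by ring; rewrite E; ring. }
  rewrite K, Cmod_opp, Cmod_1 in H1; lra.
Qed.

Lemma Win_inv (r : R -> C) (rho : R) :
  WBin Rnonneg rho r -> rho < 1 -> Win Rnonneg (fun x => (/ (1 + r x))%C).
Proof.
  intros Hr Hrho; assert (H0 := WBin_ge_0 _ _ _ Hr).
  exists (/ (1 - rho)); apply WBin_unif_closed; intros eps Heps.
  destruct (pow_lt_1_zero rho) with (y := eps * (1 - rho)) as [n Hn].
  { rewrite Rabs_pos_eq; lra. }
  { apply Rmult_lt_0_compat; lra. }
  exists (geom r n); split; [apply WBin_geom; assumption|]; intros x.
  assert (Hx := WBin_bound _ _ _ Hr x).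
  assert (Hnz := one_plus_neq_0 _ _ Hx Hrho).
  replace (/ (1 + r x) - geom r n x)%C with ((- r x) ^ S n / (1 + r x))%C.
  - rewrite Cmod_div, Cmod_pow, Cmod_opp by exact Hnz.
    assert (Hm : 1 - rho <= Cmod (1 + r x)%C).
    { assert (K := Cmod_triangle (1 + r x) (- r x)); rewrite Cmod_opp in K.
      replace (1 + r x + - r x)%C with (RtoC 1) in K by ring; rewrite Cmod_1 in K; lra. }
    specialize (Hn (S n) ltac:(lia)); rewrite Rabs_pos_eq in Hn by (apply pow_le; lra).
    assert (Cmod (r x) ^ S n <= rho ^ S n) by (apply pow_incr; split; [apply Cmod_ge_0|lra]).
    apply (Rmult_lt_reg_r (Cmod (1 + r x)%C)); [lra|].
    unfold Rdiv; rewrite Rmult_assoc, Rinv_l, Rmult_1_r by lra.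
    apply Rlt_le_trans with (eps * (1 - rho)); [lra|apply Rmult_le_compat_l; lra].
  - replace ((- r x) ^ S n)%C with (1 - (1 + r x) * geom r n x)%C by (rewrite geom_eq; ring).
    field; exact Hnz.
Qed.

Lemma min_freq (l : list (C * R)) :
  (forall p, In p l -> 0 < snd p) -> exists d, 0 < d /\ forall p, In p l -> d <= snd p.
Proof.
  induction l as [|p l IH]; intros H; [exists 1; split; [lra|intros p []]|].
  destruct IH as [d [Hd K]]; [intros q Hq; apply H; right; exact Hq|].
  exists (Rmin d (snd p)); split; [apply Rmin_pos; [exact Hd|apply H; left; reflexivity]|].
  intros q [<-|Hq]; [apply Rmin_r|eapply Rle_trans; [apply Rmin_l|apply K, Hq]].
Qed.

Definition at_zero (a : R) : bool := if Req_dec_T a 0 then true else false.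

Lemma trig_poly_at_zero (l : list (C * R)) (x : R) : trig_poly (tfilter at_zero l) x = coef l 0.
Proof.
  induction l as [|p l IH]; [reflexivity|].
  unfold tfilter in *; cbn [filter]; rewrite coef_cons.
  unfold at_zero at 1; destruct (Req_dec_T (snd p) 0) as [E|E].
  - rewrite trig_poly_cons, IH, E, e_zero; ring.
  - rewrite IH; ring.
Qed.

Lemma Win_pow (d : R) (f : R -> C) (n : nat) :
  Win (fun a => d <= a) f -> Win (fun a => INR n * d <= a) (fun x => (f x ^ n)%C).
Proof.
  intros H; induction n as [|n IH].
  - apply (Win_const _ (RtoC 1)); cbn; lra.
  - apply (Win_mult (fun a => d <= a) (fun a => INR n * d <= a) _ f (fun x => (f x ^ n)%C));
      auto; intros a b Ha Hb; rewrite S_INR; lra.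
Qed.

(* Split [p = c0 + Q + r] with [Q] a finite sum over positive frequencies and [r] small.  Then
   [p / (c0 + r) = 1 + w] where the frequencies of [w] are bounded away from [0], so that a
   finite geometric sum inverts [1 + w] modulo [e tau]. *)
Lemma corona (p : R -> C) (tau : R) :
  Win Rnonneg p -> 0 <= tau -> (tau = 0 \/ bohr p 0 <> RtoC 0) ->
  exists chi psi, Win (fun a => 0 <= a <= tau) chi /\ Win Rnonneg psi /\
    forall x, (p x * chi x + e tau x * psi x)%C = RtoC 1.
Proof.
  intros Hp Htau [->|Hc].
  (* For [tau = 0] the second generator is the constant 1 and [p] is arbitrary. *)
  { exists (fun _ => RtoC 0), (fun _ => RtoC 1); repeat split.
    - apply Win_zero.
    - apply Win_const; unfold Rnonneg; lra.
    - intros x; rewrite e_zero; ring. }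
  assert (HW := Win_APW _ _ Hp); assert (HAP := proj1 HW).
  set (c := bohr p 0) in *.
  assert (Hc0 : 0 < Cmod c) by (apply Cmod_gt_0, Hc).
  (* A quarter leaves [|c0| >= 3/4 |c|], so [r / c0] has Wiener norm at most [1 / 3] and
     [1 + r / c0] is invertible by the Neumann series. *)
  destruct (APW_tail p (Cmod c / 4) HW) as [s [_ [Hs Hr]]]; [lra|].
  set (l := tlist (bohr p) s) in *; set (r := fun x => (p x - trig_poly l x)%C) in *.
  set (c0 := coef l 0).
  assert (HOm : forall a, Omega p a -> Rnonneg a)
    by (intros a Ha; eapply APin_Omega; [apply Win_APin, Hp|exact Ha]).
  assert (Hc1 : Cmod (c - c0)%C <= Cmod c / 4).
  { replace (c - c0)%C with (bohr r 0).
    - apply bohr_le; [apply (WBin_AP _ _ _ Hr)|apply (WBin_bound _ _ _ Hr)].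
    - unfold r; rewrite bohr_minus, bohr_trig_poly; auto using AP_trig_poly. }
  assert (Hc2 : 3 / 4 * Cmod c <= Cmod c0).
  { assert (K := Cmod_triangle (c - c0) c0).
    replace (c - c0 + c0)%C with c in K by ring; lra. }
  assert (Hc0nz : c0 <> RtoC 0) by (apply Cmod_gt_0; lra).
  set (Q := tfilter (fun a => negb (at_zero a)) l).
  assert (HQ : forall q, In q Q -> 0 < snd q).
  { intros q Hq; apply filter_In in Hq; destruct Hq as [Hq Hn].
    apply in_map_iff in Hq; destruct Hq as [a [<- Ha]]; cbn [snd] in *.
    apply Hs, HOm in Ha; unfold Rnonneg in Ha; unfold at_zero in Hn.
    destruct (Req_dec_T a 0); [discriminate|lra]. }
  destruct (min_freq Q HQ) as [d [Hd HQd]].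
  assert (Hpdec : forall x, p x = (c0 + trig_poly Q x + r x)%C).
  { intros x; unfold r, c0; rewrite <- (trig_poly_at_zero l x).
    rewrite <- (trig_poly_tfilter_split at_zero l x); fold Q; ring. }
  set (r1 := fun x => (/ c0 * r x)%C).
  assert (Hr1 : WBin Rnonneg (1 / 3) r1).
  { apply (WBin_mono (Omega p) Rnonneg (Cmod (/ c0) * (Cmod c / 4))); [exact HOm| |].
    - rewrite Cmod_inv by exact Hc0nz.
      apply (Rmult_le_reg_l (Cmod c0)); [lra|].
      rewrite <- Rmult_assoc, Rinv_r; lra.
    - apply WBin_Cmult, Hr. }
  set (v := fun x => (/ c0 * / (1 + r1 x))%C).
  assert (Hv : Win Rnonneg v).
  { apply (Win_mult Rnonneg Rnonneg Rnonneg (fun _ => / c0)%C).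
    - apply Win_const; unfold Rnonneg; lra.
    - apply (Win_inv r1 (1 / 3)); [exact Hr1|lra].
    - unfold Rnonneg; intros; lra. }
  set (w := fun x => (v x * trig_poly Q x)%C).
  assert (Hw : Win (fun a => d <= a) w).
  { apply (Win_mult Rnonneg (fun a => d <= a) _ v (trig_poly Q)); [exact Hv| |].
    - apply Win_trig_poly; exact HQd.
    - unfold Rnonneg; intros; lra. }
  assert (Hw' : Win Rnonneg w) by (apply (Win_mono (fun a => d <= a)); [unfold Rnonneg; intros; lra|exact Hw]).
  assert (Hpv : forall x, (p x * v x)%C = (1 + w x)%C).
  { intros x; unfold w; rewrite Hpdec.
    assert (Hnz : (1 + r1 x)%C <> RtoC 0)
      by (apply (one_plus_neq_0 _ (1 / 3)); [apply (WBin_bound _ _ _ Hr1)|lra]).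
    assert (E : ((c0 + r x) * v x)%C = RtoC 1).
    { unfold v; replace (r x) with (c0 * r1 x)%C by (unfold r1; field; exact Hc0nz).
      field; split; assumption. }
    replace ((c0 + trig_poly Q x + r x) * v x)%C
      with ((c0 + r x) * v x + v x * trig_poly Q x)%C by ring.
    rewrite E; reflexivity. }
  (* After [N + 1] factors the remainder [(- w) ^ (N + 1)] has its spectrum beyond [tau] and is
     divisible by [e_tau], without any smallness of [w]. *)
  destruct (INR_unbounded (tau / d)) as [N HN].
  assert (HNd : tau <= INR N * d).
  { apply (Rmult_lt_compat_r d) in HN; [|exact Hd].
    replace (tau / d * d) with tau in HN by (field; lra); lra. }
  assert (Hgeom : forall n, Win Rnonneg (geom w n)).
  { induction n as [|n IH]; [apply Win_const; unfold Rnonneg; lra|].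
    apply (Win_minus Rnonneg (fun _ => RtoC 1)); [apply Win_const; unfold Rnonneg; lra|].
    apply (Win_mult Rnonneg Rnonneg); [exact Hw'|exact IH|unfold Rnonneg; intros; lra]. }
  set (chi0 := fun x => (v x * geom w N x)%C).
  assert (Hchi0 : Win Rnonneg chi0).
  { apply (Win_mult Rnonneg Rnonneg); [exact Hv|apply Hgeom|unfold Rnonneg; intros; lra]. }
  set (rest := fun x => ((- w x) ^ S N)%C).
  assert (Hrest : Win (fun a => tau <= a) rest).
  { apply (Win_mono (fun a => INR (S N) * d <= a)).
    - intros a Ha; rewrite S_INR in Ha; lra.
    - apply (Win_pow d (fun x => - w x)%C), Win_opp, Hw. }
  assert (Hpchi : forall x, (p x * chi0 x)%C = (1 - rest x)%C).
  { intros x; unfold chi0; replace (p x * (v x * geom w N x))%C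
      with ((p x * v x) * geom w N x)%C by ring.
    rewrite Hpv; apply geom_eq. }
  (* The part [chi1] of the cofactor beyond [tau] is divisible by [e_tau] and moves into [psi]; what
     remains has spectrum in [[0, tau]]. *)
  destruct (APW_split chi0 (fun a => if Rle_dec a tau then true else false) (Win_APW _ _ Hchi0))
    as [chi [chi1 [B [H1 [H2 H12]]]]].
  assert (HOm' : forall a, Omega chi0 a -> Rnonneg a)
    by (intros a Ha; eapply APin_Omega; [apply Win_APin, Hchi0|exact Ha]).
  exists chi, (fun x => (e (- tau) x * (rest x + p x * chi1 x))%C); repeat split.
  - exists B; apply (WBin_mono _ _ B B) with (3 := H1); [|lra].
    intros a [Ha1 Ha2]; apply HOm' in Ha1; unfold Rnonneg in Ha1.
    destruct (Rle_dec a tau); [lra|discriminate].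
  - apply (Win_e_mult (fun a => tau <= a)); [|unfold Rnonneg; intros; lra].
    apply Win_plus; [exact Hrest|].
    apply (Win_mult Rnonneg (fun a => tau <= a)); [exact Hp| |unfold Rnonneg; intros; lra].
    exists B; apply (WBin_mono _ _ B B) with (3 := H2); [|lra].
    intros a [Ha1 Ha2]; destruct (Rle_dec a tau); [discriminate|lra].
  - intros x.
    replace (p x * chi x + e tau x * (e (- tau) x * (rest x + p x * chi1 x)))%C
      with (p x * chi x + (e tau x * e (- tau) x) * (rest x + p x * chi1 x))%C by ring.
    rewrite <- e_plus, Rplus_opp_r, e_zero.
    replace (p x * chi x + 1 * (rest x + p x * chi1 x))%C
      with (p x * (chi x + chi1 x) + rest x)%C by ring.
    rewrite <- H12, Hpchi; ring.
Qed.

Lemma corona_minus (q : R -> C) (tau : R) :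
  Win (fun a => a <= 0) q -> 0 <= tau -> (tau = 0 \/ bohr q 0 <> RtoC 0) ->
  exists chi psi, Win (fun a => - tau <= a <= 0) chi /\ Win (fun a => a <= 0) psi /\
    forall x, (q x * chi x + e (- tau) x * psi x)%C = RtoC 1.
Proof.
  intros Hq Htau Hc.
  assert (HAP := proj1 (Win_APW _ _ Hq)).
  destruct (corona (fun x => q (- x)) tau) as [chi [psi [H1 [H2 H3]]]].
  - apply (Win_mono (fun a => - a <= 0)); [unfold Rnonneg; intros; lra|].
    apply (Win_reflect (fun a => a <= 0)), Hq.
  - exact Htau.
  - rewrite bohr_reflect, Ropp_0 by exact HAP; exact Hc.
  - exists (fun x => chi (- x)), (fun x => psi (- x)); repeat split.
    + apply (Win_mono (fun a => 0 <= - a <= tau)); [intros; lra|].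
      apply (Win_reflect (fun a => 0 <= a <= tau)), H1.
    + apply (Win_mono (fun a => 0 <= - a)); [intros; lra|].
      apply (Win_reflect (fun a => 0 <= a)), H2.
    + intros x; rewrite <- (H3 (- x)), Ropp_involutive, e_opp_arg; reflexivity.
Qed.

(** * Existence of a factorization *)

Lemma Mmult_mx2 (a b c d a' b' c' d' : C) :
  Mmult (mx2 a b c d) (mx2 a' b' c' d')
  = mx2 (a * a' + b * c')%C (a * b' + b * d')%C (c * a' + d * c')%C (c * b' + d * d')%C.
Proof.
  unfold Mmult, mx2; apply mk_matrix_ext; intros i j Hi Hj.
  assert (E : forall u : nat -> C, sum_n u (pred 2) = Cplus (u 0%nat) (u 1%nat)).
  { intros u; cbn [pred]; rewrite sum_Sn, sum_O; reflexivity. }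
  rewrite E; destruct i as [|[|i]], j as [|[|j]]; try (exfalso; lia); reflexivity.
Qed.

Lemma Mone_mx2 : (Mone : @matrix C 2 2) = mx2 (RtoC 1) (RtoC 0) (RtoC 0) (RtoC 1).
Proof. reflexivity. Qed.

Lemma mx2_eta (A : @matrix C 2 2) :
  A = mx2 (coeff_mat (RtoC 0) A 0 0) (coeff_mat (RtoC 0) A 0 1)
          (coeff_mat (RtoC 0) A 1 0) (coeff_mat (RtoC 0) A 1 1).
Proof. destruct A as [[a [b []]] [[c [d []]] []]]; reflexivity. Qed.

Lemma mx2_inj (a b c d a' b' c' d' : C) :
  mx2 a b c d = mx2 a' b' c' d' -> a = a' /\ b = b' /\ c = c' /\ d = d'.
Proof. intros H; unfold mx2, mk_matrix, mk_Tn in H; cbn in H; injection H; auto. Qed.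

(** With determinants equal to 1 the inverses are adjugates, so they stay in the classes as soon as
    these are closed under sign change. The last four hypotheses are [G Gp = Gm D] by entries. *)
Lemma factorization_intro (Xm Xp : (R -> C) -> Prop) (lam d1 d2 : R)
    (g m11 m12 m21 m22 p11 p12 p21 p22 : R -> C) :
  (forall f, Xm f -> Xm (fun x => (- f x)%C)) ->
  (forall f, Xp f -> Xp (fun x => (- f x)%C)) ->
  Xm m11 -> Xm m12 -> Xm m21 -> Xm m22 ->
  Xp p11 -> Xp p12 -> Xp p21 -> Xp p22 ->
  (forall x, m11 x * m22 x - m12 x * m21 x = 1)%C ->
  (forall x, p11 x * p22 x - p12 x * p21 x = 1)%C ->
  (forall x, e (- lam) x * p11 x = m11 x * e d1 x)%C ->
  (forall x, e (- lam) x * p12 x = m12 x * e d2 x)%C ->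
  (forall x, g x * p11 x + e lam x * p21 x = m21 x * e d1 x)%C ->
  (forall x, g x * p12 x + e lam x * p22 x = m22 x * e d2 x)%C ->
  is_factorization Xm Xp (G_mat lam g) d1 d2.
Proof.
  intros HXm HXp Hm11 Hm12 Hm21 Hm22 Hp11 Hp12 Hp21 Hp22 Dm Dp E11 E12 E21 E22.
  exists (fun x => mx2 (m11 x) (m12 x) (m21 x) (m22 x)),
    (fun x => mx2 (m22 x) (- m12 x)%C (- m21 x)%C (m11 x)),
    (fun x => mx2 (p11 x) (p12 x) (p21 x) (p22 x)),
    (fun x => mx2 (p22 x) (- p12 x)%C (- p21 x)%C (p11 x)).
  repeat split.
  - intros [|[|i]] [|[|j]] Hi Hj; try (exfalso; lia); assumption.
  - intros [|[|i]] [|[|j]] Hi Hj; try (exfalso; lia); [assumption| | |assumption];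
      apply HXm; assumption.
  - rewrite Mmult_mx2, Mone_mx2; rewrite <- (Dm x); f_equal; ring.
  - rewrite Mmult_mx2, Mone_mx2; rewrite <- (Dm x); f_equal; ring.
  - intros [|[|i]] [|[|j]] Hi Hj; try (exfalso; lia); assumption.
  - intros [|[|i]] [|[|j]] Hi Hj; try (exfalso; lia); [assumption| | |assumption];
      apply HXp; assumption.
  - rewrite Mmult_mx2, Mone_mx2; rewrite <- (Dp x); f_equal; ring.
  - rewrite Mmult_mx2, Mone_mx2; rewrite <- (Dp x); f_equal; ring.
  - intros x; unfold G_mat, diag_e; rewrite !Mmult_mx2.
    specialize (E11 x); specialize (E12 x); specialize (E21 x); specialize (E22 x).
    specialize (Dp x).
    f_equal.
    + transitivity (m11 x * e d1 x * p22 x - m12 x * e d2 x * p21 x)%C; [|ring].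
      rewrite <- E11, <- E12.
      transitivity (e (- lam) x * (p11 x * p22 x - p12 x * p21 x))%C; [rewrite Dp|]; ring.
    + transitivity (m12 x * e d2 x * p11 x - m11 x * e d1 x * p12 x)%C; [|ring].
      rewrite <- E11, <- E12; ring.
    + transitivity (m21 x * e d1 x * p22 x - m22 x * e d2 x * p21 x)%C; [|ring].
      rewrite <- E21, <- E22.
      transitivity (g x * (p11 x * p22 x - p12 x * p21 x))%C; [rewrite Dp|]; ring.
    + transitivity (m22 x * e d2 x * p11 x - m21 x * e d1 x * p12 x)%C; [|ring].
      rewrite <- E21, <- E22.
      transitivity (e lam x * (p11 x * p22 x - p12 x * p21 x))%C; [rewrite Dp|]; ring.
Qed.

Definition Rnonpos (a : R) : Prop := a <= 0.

Lemma Win_APWplus (f : R -> C) : Win Rnonneg f -> APWplus f.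
Proof.
  intros H; assert (K := Win_APW _ _ H); split; [split; [apply K|]|exact K].
  intros a Ha; apply (APin_Omega Rnonneg f a (Win_APin _ _ H) Ha).
Qed.

Lemma Win_APWminus (f : R -> C) : Win Rnonpos f -> APWminus f.
Proof.
  intros H; assert (K := Win_APW _ _ H); split; [split; [apply K|]|exact K].
  intros a Ha; apply (APin_Omega Rnonpos f a (Win_APin _ _ H) Ha).
Qed.

(* The first column of [Gp] is [(e (lam - a), - p)]; the Bezout cofactors of [p] complete it to
   a unimodular matrix, and those of [q] correct the second column. *)
Lemma factorization_exists (lam a b : R) (g p q : R -> C) :
  0 <= a <= lam -> 0 <= b <= lam -> lam <= a + b ->
  Win Rnonneg p -> Win Rnonpos q ->
  (forall x, g x = (e a x * p x + e (- b) x * q x)%C) ->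
  (a = lam \/ bohr p 0 <> RtoC 0) -> (b = lam \/ bohr q 0 <> RtoC 0) ->
  is_factorization (Win Rnonpos) (Win Rnonneg) (G_mat lam g) (- (a + b - lam)) (a + b - lam).
Proof.
  intros Ha Hb Hab Hp Hq Hg Hcp Hcq; set (mu := a + b - lam).
  destruct (corona p (lam - a)) as [chi [psi [Hchi [Hpsi Bp]]]]; [exact Hp|lra| |].
  { destruct Hcp as [->|Hcp]; [left; ring|right; exact Hcp]. }
  destruct (corona_minus q (lam - b)) as [chim [psim [Hchim [Hpsim Bq]]]]; [exact Hq|lra| |].
  { destruct Hcq as [->|Hcq]; [left; ring|right; exact Hcq]. }
  (* [G] sends [(chi, psi)] to a column with second entry [e_a + e_(-b) q chi], where [e_a] may be
     too high for [e_mu] times a function in AP-. Adding [u Phi] to the column replaces [e_a] by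
     [e_a (1 - q chim) = e_mu psim]. The lowest frequency of [u] is at least
     [a + mu - (lam - b) = 2 mu]. *)
  set (u := fun x => (- (e (a + mu) x * chim x))%C).
  assert (Hu : Win (fun c => a + mu - (lam - b) <= c) u).
  { apply Win_opp, (Win_e_mult (fun c => - (lam - b) <= c <= 0)); [exact Hchim|intros; lra]. }
  assert (Hu' : Win Rnonneg u)
    by (apply (Win_mono (fun c => a + mu - (lam - b) <= c)); [unfold Rnonneg, mu; intros; lra|exact Hu]).
  assert (Hchi' : Win Rnonneg chi)
    by (apply (Win_mono (fun c => 0 <= c <= lam - a)); [unfold Rnonneg; intros; lra|exact Hchi]).
  assert (addp : forall c d, Rnonneg c -> Rnonneg d -> Rnonneg (c + d)) by (unfold Rnonneg; intros; lra).
  apply (factorization_intro _ _ lam _ _ g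
    (e (- (lam - b))) (fun x => (e (- mu - lam) x * chi x - chim x)%C)
    q (fun x => (e (- mu - b) x * (q x * chi x) + psim x)%C)
    (e (lam - a)) (fun x => (chi x + e (lam - a) x * u x)%C)
    (fun x => (- p x)%C) (fun x => (psi x - u x * p x)%C)).
  - intros f; apply Win_opp.
  - intros f; apply Win_opp.
  - apply Win_e; unfold Rnonpos; lra.
  - apply Win_minus.
    (* Here the upper end of the spectrum of [chi] counts:
       [- mu - lam + (lam - a) = - mu - a <= 0]. *)
    + apply (Win_e_mult (fun c => 0 <= c <= lam - a)); [exact Hchi|].
      unfold Rnonpos, mu; intros; lra.
    + apply (Win_mono (fun c => - (lam - b) <= c <= 0)); [unfold Rnonpos; intros; lra|exact Hchim].
  - exact Hq.
  - apply Win_plus; [|exact Hpsim].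
    apply (Win_e_mult (fun c => c <= lam - a)).
    + apply (Win_mult Rnonpos (fun c => 0 <= c <= lam - a)); [exact Hq|exact Hchi|].
      unfold Rnonpos; intros; lra.
    + unfold Rnonpos, mu; intros; lra.
  - apply Win_e; unfold Rnonneg; lra.
  - apply Win_plus; [exact Hchi'|].
    apply (Win_e_mult Rnonneg); [exact Hu'|unfold Rnonneg; intros; lra].
  - apply Win_opp, Hp.
  - apply Win_minus; [exact Hpsi|].
    apply (Win_mult Rnonneg Rnonneg); assumption.
  - intros x; rewrite <- (Bq x).
    replace (- mu - b) with (- mu - lam + (lam - b)) by ring.
    rewrite (e_plus _ (lam - b)), (e_opp (lam - b)).
    field; apply e_neq_0.
  - intros x; rewrite <- (Bp x); ring.
  - intros x; rewrite <- !e_plus; f_equal; unfold mu; ring.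
  - intros x; unfold u.
    replace (- mu - lam) with (- lam + - mu) by ring.
    replace (a + mu) with (- (lam - a) + lam + mu) by ring.
    rewrite !e_plus, !e_opp; field; repeat split; apply e_neq_0.
  - intros x; rewrite Hg.
    replace (- mu) with ((lam - a) - b) by (unfold mu; ring).
    replace lam with (a + (lam - a)) at 2 by ring.
    rewrite e_plus, (e_minus (lam - a) b), e_opp.
    field; apply e_neq_0.
  - intros x; rewrite Hg.
    transitivity (e (- b) x * (q x * chi x) + e a x * (p x * chi x + e (lam - a) x * psi x)
      + e (- b) x * q x * e (lam - a) x * u x)%C.
    { replace lam with (a + (lam - a)) at 2 by ring; rewrite e_plus; ring. }
    rewrite Bp.
    assert (E : (e (- b) x * q x * e (lam - a) x * u x)%C = (- (e a x * (q x * chim x)))%C).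
    { unfold u; replace (a + mu) with (a + a + b - lam) by (unfold mu; ring).
      rewrite !e_minus, !e_plus, e_opp; field; repeat split; apply e_neq_0. }
    rewrite E.
    replace (q x * chim x)%C with (1 - e (- (lam - b)) x * psim x)%C by (rewrite <- (Bq x); ring).
    replace (- mu - b) with (- b - mu) by ring.
    replace mu with (a + - (lam - b)) at 2 by (unfold mu; ring).
    rewrite (e_minus (- b) mu), (e_plus a), !(e_opp).
    field_simplify; [|repeat split; apply e_neq_0..].
    replace mu with (a + - (lam - b)) by (unfold mu; ring).
    rewrite (e_plus a), !e_opp; field; repeat split; apply e_neq_0.
Qed.

(** * Zero-free functions with bounded spectrum *)

Definition tder (l : list (C * R)) : list (C * R) :=
  map (fun p => ((fst p * (RtoC (snd p) * Ci))%C, snd p)) l.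

(** Equal to the mean of [|trig_poly l|^2] for distinct frequencies only, as in [parseval]. *)
Definition sq_norm (l : list (C * R)) : R :=
  fold_right Rplus 0 (map (fun p => Cmod (fst p) ^ 2) l).

Lemma coef_tconj (l : list (C * R)) (a : R) : coef (tconj l) (- a) = Cconj (coef l a).
Proof.
  induction l as [|p l IH]; [symmetry; apply Cconj_0|].
  cbn [tconj map]; fold (tconj l); rewrite !coef_cons, Cplus_conj, IH; cbn [fst snd].
  f_equal; destruct (Req_dec_T (- snd p) (- a)), (Req_dec_T (snd p) a);
    try reflexivity; try (exfalso; lra); symmetry; apply Cconj_0.
Qed.

Lemma parseval (l : list (C * R)) :
  NoDup (freqs l) ->
  M (fun t => (trig_poly l t * Cconj (trig_poly l t))%C) = RtoC (sq_norm l).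
Proof.
  intros Hl.
  rewrite (M_ext _ (fun t => (trig_poly l t * trig_poly (tconj l) t)%C))
    by (intros t; rewrite trig_poly_tconj; reflexivity).
  rewrite M_Cmult_trig_poly by apply AP_trig_poly.
  assert (K : forall p, In p l -> coef l (snd p) = fst p) by (intros; apply coef_in; assumption).
  assert (H : forall l', incl l' l -> fold_right Cplus (RtoC 0)
      (map (fun p => (fst p * bohr (trig_poly (tconj l)) (- snd p))%C) l') = RtoC (sq_norm l')).
  { induction l' as [|p l' IH]; intros Hi; [reflexivity|].
    cbn [map fold_right]; rewrite IH by (intros q Hq; apply Hi; right; exact Hq).
    rewrite bohr_trig_poly, coef_tconj, K by (apply Hi; left; reflexivity).
    rewrite <- Cmod2_conj, <- RtoC_plus; reflexivity. }
  apply H; intros p Hp; exact Hp.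
Qed.

Lemma AP_abs_sq (l : list (C * R)) : AP (fun t => (trig_poly l t * Cconj (trig_poly l t))%C).
Proof.
  apply (AP_ext (fun t => (trig_poly l t * trig_poly (tconj l) t)%C)).
  - intros t; rewrite trig_poly_tconj; reflexivity.
  - apply AP_mult; apply AP_trig_poly.
Qed.

Lemma Cmult_conj_sq (z : C) : (z * Cconj z)%C = RtoC (Cmod z ^ 2).
Proof. symmetry; apply Cmod2_conj. Qed.

Lemma sq_norm_le (l : list (C * R)) (F : R) :
  NoDup (freqs l) -> (forall x, Cmod (trig_poly l x) <= F) -> sq_norm l <= F ^ 2.
Proof.
  intros Hl HF.
  assert (K := parseval l Hl).
  rewrite (M_ext _ (fun t => RtoC (Cmod (trig_poly l t) ^ 2))) in K
    by (intros; apply Cmult_conj_sq).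
  apply Rle_trans with (Cmod (RtoC (sq_norm l))); [rewrite Cmod_R; apply Rle_abs|].
  rewrite <- K; change (F ^ 2) with (fst (RtoC (F ^ 2))); rewrite <- (M_const (RtoC (F ^ 2))).
  apply M_le; [|apply AP_const|].
  - apply (AP_ext _ _ (fun t => Cmult_conj_sq (trig_poly l t))), AP_abs_sq.
  - intros t; cbn [fst RtoC]; rewrite Cmod_R, Rabs_pos_eq by apply pow2_ge_0.
    apply pow_incr; split; [apply Cmod_ge_0|apply HF].
Qed.

Lemma freqs_tder (l : list (C * R)) : freqs (tder l) = freqs l.
Proof. unfold freqs, tder; rewrite map_map; reflexivity. Qed.

Lemma sq_norm_map_le (k : R -> C) (l : list (C * R)) (B : R) :
  (forall a, In a (freqs l) -> Cmod (k a) <= B) ->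
  sq_norm (map (fun p => ((fst p * k (snd p))%C, snd p)) l) <= B ^ 2 * sq_norm l.
Proof.
  unfold sq_norm; induction l as [|p l IH]; intros H; cbn [map fold_right fst]; [lra|].
  specialize (IH (fun a Ha => H a (or_intror Ha))).
  assert (Hp := H (snd p) (or_introl eq_refl)).
  rewrite Cmod_mult, Rpow_mult_distr.
  assert (Cmod (k (snd p)) ^ 2 <= B ^ 2) by (apply pow_incr; split; [apply Cmod_ge_0|exact Hp]).
  assert (Cmod (fst p) ^ 2 * Cmod (k (snd p)) ^ 2 <= Cmod (fst p) ^ 2 * B ^ 2)
    by (apply Rmult_le_compat_l; [apply pow2_ge_0|assumption]).
  lra.
Qed.

(** Bernstein's inequality in mean square. The mean square suffices for the estimates below and is
    blind to the number of terms. *)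
Lemma sq_norm_tder (l : list (C * R)) (A : R) :
  (forall a, In a (freqs l) -> Rabs a <= A) -> sq_norm (tder l) <= A ^ 2 * sq_norm l.
Proof.
  intros H; apply (sq_norm_map_le (fun a => RtoC a * Ci)%C); intros a Ha.
  rewrite Cmod_mult, Cmod_R, Cmod_Ci, Rmult_1_r; apply H, Ha.
Qed.

Lemma sq_norm_shiftE (l : list (C * R)) (A y : R) :
  (forall a, In a (freqs l) -> Rabs a <= A) ->
  sq_norm (shiftE y l) <= exp (A * Rabs y) ^ 2 * sq_norm l.
Proof.
  intros H; apply (sq_norm_map_le (fun a => RtoC (exp (- (a * y))))); intros a Ha.
  rewrite Cmod_R, Rabs_pos_eq by apply Rlt_le, exp_pos; apply exp_le_mono.
  apply Rle_trans with (Rabs a * Rabs y).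
  - rewrite <- Rabs_mult, <- Rabs_Ropp; apply Rle_abs.
  - apply Rmult_le_compat_r; [apply Rabs_pos|apply H, Ha].
Qed.

Lemma is_derive_trig_poly_fst (l : list (C * R)) (t : R) :
  is_derive (fun t => fst (trig_poly l t)) t (fst (trig_poly (tder l) t)).
Proof.
  induction l as [|p l IH].
  - apply (@is_derive_const R_AbsRing R_NormedModule 0 t).
  - apply (is_derive_plus (V := R_NormedModule)
      (fun t => fst (fst p * e (snd p) t)%C) (fun t => fst (trig_poly l t))); [|exact IH].
    cbn; auto_derive; auto; ring.
Qed.

Lemma is_derive_trig_poly_snd (l : list (C * R)) (t : R) :
  is_derive (fun t => snd (trig_poly l t)) t (snd (trig_poly (tder l) t)).
Proof.
  induction l as [|p l IH].
  - apply (@is_derive_const R_AbsRing R_NormedModule 0 t).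
  - apply (is_derive_plus (V := R_NormedModule)
      (fun t => snd (fst p * e (snd p) t)%C) (fun t => snd (trig_poly l t))); [|exact IH].
    cbn; auto_derive; auto; ring.
Qed.

Lemma Re_div (z w : C) :
  w <> RtoC 0 ->
  Re (z / w)%C = (fst w * fst z + snd w * snd z) / (fst w ^ 2 + snd w ^ 2).
Proof.
  intros Hw.
  assert (H : fst w ^ 2 + snd w ^ 2 <> 0).
  { intros E; apply Hw; apply injective_projections; cbn; nra. }
  unfold Cdiv, Cinv, Cmult, Re; cbn [fst snd]; field; exact H.
Qed.

Lemma is_derive_half_ln (f1 f2 : R -> R) (t a b : R) :
  is_derive f1 t a -> is_derive f2 t b -> 0 < f1 t ^ 2 + f2 t ^ 2 ->
  is_derive (fun t => / 2 * ln (f1 t ^ 2 + f2 t ^ 2)) t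
    ((f1 t * a + f2 t * b) / (f1 t ^ 2 + f2 t ^ 2)).
Proof.
  intros D1 D2 Hsq; auto_derive.
  - repeat split; [eexists; exact D1|eexists; exact D2|].
    replace (f1 t * (f1 t * 1) + f2 t * (f2 t * 1)) with (f1 t ^ 2 + f2 t ^ 2) by ring; exact Hsq.
  - replace (Derive (fun x : R => f1 x) t) with a by (symmetry; apply is_derive_unique, D1).
    replace (Derive (fun x : R => f2 x) t) with b by (symmetry; apply is_derive_unique, D2).
    field; lra.
Qed.

Lemma continuous_log_derivative (f1 f2 g1 g2 : R -> R) (t : R) :
  ex_derive f1 t -> ex_derive f2 t -> ex_derive g1 t -> ex_derive g2 t ->
  0 < f1 t ^ 2 + f2 t ^ 2 ->
  continuous (fun t => (f1 t * g1 t + f2 t * g2 t) / (f1 t ^ 2 + f2 t ^ 2)) t.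
Proof.
  intros D1 D2 D3 D4 Hsq; apply (ex_derive_continuous (V := R_NormedModule)).
  auto_derive; repeat split; try assumption.
  replace (f1 t * (f1 t * 1) + f2 t * (f2 t * 1)) with (f1 t ^ 2 + f2 t ^ 2) by ring; lra.
Qed.

(* [Re (P' / P)] is the derivative of the bounded function [ln |P|]. *)
Lemma log_derivative_mean (P U : list (C * R)) (L c a : R) :
  (forall t, exp (- L) <= Cmod (trig_poly P t) <= exp L) -> 0 <= c ->
  (forall t, Cmod (trig_poly U t - trig_poly (tder P) t / trig_poly P t)%C
    <= c * Cmod (trig_poly (tder P) t)) ->
  NoDup (freqs P) ->
  Cmod (M (fun t => (e (- a) t * RtoC (Re (trig_poly U t)))%C))
    <= Rabs a * L + c * ((1 + sq_norm (tder P)) / 2).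
Proof.
  intros HL Hc HU HP.
  assert (Hpos : forall t, 0 < Cmod (trig_poly P t)).
  { intros t; eapply Rlt_le_trans; [apply exp_pos|apply (HL t)]. }
  assert (Hnz : forall t, trig_poly P t <> RtoC 0) by (intros t; apply Cmod_gt_0, Hpos).
  assert (Hsq : forall t, 0 < fst (trig_poly P t) ^ 2 + snd (trig_poly P t) ^ 2).
  { intros t; generalize (Cmod2_alt (trig_poly P t)) (pow_lt _ 2 (Hpos t)); unfold Re, Im; lra. }
  assert (HL0 : forall t, Rabs (ln (Cmod (trig_poly P t))) <= L).
  { intros t; apply Rabs_le; split; [rewrite <- (ln_exp (- L))|rewrite <- (ln_exp L)];
      apply ln_le; try apply exp_pos; try apply Hpos; apply HL. }
  (* [|P'|] is replaced by the larger [(1 + |P'|^2) / 2], an almost periodic function whose mean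
     Parseval gives. *)
  set (g := fun t => (RtoC (c / 2) * (1 + trig_poly (tder P) t * Cconj (trig_poly (tder P) t))
    + RtoC (Rabs a * L))%C).
  assert (HgAP1 : AP (fun t => (1 + trig_poly (tder P) t * Cconj (trig_poly (tder P) t))%C))
    by (apply AP_plus; [apply AP_const|apply AP_abs_sq]).
  assert (HgAP : AP g).
  { apply AP_plus; [|apply AP_const]; apply AP_mult; [apply AP_const|exact HgAP1]. }
  replace (Rabs a * L + c * ((1 + sq_norm (tder P)) / 2)) with (fst (M g)).
  2: { unfold g; rewrite M_plus, M_Cmult, M_plus, !M_const, parseval;
         try apply AP_const; try apply AP_abs_sq; try assumption.
       - cbn; field.
       - rewrite freqs_tder; exact HP.
       - apply AP_mult; [apply AP_const|exact HgAP1]. }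
  set (r := fun t => / 2 * ln (fst (trig_poly P t) ^ 2 + snd (trig_poly P t) ^ 2)).
  set (dr := fun t => (fst (trig_poly P t) * fst (trig_poly (tder P) t)
    + snd (trig_poly P t) * snd (trig_poly (tder P) t))
    / (fst (trig_poly P t) ^ 2 + snd (trig_poly P t) ^ 2)).
  assert (Hr : forall t, r t = ln (Cmod (trig_poly P t))).
  { intros t; unfold r; rewrite <- Cmod2_alt; cbn [pow]; rewrite Rmult_1_r, ln_mult by apply Hpos.
    field. }
  assert (Hdr : forall t, is_derive r t (dr t)).
  { intros t; unfold r, dr.
    apply (is_derive_half_ln (fun t => fst (trig_poly P t)) (fun t => snd (trig_poly P t)));
      [apply is_derive_trig_poly_fst|apply is_derive_trig_poly_snd|apply Hsq]. }
  assert (Hdrc : forall t, continuous dr t).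
  { intros t; apply (continuous_log_derivative
      (fun t => fst (trig_poly P t)) (fun t => snd (trig_poly P t))
      (fun t => fst (trig_poly (tder P) t)) (fun t => snd (trig_poly (tder P) t)));
      [eexists; apply is_derive_trig_poly_fst|eexists; apply is_derive_trig_poly_snd|
       eexists; apply is_derive_trig_poly_fst|eexists; apply is_derive_trig_poly_snd|apply Hsq]. }
  (* The derivative of [ln |P| e_(-a)] is [e_(-a) Re (P' / P)] up to a term of modulus at most
     [|a| L]. *)
  apply (M_parts _ (fun t => (RtoC (r t) * e (- a) t)%C)
    (fun t => (RtoC (dr t) * e (- a) t + RtoC (r t) * (RtoC (- a) * Ci * e (- a) t))%C) g L).
  - apply AP_mult; [apply AP_e|].
    apply (AP_ext (fun t => (RtoC (/ 2) * (trig_poly U t + trig_poly (tconj U) t))%C)).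
    + intros t; rewrite trig_poly_tconj; generalize (trig_poly U t); intros z.
      apply injective_projections; unfold Cplus, Cmult, Cconj, RtoC, Re; cbn [fst snd]; field.
    + apply AP_mult; [apply AP_const|apply AP_plus; apply AP_trig_poly].
  - exact HgAP.
  - intros t; rewrite Cmod_mult, Cmod_e, Cmod_R, Rmult_1_r, Hr; apply HL0.
  - intros t.
    apply (is_derive_ext (fun t => (r t * cos (- a * t), r t * sin (- a * t)) : C)).
    { intros u; apply injective_projections; cbn; ring. }
    replace (RtoC (dr t) * e (- a) t + RtoC (r t) * (RtoC (- a) * Ci * e (- a) t))%C
      with ((dr t * cos (- a * t) + r t * (- (- a) * sin (- a * t)),
             dr t * sin (- a * t) + r t * (- a * cos (- a * t))) : C)
      by (apply injective_projections; cbn; ring).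
    apply is_derive_pairC; cbn [fst snd].
    + apply (is_derive_mult r (fun t => cos (- a * t))); [apply Hdr| |intros; apply Rmult_comm].
      auto_derive; auto; ring.
    + apply (is_derive_mult r (fun t => sin (- a * t))); [apply Hdr| |intros; apply Rmult_comm].
      auto_derive; auto; ring.
  - intros t.
    assert (Kr : continuous r t) by (apply (ex_derive_continuous r); eexists; apply Hdr).
    assert (KR : forall h : R -> R, continuous h t -> continuous (U := CV) (fun t => RtoC (h t)) t).
    { intros h Hh; apply continuous_pairC; [exact Hh|apply continuous_const]. }
    apply (continuous_plus (V := C_R_NormedModule)); apply continuous_Cmult.
    + apply KR, Hdrc.
    + apply continuous_e.
    + apply KR, Kr.
    + apply continuous_Cmult; [apply continuous_const|apply continuous_e].
  - intros t.
    replace (e (- a) t * RtoC (Re (trig_poly U t))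
      - (RtoC (dr t) * e (- a) t + RtoC (r t) * (RtoC (- a) * Ci * e (- a) t)))%C
      with (e (- a) t * RtoC (Re (trig_poly U t) - dr t)
        + RtoC (r t) * (RtoC a * Ci) * e (- a) t)%C
      by (rewrite RtoC_minus, RtoC_opp; ring).
    eapply Rle_trans; [apply Cmod_triangle|].
    rewrite !Cmod_mult, !Cmod_e, !Cmod_R, Cmod_Ci, !Rmult_1_r, Rmult_1_l.
    assert (K1 : Rabs (Re (trig_poly U t) - dr t) <= c * Cmod (trig_poly (tder P) t)).
    { eapply Rle_trans; [|apply (HU t)].
      replace (Re (trig_poly U t) - dr t)
        with (Re (trig_poly U t - trig_poly (tder P) t / trig_poly P t)%C).
      - apply re_le_Cmod.
      - change (Re (trig_poly U t - trig_poly (tder P) t / trig_poly P t)%C)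
          with (Re (trig_poly U t) - Re (trig_poly (tder P) t / trig_poly P t)%C).
        rewrite Re_div by apply Hnz; reflexivity. }
    assert (K2 : Rabs (r t) * Rabs a <= Rabs a * L).
    { rewrite Rmult_comm; apply Rmult_le_compat_l; [apply Rabs_pos|rewrite Hr; apply HL0]. }
    unfold g; rewrite Cmult_conj_sq.
    replace (fst _) with (c / 2 * (1 + Cmod (trig_poly (tder P) t) ^ 2) + Rabs a * L)
      by (cbn; ring).
    set (z := Cmod (trig_poly (tder P) t)) in *.
    assert (c * z <= c / 2 * (1 + z ^ 2)).
    { replace (c / 2 * (1 + z ^ 2)) with (c * ((1 + z ^ 2) / 2)) by field.
      apply Rmult_le_compat_l; [exact Hc|]; generalize (pow2_ge_0 (z - 1)); nra. }
    lra.
Qed.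

(** * Logarithmic derivatives of approximate divisors of an exponential *)

Lemma shiftE_tder (y : R) (l : list (C * R)) : shiftE y (tder l) = tder (shiftE y l).
Proof.
  unfold tder, shiftE; rewrite !map_map; apply map_ext; intros q; cbn [fst snd].
  f_equal; ring.
Qed.

Lemma coef_app (l m : list (C * R)) (a : R) : coef (l ++ m) a = (coef l a + coef m a)%C.
Proof.
  induction l as [|p l IH]; cbn [app]; [cbn; ring|].
  rewrite !coef_cons, IH; ring.
Qed.

(** If [P Q] is close to [e_tau], then [e_(-tau) Q] is close to [1 / P], and this polynomial stands
    for [P' / P]. *)
Definition log_der (P Q : list (C * R)) (tau : R) : list (C * R) :=
  tmono (RtoC 1, - tau) (tmul (tder P) Q).

(** Finite model of [x phi = e_tau] with spectra in [[- A, A]]. No parameter depends on the number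
    of terms, so estimates hold uniformly along a sequence of approximants. *)
Definition approx_factors (A F tau eps : R) (P Q : list (C * R)) : Prop :=
  NoDup (freqs P) /\
  (forall b, In b (freqs P) -> Rabs b <= A) /\ (forall b, In b (freqs Q) -> Rabs b <= A) /\
  (forall x, Cmod (trig_poly P x) <= F) /\ (forall x, Cmod (trig_poly Q x) <= F) /\
  (forall x, Cmod (trig_poly P x * trig_poly Q x - e tau x)%C <= eps).

Lemma approx_factors_mono (A F tau eps eps' : R) (P Q : list (C * R)) :
  eps <= eps' -> approx_factors A F tau eps P Q -> approx_factors A F tau eps' P Q.
Proof.
  intros He [H1 [H2 [H3 [H4 [H5 H6]]]]]; repeat split; try assumption.
  intros x; eapply Rle_trans; [apply H6|exact He].
Qed.

(** Pointwise [|P' h| <= B (1 + |P'|^2) / 2], and the mean of [|P'|^2] is at most [A^2 F^2] by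
    Parseval. *)
Lemma bohr_tder_mult (P : list (C * R)) (h : R -> C) (A F B a : R) :
  NoDup (freqs P) -> (forall b, In b (freqs P) -> Rabs b <= A) ->
  (forall x, Cmod (trig_poly P x) <= F) ->
  AP h -> (forall x, Cmod (h x) <= B) ->
  Cmod (bohr (fun t => (trig_poly (tder P) t * h t)%C) a) <= B * ((1 + A ^ 2 * F ^ 2) / 2).
Proof.
  intros HND HA HF Hh HB.
  assert (HB0 : 0 <= B) by (eapply Rle_trans; [apply Cmod_ge_0|apply (HB 0)]).
  assert (HAP1 : AP (fun t => (1 + trig_poly (tder P) t * Cconj (trig_poly (tder P) t))%C))
    by (apply AP_plus; [apply AP_const|apply AP_abs_sq]).
  apply Rle_trans with (fst (M (fun t =>
    (RtoC (B / 2) * (1 + trig_poly (tder P) t * Cconj (trig_poly (tder P) t)))%C))).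
  - apply bohr_le_M.
    + apply AP_mult; [apply AP_trig_poly|exact Hh].
    + apply AP_mult; [apply AP_const|exact HAP1].
    + intros t; rewrite Cmult_conj_sq, Cmod_mult.
      set (z := Cmod (trig_poly (tder P) t)).
      replace (fst _) with (B / 2 * (1 + z ^ 2)) by (cbn; ring).
      assert (z * Cmod (h t) <= z * B) by (apply Rmult_le_compat_l; [apply Cmod_ge_0|apply HB]).
      assert (z * B <= B / 2 * (1 + z ^ 2)).
      { replace (B / 2 * (1 + z ^ 2)) with ((1 + z ^ 2) / 2 * B) by field.
        apply Rmult_le_compat_r; [exact HB0|]; generalize (pow2_ge_0 (z - 1)); nra. }
      lra.
  - rewrite M_Cmult, M_plus, M_const, parseval; try assumption; try apply AP_const; try apply AP_abs_sq.
    + replace (fst _) with (B * ((1 + sq_norm (tder P)) / 2))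
        by (unfold Cmult, Cplus, RtoC; cbn [fst snd]; field).
      apply Rmult_le_compat_l; [exact HB0|].
      assert (K1 := sq_norm_tder P A HA); assert (K2 := sq_norm_le P F HND HF).
      assert (A ^ 2 * sq_norm P <= A ^ 2 * F ^ 2)
        by (apply Rmult_le_compat_l; [apply pow2_ge_0|exact K2]).
      lra.
    + rewrite freqs_tder; exact HND.
Qed.

Lemma trig_poly_log_der (P Q : list (C * R)) (tau t : R) :
  trig_poly (log_der P Q tau) t = (trig_poly (tder P) t * (e (- tau) t * trig_poly Q t))%C.
Proof.
  unfold log_der; rewrite trig_poly_tmono, trig_poly_tmul; cbn [fst snd]; ring.
Qed.

Lemma log_der_coef_bound (A F tau eps : R) (P Q : list (C * R)) (b : R) :
  approx_factors A F tau eps P Q ->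
  Cmod (coef (log_der P Q tau) b) <= F * ((1 + A ^ 2 * F ^ 2) / 2).
Proof.
  intros [HND [HPA [HQA [HPF [HQF _]]]]]; rewrite <- bohr_trig_poly.
  rewrite (bohr_ext _ _ b (trig_poly_log_der P Q tau)); apply bohr_tder_mult; auto.
  - apply AP_mult; [apply AP_e|apply AP_trig_poly].
  - intros t; rewrite Cmod_mult, Cmod_e, Rmult_1_l; apply HQF.
Qed.

(** This is [log_derivative_mean] on the line of height [y]. Only the real part of the logarithmic
    derivative is controlled, which couples the coefficients at [a] and [- a]; the shift scales them
    by opposite exponentials. *)
Lemma log_der_shift_bound (P Q : list (C * R)) (A F tau a y eps : R) :
  approx_factors A F tau eps P Q -> Rabs tau <= A -> 1 <= F ->
  eps * exp (3 * A * Rabs y) <= 1 / 2 ->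
  Cmod (coef (log_der P Q tau) a) * exp (- (a * y))
  <= Cmod (coef (log_der P Q tau) (- a)) * exp (a * y)
     + 2 * (Rabs a * (ln (2 * F) + 2 * A * Rabs y)
       + exp (ln (2 * F) + 2 * A * Rabs y) * (eps * exp (3 * A * Rabs y))
         * ((1 + exp (A * Rabs y) ^ 2 * (A ^ 2 * F ^ 2)) / 2)).
Proof.
  intros [HND [HPA [HQA [HPF [HQF HPQ]]]]] Htau HF Heps.
  set (U := log_der P Q tau); set (L := ln (2 * F) + 2 * A * Rabs y).
  set (X := shiftE y P); set (c := eps * exp (3 * A * Rabs y)) in *.
  assert (HA : 0 <= A) by (eapply Rle_trans; [apply Rabs_pos|exact Htau]).
  assert (Hy : 0 <= Rabs y) by apply Rabs_pos.
  assert (Heps0 : 0 <= eps) by (eapply Rle_trans; [apply Cmod_ge_0|apply (HPQ 0)]).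
  assert (Hc : 0 <= c) by (apply Rmult_le_pos; [exact Heps0|apply Rlt_le, exp_pos]).
  set (Y := tmono (RtoC (exp (tau * y)), - tau) (shiftE y Q)).
  assert (HXY : forall t, Cmod (trig_poly X t * trig_poly Y t - 1)%C <= c).
  { intros t.
    (* The polynomial [e_(-tau) P Q - 1] is bounded by [eps] on the real line and has frequencies in
       [[- 3 A, 3 A]], so [shiftE_bound] gives the error [c] on the shifted line. *)
    set (l1 := tmono (RtoC 1, - tau) (tmul P Q) ++ tconst (- RtoC 1)).
    replace (trig_poly X t * trig_poly Y t - 1)%C with (trig_poly (shiftE y l1) t).
    - apply shiftE_bound.
      + intros b Hb; apply in_map_iff in Hb; destruct Hb as [p [<- Hp]].
        apply in_app_iff in Hp; destruct Hp as [Hp|[<-|[]]].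
        * apply in_map_iff in Hp; destruct Hp as [q [<- Hq]]; cbn [snd].
          apply in_tmul in Hq; destruct Hq as [u [v [Hu [Hv [_ ->]]]]].
          eapply Rle_trans; [apply Rabs_triang|]; rewrite Rabs_Ropp.
          assert (K := Rabs_triang (snd u) (snd v)).
          generalize (HPA _ (in_map snd _ _ Hu)) (HQA _ (in_map snd _ _ Hv)); lra.
        * cbn [snd]; rewrite Rabs_R0; lra.
      + intros x; unfold l1; rewrite trig_poly_app, trig_poly_tmono, trig_poly_tmul, trig_poly_tconst.
        cbn [fst snd].
        replace (1 * e (- tau) x * (trig_poly P x * trig_poly Q x) + - (1))%C
          with (e (- tau) x * (trig_poly P x * trig_poly Q x - e tau x))%C.
        * rewrite Cmod_mult, Cmod_e, Rmult_1_l; apply HPQ.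
        * rewrite e_opp; field; apply e_neq_0.
    - unfold l1; rewrite shiftE_app, trig_poly_app, shiftE_tmono, shiftE_tmul, trig_poly_tmono,
        trig_poly_tmul; cbn [fst snd].
      unfold tconst; cbn [shiftE map fst snd]; rewrite trig_poly_cons; cbn [fst snd].
      unfold Y, X; rewrite trig_poly_tmono; cbn [fst snd].
      rewrite e_zero, Rmult_0_l, Ropp_0, exp_0.
      replace (- (- tau * y)) with (tau * y) by ring.
      unfold trig_poly at 3; cbn; ring. }
  assert (HX : forall t, Cmod (trig_poly X t) <= F * exp (A * Rabs y))
    by (apply shiftE_bound; assumption).
  assert (HY : forall t, Cmod (trig_poly Y t) <= F * exp (2 * A * Rabs y)).
  { intros t; unfold Y; rewrite trig_poly_tmono; cbn [fst snd].
    rewrite !Cmod_mult, Cmod_e, Cmod_R, Rabs_pos_eq, Rmult_1_r by apply Rlt_le, exp_pos.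
    replace (2 * A * Rabs y) with (A * Rabs y + A * Rabs y) by ring; rewrite exp_plus.
    assert (K1 := shiftE_bound Q A F y HQA HQF t).
    assert (K2 : exp (tau * y) <= exp (A * Rabs y)).
    { apply exp_le_mono; eapply Rle_trans; [apply Rle_abs|]; rewrite Rabs_mult.
      apply Rmult_le_compat_r; assumption. }
    replace (F * (exp (A * Rabs y) * exp (A * Rabs y)))
      with (exp (A * Rabs y) * (F * exp (A * Rabs y))) by ring.
    apply Rmult_le_compat; [apply Rlt_le, exp_pos|apply Cmod_ge_0|exact K2|exact K1]. }
  assert (HexpL : exp L = 2 * F * exp (2 * A * Rabs y)).
  { unfold L; rewrite exp_plus, exp_ln; [reflexivity|lra]. }
  assert (HE : 1 <= exp (A * Rabs y)).
  { rewrite <- exp_0; apply exp_le_mono, Rmult_le_pos; assumption. }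
  assert (HE2 : exp (2 * A * Rabs y) = exp (A * Rabs y) * exp (A * Rabs y)).
  { rewrite <- exp_plus; f_equal; ring. }
  (* The smallness of [eps] gives [|X Y| >= 1/2], and [|Y| <= F exp (2 A |y|)]; hence [X] is free of
     zeros on this line, with [L] independent of [eps]. *)
  assert (Hlow : forall t, exp (- L) <= Cmod (trig_poly X t)).
  { intros t; rewrite exp_Ropp; specialize (HXY t); specialize (HY t).
    assert (K : 1 / 2 <= Cmod (trig_poly X t) * Cmod (trig_poly Y t)).
    { rewrite <- Cmod_mult.
      assert (T := Cmod_triangle (trig_poly X t * trig_poly Y t)
        (- (trig_poly X t * trig_poly Y t - 1))).
      rewrite Cmod_opp in T.
      replace (trig_poly X t * trig_poly Y t + - (trig_poly X t * trig_poly Y t - 1))%C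
        with (RtoC 1) in T by ring.
      rewrite Cmod_1 in T; lra. }
    apply (Rmult_le_reg_r (exp L)); [apply exp_pos|]; rewrite Rinv_l by apply Rgt_not_eq, exp_pos.
    rewrite HexpL.
    assert (Cmod (trig_poly X t) * Cmod (trig_poly Y t)
      <= Cmod (trig_poly X t) * (F * exp (2 * A * Rabs y)))
      by (apply Rmult_le_compat_l; [apply Cmod_ge_0|exact HY]).
    lra. }
  assert (Hup : forall t, Cmod (trig_poly X t) <= exp L).
  { intros t; eapply Rle_trans; [apply HX|]; rewrite HexpL, HE2.
    assert (F * exp (A * Rabs y) * 1 <= F * exp (A * Rabs y) * exp (A * Rabs y)).
    { apply Rmult_le_compat_l; [apply Rmult_le_pos; lra|exact HE]. }
    assert (0 <= F * exp (A * Rabs y) * exp (A * Rabs y))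
      by (repeat apply Rmult_le_pos; lra).
    lra. }
  assert (HUy : forall t, trig_poly (shiftE y U) t
    = (trig_poly (tder X) t * trig_poly Y t)%C).
  { intros t; unfold U, log_der; rewrite shiftE_tmono, shiftE_tmul, shiftE_tder.
    unfold Y, X; rewrite !trig_poly_tmono, trig_poly_tmul; cbn [fst snd].
    replace (- (- tau * y)) with (tau * y) by ring; ring. }
  assert (HXnz : forall t, trig_poly X t <> RtoC 0).
  { intros t; apply Cmod_gt_0; eapply Rlt_le_trans; [apply exp_pos|apply Hlow]. }
  assert (HNDX : NoDup (freqs X)) by (unfold X; rewrite freqs_shiftE; exact HND).
  assert (HPAX : forall b, In b (freqs X) -> Rabs b <= A)
    by (unfold X; rewrite freqs_shiftE; exact HPA).
  assert (K := log_derivative_mean X (shiftE y U) L (exp L * c) a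
    (fun t => conj (Hlow t) (Hup t))).
  specialize (K ltac:(apply Rmult_le_pos; [apply Rlt_le, exp_pos|exact Hc])).
  assert (HK : forall t, Cmod (trig_poly (shiftE y U) t - trig_poly (tder X) t / trig_poly X t)%C
    <= exp L * c * Cmod (trig_poly (tder X) t)).
  { intros t; rewrite HUy.
    replace (trig_poly (tder X) t * trig_poly Y t - trig_poly (tder X) t / trig_poly X t)%C
      with (/ trig_poly X t * (trig_poly X t * trig_poly Y t - 1) * trig_poly (tder X) t)%C
      by (field; apply HXnz).
    rewrite !Cmod_mult, Cmod_inv by apply HXnz.
    apply Rmult_le_compat_r; [apply Cmod_ge_0|].
    apply Rmult_le_compat; [| apply Cmod_ge_0| |apply HXY].
    - apply Rlt_le, Rinv_0_lt_compat, Cmod_gt_0, HXnz.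
    - specialize (Hlow t); rewrite exp_Ropp in Hlow.
      rewrite <- (Rinv_inv (exp L)); apply Rinv_le_contravar; [|exact Hlow].
      apply Rinv_0_lt_compat, exp_pos. }
  specialize (K HK HNDX).
  (* [Re U] is half of [U] plus its conjugate, and conjugation carries the coefficient at [- a] to
     [a]. *)
  assert (HM : M (fun t => (e (- a) t * RtoC (Re (trig_poly (shiftE y U) t)))%C)
    = (/ 2 * (coef U a * RtoC (exp (- (a * y))) + Cconj (coef U (- a) * RtoC (exp (a * y)))))%C).
  { rewrite (M_ext _ (trig_poly (tmono (RtoC (/ 2), - a) (shiftE y U ++ tconj (shiftE y U))))).
    - rewrite M_trig_poly, coef_tmono, coef_app; cbn [fst snd].
      replace (0 - - a) with a by ring.
      replace (coef (tconj (shiftE y U)) a) with (Cconj (coef (shiftE y U) (- a)))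
        by (rewrite <- coef_tconj, Ropp_involutive; reflexivity).
      rewrite !coef_shiftE; replace (- (- a * y)) with (a * y) by ring.
      rewrite RtoC_inv by lra; reflexivity.
    - intros t; rewrite trig_poly_tmono, trig_poly_app, trig_poly_tconj; cbn [fst snd].
      replace (RtoC (Re (trig_poly (shiftE y U) t)))
        with (RtoC (/ 2) * (trig_poly (shiftE y U) t + Cconj (trig_poly (shiftE y U) t)))%C;
        [ring|].
      generalize (trig_poly (shiftE y U) t); intros z.
      apply injective_projections; unfold Cplus, Cmult, Cconj, RtoC, Re; cbn [fst snd]; field. }
  rewrite HM in K.
  assert (Hsq : sq_norm (tder X) <= exp (A * Rabs y) ^ 2 * (A ^ 2 * F ^ 2)).
  { unfold X; eapply Rle_trans; [apply sq_norm_tder; exact HPAX|].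
    assert (K1 := sq_norm_shiftE P A y HPA); assert (K2 := sq_norm_le P F HND HPF).
    assert (exp (A * Rabs y) ^ 2 * sq_norm P <= exp (A * Rabs y) ^ 2 * F ^ 2)
      by (apply Rmult_le_compat_l; [apply pow2_ge_0|exact K2]).
    apply Rle_trans with (A ^ 2 * (exp (A * Rabs y) ^ 2 * F ^ 2)); [|right; ring].
    apply Rmult_le_compat_l; [apply pow2_ge_0|lra]. }
  assert (K3 : exp L * c * ((1 + sq_norm (tder X)) / 2)
    <= exp L * c * ((1 + exp (A * Rabs y) ^ 2 * (A ^ 2 * F ^ 2)) / 2)).
  { apply Rmult_le_compat_l; [apply Rmult_le_pos; [apply Rlt_le, exp_pos|exact Hc]|lra]. }
  set (u := (coef U a * RtoC (exp (- (a * y))))%C) in *.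
  set (v := (coef U (- a) * RtoC (exp (a * y)))%C) in *.
  replace (Cmod (coef U a) * exp (- (a * y))) with (Cmod u)
    by (unfold u; rewrite Cmod_mult, Cmod_R, Rabs_pos_eq by apply Rlt_le, exp_pos; reflexivity).
  replace (Cmod (coef U (- a)) * exp (a * y)) with (Cmod v)
    by (unfold v; rewrite Cmod_mult, Cmod_R, Rabs_pos_eq by apply Rlt_le, exp_pos; reflexivity).
  replace u with (2 * (/ 2 * (u + Cconj v)) + - Cconj v)%C by field.
  eapply Rle_trans; [apply Cmod_triangle|]; rewrite Cmod_opp, Cmod_conj, Cmod_mult, Cmod_R.
  rewrite Rabs_pos_eq by lra; lra.
Qed.

(** Quadratic growth is enough against bounds linear in [y]. It follows from squaring
    [1 + x / 2 <= exp (x / 2)]. *)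
Lemma exp_ge_sq (x : R) : 0 <= x -> x ^ 2 / 4 <= exp x.
Proof.
  intros Hx; replace x with (x / 2 + x / 2) at 2 by field; rewrite exp_plus.
  assert (H : 1 + x / 2 <= exp (x / 2)).
  { destruct (Req_dec_T x 0) as [->|Hn].
    - replace (0 / 2) with 0 by field; rewrite exp_0; lra.
    - apply Rlt_le, exp_ineq1; lra. }
  assert (x / 2 * (x / 2) <= exp (x / 2) * exp (x / 2)) by (apply Rmult_le_compat; lra).
  lra.
Qed.

(* The coefficient of [P' / P] at [a] gets the factor [exp (- a y)] under the shift to [i y],
   whereas [ln |P|] grows only linearly in [y]; letting [a y] tend to minus infinity kills it. *)
Lemma log_der_coef_small (A F tau a eta : R) :
  a <> 0 -> 0 < eta -> 1 <= F -> Rabs tau <= A ->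
  exists eps0, 0 < eps0 /\ forall P Q : list (C * R),
    approx_factors A F tau eps0 P Q ->
    Cmod (coef (log_der P Q tau) a) <= eta.
Proof.
  intros Ha Heta HF Htau.
  assert (HA : 0 <= A) by (eapply Rle_trans; [apply Rabs_pos|exact Htau]).
  set (c := Rabs a); assert (Hc : 0 < c) by (apply Rabs_pos_lt, Ha).
  set (K := F * ((1 + A ^ 2 * F ^ 2) / 2)).
  assert (HK : 0 <= K).
  { unfold K; generalize (pow2_ge_0 A) (pow2_ge_0 F); intros.
    assert (0 <= A ^ 2 * F ^ 2) by (apply Rmult_le_pos; assumption).
    apply Rmult_le_pos; lra. }
  assert (HlnF : 0 <= ln (2 * F)) by (rewrite <- ln_1; apply ln_le; lra).
  set (C0 := K + 2 * c * ln (2 * F) + 4 * c * A).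
  assert (HC0 : 0 <= C0).
  { unfold C0; assert (0 <= c * ln (2 * F)) by (apply Rmult_le_pos; lra).
    assert (0 <= c * A) by (apply Rmult_le_pos; lra); lra. }
  (* The height of the shift: [exp (c s) >= (c s)^2 / 4] then gives [C0 s <= eta / 2 exp (c s)],
     where [C0 s] dominates all terms linear in the height. *)
  set (s := Rmax 1 (8 * C0 / (c ^ 2 * eta))).
  assert (Hs1 : 1 <= s) by apply Rmax_l.
  assert (Hc2 : 0 < c ^ 2) by (apply pow_lt, Hc).
  assert (Hs2 : 8 * C0 <= s * (c ^ 2 * eta)).
  { apply Rle_trans with (8 * C0 / (c ^ 2 * eta) * (c ^ 2 * eta)); [right; field; split; lra|].
    apply Rmult_le_compat_r; [apply Rmult_le_pos; lra|apply Rmax_r]. }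
  clearbody s.
  set (L := ln (2 * F) + 2 * A * s).
  set (E := exp L * ((1 + exp (A * s) ^ 2 * (A ^ 2 * F ^ 2)) / 2)).
  assert (HE : 0 < E).
  { apply Rmult_lt_0_compat; [apply exp_pos|].
    generalize (pow2_ge_0 (exp (A * s))) (pow2_ge_0 A) (pow2_ge_0 F); intros.
    assert (0 <= exp (A * s) ^ 2 * (A ^ 2 * F ^ 2)) by (apply Rmult_le_pos; [|apply Rmult_le_pos]; assumption).
    lra. }
  (* Fixed after [s], so it can pay for the factor [exp (3 A s)] by which the shift enlarges the
     error. *)
  set (eps0 := Rmin (1 / 2) (eta / (4 * E)) / exp (3 * A * s)).
  exists eps0; split.
  { apply Rdiv_lt_0_compat; [|apply exp_pos]; apply Rmin_pos; [lra|].
    apply Rdiv_lt_0_compat; lra. }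
  intros P Q HPQ; assert (HU := fun b => log_der_coef_bound A F tau eps0 P Q b HPQ).
  (* The sign makes [a y = - c s]: the coefficient at [a] is amplified and the one at [- a]
     damped. *)
  set (y := if Rlt_dec 0 a then - s else s).
  assert (Hyabs : Rabs y = s).
  { unfold y; destruct (Rlt_dec 0 a); [rewrite Rabs_Ropp|]; apply Rabs_pos_eq; lra. }
  assert (Hay : a * y = - (c * s)).
  { unfold y, c; destruct (Rlt_dec 0 a); [rewrite Rabs_pos_eq by lra|rewrite Rabs_left by lra]; ring. }
  assert (Heps : eps0 * exp (3 * A * Rabs y) = Rmin (1 / 2) (eta / (4 * E))).
  { rewrite Hyabs; unfold eps0; field; apply Rgt_not_eq, exp_pos. }
  assert (B := log_der_shift_bound P Q A F tau a y eps0 HPQ Htau HF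
    ltac:(rewrite Heps; apply Rmin_l)).
  rewrite Heps, Hyabs in B; fold L in B; fold c in B.
  rewrite Hay, Ropp_involutive in B.
  set (x0 := Cmod (coef (log_der P Q tau) a)) in *.
  assert (B1 : exp L * Rmin (1 / 2) (eta / (4 * E)) * ((1 + exp (A * s) ^ 2 * (A ^ 2 * F ^ 2)) / 2)
    <= eta / 4).
  { apply Rle_trans with (E * (eta / (4 * E))); [|right; field; lra].
    replace (exp L * Rmin (1 / 2) (eta / (4 * E)) * ((1 + exp (A * s) ^ 2 * (A ^ 2 * F ^ 2)) / 2))
      with (E * Rmin (1 / 2) (eta / (4 * E))) by (unfold E; ring).
    apply Rmult_le_compat_l; [lra|apply Rmin_r]. }
  assert (Hcs : 0 <= c * s) by (apply Rmult_le_pos; lra).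
  assert (B2 : exp (- (c * s)) <= 1).
  { rewrite <- exp_0; apply exp_le_mono; lra. }
  assert (B3 : Cmod (coef (log_der P Q tau) (- a)) * exp (- (c * s)) <= K * 1).
  { apply Rmult_le_compat; [apply Cmod_ge_0|apply Rlt_le, exp_pos|apply HU|exact B2]. }
  assert (B4 : K + 2 * (c * L) <= C0 * s).
  { unfold C0, L; assert (K <= K * s) by nra.
    assert (0 <= c * ln (2 * F)) by (apply Rmult_le_pos; lra).
    assert (c * ln (2 * F) <= c * ln (2 * F) * s) by nra.
    lra. }
  assert (Hexp := exp_ge_sq (c * s) Hcs).
  assert (Hexp1 : 1 <= exp (c * s)) by (rewrite <- exp_0; apply exp_le_mono; lra).
  assert (B5 : x0 * exp (c * s) <= C0 * s + eta / 2) by lra.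
  assert (B6 : C0 * s <= eta / 2 * exp (c * s)).
  { apply Rle_trans with (eta / 2 * ((c * s) ^ 2 / 4)); [|apply Rmult_le_compat_l; lra].
    replace (eta / 2 * ((c * s) ^ 2 / 4)) with (s * (c ^ 2 * eta) * s / 8) by field.
    assert (8 * C0 * s <= s * (c ^ 2 * eta) * s) by (apply Rmult_le_compat_r; lra).
    lra. }
  apply (Rmult_le_reg_r (exp (c * s))); [apply exp_pos|].
  assert (eta / 2 <= eta / 2 * exp (c * s)) by nra.
  lra.
Qed.

Lemma coef_tder (l : list (C * R)) (b : R) : coef (tder l) b = (RtoC b * Ci * coef l b)%C.
Proof.
  induction l as [|p l IH]; [cbn; ring|].
  cbn [tder map]; fold (tder l); rewrite !coef_cons, IH; cbn [fst snd].
  destruct (Req_dec_T (snd p) b) as [<-|]; ring.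
Qed.

(** If the relevant nonzero frequencies of [U] are negligible, multiplication by [U] acts on
    coefficients like multiplication by the mean of [U]. *)
Lemma coef_tmul_near_const (l U : list (C * R)) (b eta : R) :
  (forall p, In p l -> snd p <> b -> Cmod (coef U (b - snd p)) <= eta) -> 0 <= eta ->
  Cmod (coef (tmul l U) b - coef l b * coef U 0)%C <= wnorm l * eta.
Proof.
  intros H Heta; induction l as [|p l IH].
  - unfold wnorm; cbn; replace (0 - 0 * coef U 0)%C with (RtoC 0) by ring; rewrite Cmod_0; lra.
  - change (tmul (p :: l) U) with (tmono p U ++ tmul l U).
    rewrite coef_app, coef_tmono, coef_cons, wnorm_cons.
    assert (IH' := IH (fun q Hq => H q (or_intror Hq))).
    specialize (H p (or_introl eq_refl)).
    assert (K : Cmod (fst p * coef U (b - snd p)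
      - (if Req_dec_T (snd p) b then fst p else RtoC 0) * coef U 0)%C <= Cmod (fst p) * eta).
    { destruct (Req_dec_T (snd p) b) as [E|E].
      - rewrite E; replace (b - b) with 0 by ring.
        replace (fst p * coef U 0 - fst p * coef U 0)%C with (RtoC 0) by ring.
        rewrite Cmod_0; apply Rmult_le_pos; [apply Cmod_ge_0|exact Heta].
      - replace (fst p * coef U (b - snd p) - 0 * coef U 0)%C
          with (fst p * coef U (b - snd p)%R)%C by ring.
        rewrite Cmod_mult; apply Rmult_le_compat_l; [apply Cmod_ge_0|apply H, E]. }
    replace (fst p * coef U (b - snd p) + coef (tmul l U) b
      - ((if Req_dec_T (snd p) b then fst p else RtoC 0) + coef l b) * coef U 0)%C
      with ((fst p * coef U (b - snd p)%R - (if Req_dec_T (snd p) b then fst p else RtoC 0) * coef U 0)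
        + (coef (tmul l U) b - coef l b * coef U 0))%C by ring.
    eapply Rle_trans; [apply Cmod_triangle|]; lra.
Qed.

Lemma log_der_coefs_small (A F tau eta : R) (s : list R) :
  0 < eta -> 1 <= F -> Rabs tau <= A ->
  exists eps0, 0 < eps0 /\ forall P Q : list (C * R),
    approx_factors A F tau eps0 P Q ->
    forall a, In a s -> a <> 0 -> Cmod (coef (log_der P Q tau) a) <= eta.
Proof.
  intros Heta HF Htau; induction s as [|a s [eps1 [He1 IH]]].
  - exists 1; split; [lra|]; intros P Q _ a [].
  - destruct (Req_dec_T a 0) as [Ha|Ha].
    + exists eps1; split; [exact He1|]; intros P Q HPQ b [<-|Hb] Hn;
        [contradiction|apply IH; assumption].
    + destruct (log_der_coef_small A F tau a eta Ha Heta HF Htau) as [eps2 [He2 K]].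
      exists (Rmin eps1 eps2); split; [apply Rmin_pos; assumption|].
      intros P Q HPQ b [<-|Hb] Hn.
      * apply K; auto; apply (approx_factors_mono _ _ _ _ _ _ _ (Rmin_r eps1 eps2) HPQ).
      * apply IH; auto; apply (approx_factors_mono _ _ _ _ _ _ _ (Rmin_l eps1 eps2) HPQ).
Qed.

Lemma trig_approx (f : R -> C) (A eps : R) :
  APin (fun b => Rabs b <= A) f -> 0 < eps ->
  exists P : list (C * R), NoDup (freqs P) /\ (forall b, In b (freqs P) -> Rabs b <= A) /\
    forall x, Cmod (f x - trig_poly P x)%C <= eps.
Proof.
  intros Hf Heps; destruct (bochner_fejer f eps (APin_AP _ _ Hf) Heps) as [P [H1 [H2 H3]]].
  exists P; split; [exact H1|split].
  - intros b Hb; apply in_map_iff in Hb; destruct Hb as [p [<- Hp]].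
    apply (APin_Omega _ _ _ Hf), H2, Hp.
  - intros x; apply Rlt_le, H3.
Qed.

Lemma Cmod_sum5 (a b c d f : C) :
  Cmod (a + (b + (c + (d + f))))%C <= Cmod a + Cmod b + Cmod c + Cmod d + Cmod f.
Proof.
  generalize (Cmod_triangle a (b + (c + (d + f)))) (Cmod_triangle b (c + (d + f)))
    (Cmod_triangle c (d + f)) (Cmod_triangle d f); lra.
Qed.

(* Hadamard: a zero-free entire function of exponential type is an exponential. *)
Lemma single_frequency (x phi : R -> C) (A tau b1 b2 : R) :
  APin (fun b => Rabs b <= A) x -> APin (fun b => Rabs b <= A) phi ->
  (forall t, (x t * phi t)%C = e tau t) ->
  Omega x b1 -> Omega x b2 -> b1 = b2.
Proof.
  intros Hx Hphi Hprod HO1 HO2.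
  destruct (Req_dec_T b1 b2) as [|Hne]; [assumption|exfalso].
  set (A1 := Rmax A (Rabs tau)).
  assert (HAA : forall b, Rabs b <= A -> Rabs b <= A1)
    by (intros b Hb; eapply Rle_trans; [exact Hb|apply Rmax_l]).
  assert (Htau : Rabs tau <= A1) by apply Rmax_r.
  apply (APin_mono _ (fun b => Rabs b <= A1) _ HAA) in Hx.
  apply (APin_mono _ (fun b => Rabs b <= A1) _ HAA) in Hphi.
  clearbody A1; clear A HAA; rename A1 into A.
  assert (HxAP := APin_AP _ _ Hx); assert (HpAP := APin_AP _ _ Hphi).
  destruct (bounded_AP x HxAP) as [B1 [HB1 Hx1]].
  destruct (bounded_AP phi HpAP) as [B2 [HB2 Hp1]].
  set (F := B1 + B2 + 1); assert (HF : 1 <= F) by (unfold F; lra).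
  set (K' := (1 + A ^ 2 * F ^ 2) / 2).
  assert (HK' : 0 <= K').
  { unfold K'; assert (0 <= A ^ 2 * F ^ 2) by (apply Rmult_le_pos; apply pow2_ge_0); lra. }
  assert (HK : 0 <= F * K') by (apply Rmult_le_pos; lra).
  set (c1 := Cmod (bohr x b1)); set (c2 := Cmod (bohr x b2)).
  assert (Hc1 : 0 < c1) by (apply Cmod_gt_0, HO1).
  assert (Hc2 : 0 < c2) by (apply Cmod_gt_0, HO2).
  set (d := Rabs (b1 - b2)); assert (Hd : 0 < d) by (apply Rabs_pos_lt; lra).
  (* The final contradiction is [|b1 - b2| <= sg / c1 + sg / c2 = d / 2]. *)
  set (sg := d * c1 * c2 / (2 * (c1 + c2))).
  assert (Hsg : 0 < sg).
  { apply Rdiv_lt_0_compat; [repeat apply Rmult_lt_0_compat; assumption|lra]. }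
  set (eps0 := sg / (3 * (2 * (F * K') + 1))).
  assert (He0 : 0 < eps0) by (apply Rdiv_lt_0_compat; lra).
  (* [P0] is a coarse approximant fixed in advance. Only finitely many coefficients of the
     logarithmic derivative meet its frequencies, so they can be made small together by choosing the
     fine approximants [P] and [Q] afterwards; the frequencies of [P] itself change with [eps]. *)
  destruct (trig_approx x A eps0 Hx He0) as [P0 [_ [_ HP0]]].
  set (eta := sg / (3 * (wnorm P0 + 1))).
  assert (HwP0 := wnorm_ge_0 P0).
  assert (Heta : 0 < eta) by (apply Rdiv_lt_0_compat; lra).
  destruct (log_der_coefs_small A F tau eta
    (map (fun g => b1 - g) (freqs P0) ++ map (fun g => b2 - g) (freqs P0)) Heta HF Htau)
    as [eps1 [He1 Hsmall]].
  set (S3 := Rabs b1 + Rabs b2 + 3 * (F * K') + 1).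
  assert (HS3 : 0 < S3) by (unfold S3; generalize (Rabs_pos b1) (Rabs_pos b2); lra).
  set (eps := Rmin 1 (Rmin (eps1 / (2 * F)) (sg / (3 * S3)))).
  assert (He : 0 < eps).
  { repeat apply Rmin_pos; [lra| |]; apply Rdiv_lt_0_compat; lra. }
  assert (He_1 : eps <= 1) by apply Rmin_l.
  assert (He_2 : F * (eps + eps) <= eps1).
  { apply Rle_trans with (2 * F * (eps1 / (2 * F))); [|right; field; lra].
    replace (F * (eps + eps)) with (2 * F * eps) by ring.
    apply Rmult_le_compat_l; [lra|]; eapply Rle_trans; [apply Rmin_r|apply Rmin_l]. }
  assert (He_3 : S3 * eps <= sg / 3).
  { apply Rle_trans with (S3 * (sg / (3 * S3))); [|right; field; lra].
    apply Rmult_le_compat_l; [lra|]; eapply Rle_trans; [apply Rmin_r|apply Rmin_r]. }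
  destruct (trig_approx x A eps Hx He) as [P [HND [HPA HP]]].
  destruct (trig_approx phi A eps Hphi He) as [Q [_ [HQA HQ]]].
  clearbody eps.
  assert (approx_bound : forall (f : R -> C) (l : list (C * R)) B, B + 1 <= F ->
    (forall t, Cmod (f t) <= B) -> (forall t, Cmod (f t - trig_poly l t)%C <= eps) ->
    forall t, Cmod (trig_poly l t) <= F).
  { intros f l B HB Hf Hl t.
    replace (trig_poly l t) with (f t + - (f t - trig_poly l t))%C by ring.
    eapply Rle_trans; [apply Cmod_triangle|]; rewrite Cmod_opp.
    generalize (Hf t) (Hl t); lra. }
  assert (HPF := approx_bound x P B1 ltac:(unfold F; lra) Hx1 HP).
  assert (HQF := approx_bound phi Q B2 ltac:(unfold F; lra) Hp1 HQ).
  assert (HPQ : forall t, Cmod (trig_poly P t * trig_poly Q t - e tau t)%C <= F * (eps + eps)).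
  { intros t; rewrite <- Hprod; apply Cmod_prod_diff.
    - apply HPF.
    - generalize (Hp1 t); unfold F; lra.
    - replace (trig_poly P t - x t)%C with (- (x t - trig_poly P t))%C by ring.
      rewrite Cmod_opp; apply HP.
    - replace (trig_poly Q t - phi t)%C with (- (phi t - trig_poly Q t))%C by ring.
      rewrite Cmod_opp; apply HQ. }
  set (U := log_der P Q tau).
  assert (HeQ : AP (fun t => (e (- tau) t * trig_poly Q t)%C))
    by (apply AP_mult; [apply AP_e|apply AP_trig_poly]).
  assert (HU : forall b, Cmod (coef U b) <= F * K')
    by (intros b; apply (log_der_coef_bound A F tau (F * (eps + eps)) P Q);
      repeat split; assumption).
  (* The coefficient at [b] of [x' = U x], with [U] nearly constant: [i b - coef U 0] must be small
     wherever [x] has a sizeable coefficient. The five errors come from passing from [x] to [P],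
     from [P'] to [P U], from [P] to [P0], from [U] to its mean, and from [P0] back to [x]. *)
  assert (Hmain : forall b, (b = b1 \/ b = b2) ->
    Cmod ((RtoC b * Ci - coef U 0) * bohr x b)%C <= sg).
  { intros b Hb.
    assert (E1 : Cmod (bohr x b - coef P b)%C <= eps).
    { rewrite <- bohr_trig_poly; apply bohr_approx; auto using AP_trig_poly. }
    assert (E2 : Cmod (coef P0 b - bohr x b)%C <= eps0).
    { replace (coef P0 b - bohr x b)%C with (- (bohr x b - coef P0 b))%C by ring.
      rewrite Cmod_opp, <- bohr_trig_poly; apply bohr_approx; auto using AP_trig_poly. }
    assert (E3 : Cmod (RtoC b * Ci * coef P b - coef (tmul P U) b)%C <= F * (eps + eps) * K').
    { rewrite <- coef_tder, <- !bohr_trig_poly, <- bohr_minus by apply AP_trig_poly.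
      rewrite (bohr_ext _ (fun t => (trig_poly (tder P) t
        * (1 - e (- tau) t * (trig_poly P t * trig_poly Q t)))%C)).
      - apply bohr_tder_mult; auto.
        + apply AP_minus; [apply AP_const|].
          apply AP_mult; [apply AP_e|apply AP_mult; apply AP_trig_poly].
        + intros t.
          replace (1 - e (- tau) t * (trig_poly P t * trig_poly Q t))%C
            with (- (e (- tau) t * (trig_poly P t * trig_poly Q t - e tau t)))%C.
          * rewrite Cmod_opp, Cmod_mult, Cmod_e, Rmult_1_l; apply HPQ.
          * rewrite e_opp; field; apply e_neq_0.
      - intros t; rewrite trig_poly_tmul; unfold U; rewrite trig_poly_log_der; ring. }
    assert (E4 : Cmod (coef (tmul P U) b - coef (tmul P0 U) b)%C <= F * (eps + eps0) * K').
    { rewrite <- !bohr_trig_poly, <- bohr_minus by apply AP_trig_poly.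
      rewrite (bohr_ext _ (fun t => (trig_poly (tder P) t
        * (e (- tau) t * trig_poly Q t * (trig_poly P t - trig_poly P0 t)))%C)).
      - apply bohr_tder_mult; auto.
        + apply AP_mult; [exact HeQ|apply AP_minus; apply AP_trig_poly].
        + intros t; rewrite !Cmod_mult, Cmod_e, Rmult_1_l.
          apply Rmult_le_compat; [apply Cmod_ge_0|apply Cmod_ge_0|apply HQF|].
          replace (trig_poly P t - trig_poly P0 t)%C
            with (- (x t - trig_poly P t) + (x t - trig_poly P0 t))%C by ring.
          eapply Rle_trans; [apply Cmod_triangle|]; rewrite Cmod_opp.
          generalize (HP t) (HP0 t); lra.
      - intros t; rewrite !trig_poly_tmul; unfold U; rewrite trig_poly_log_der; ring. }
    assert (E5 : Cmod (coef (tmul P0 U) b - coef P0 b * coef U 0)%C <= wnorm P0 * eta).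
    { apply coef_tmul_near_const; [|lra]; intros p Hp Hpb.
      apply (Hsmall P Q).
      { apply (approx_factors_mono _ _ _ _ _ _ _ He_2); repeat split; assumption. }
      - apply in_app_iff; destruct Hb as [-> | ->]; [left|right];
          apply in_map_iff; exists (snd p); (split; [reflexivity|apply in_map, Hp]).
      - lra. }
    replace ((RtoC b * Ci - coef U 0) * bohr x b)%C with
      (RtoC b * Ci * (bohr x b - coef P b)
       + ((RtoC b * Ci * coef P b - coef (tmul P U) b)
       + ((coef (tmul P U) b - coef (tmul P0 U) b)
       + ((coef (tmul P0 U) b - coef P0 b * coef U 0)
       + coef U 0 * (coef P0 b - bohr x b)))))%C by ring.
    eapply Rle_trans; [apply Cmod_sum5|]; rewrite !Cmod_mult, Cmod_R, Cmod_Ci, Rmult_1_r.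
    assert (G1 : Rabs b * Cmod (bohr x b - coef P b)%C <= Rabs b * eps)
      by (apply Rmult_le_compat_l; [apply Rabs_pos|exact E1]).
    assert (G2 : Cmod (coef U 0) * Cmod (coef P0 b - bohr x b)%C <= F * K' * eps0)
      by (apply Rmult_le_compat; auto using Cmod_ge_0).
    assert (G3 : (Rabs b + 3 * (F * K')) * eps <= S3 * eps).
    { apply Rmult_le_compat_r; [lra|]; unfold S3.
      generalize (Rabs_pos b1) (Rabs_pos b2); destruct Hb as [-> | ->]; lra. }
    assert (G4 : (2 * (F * K') + 1) * eps0 = sg / 3) by (unfold eps0; field; lra).
    assert (G5 : (wnorm P0 + 1) * eta = sg / 3) by (unfold eta; field; lra).
    lra. }
  assert (H1 := Hmain b1 (or_introl eq_refl)); assert (H2 := Hmain b2 (or_intror eq_refl)).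
  rewrite Cmod_mult in H1, H2; fold c1 in H1; fold c2 in H2.
  set (z1 := Cmod (RtoC b1 * Ci - coef U 0)%C) in *.
  set (z2 := Cmod (RtoC b2 * Ci - coef U 0)%C) in *.
  assert (Hz : d <= z1 + z2).
  { replace d with (Cmod ((RtoC b1 * Ci - coef U 0) + - (RtoC b2 * Ci - coef U 0))%C).
    - eapply Rle_trans; [apply Cmod_triangle|]; rewrite Cmod_opp; apply Rle_refl.
    - replace ((RtoC b1 * Ci - coef U 0) + - (RtoC b2 * Ci - coef U 0))%C
        with (RtoC (b1 - b2) * Ci)%C by (rewrite RtoC_minus; ring).
      rewrite Cmod_mult, Cmod_R, Cmod_Ci, Rmult_1_r; reflexivity. }
  assert (Hsg2 : sg * (2 * (c1 + c2)) = d * c1 * c2) by (unfold sg; field; lra).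
  assert (H1' : z1 * c1 * c2 <= sg * c2) by (apply Rmult_le_compat_r; lra).
  assert (H2' : z2 * c2 * c1 <= sg * c1) by (apply Rmult_le_compat_r; lra).
  assert (H3 : d * (c1 * c2) <= (z1 + z2) * (c1 * c2))
    by (apply Rmult_le_compat_r; [apply Rmult_le_pos; lra|exact Hz]).
  assert (0 < sg * (c1 + c2)) by (apply Rmult_lt_0_compat; lra).
  lra.
Qed.

(** * Uniqueness of the indices and necessity *)

Definition entry (A : R -> @matrix C 2 2) (i j : nat) (x : R) : C := coeff_mat (RtoC 0) (A x) i j.

Definition idx (d1 d2 : R) (i : nat) : R := match i with O => d1 | _ => d2 end.

Lemma entry_Mmult (A B : @matrix C 2 2) (i j : nat) :
  (i < 2)%nat -> (j < 2)%nat ->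
  coeff_mat (RtoC 0) (Mmult A B) i j
  = (coeff_mat (RtoC 0) A i 0 * coeff_mat (RtoC 0) B 0 j
     + coeff_mat (RtoC 0) A i 1 * coeff_mat (RtoC 0) B 1 j)%C.
Proof.
  rewrite (mx2_eta A), (mx2_eta B), Mmult_mx2.
  intros Hi Hj; destruct i as [|[|i]], j as [|[|j]]; try (exfalso; lia); reflexivity.
Qed.

Lemma is_inverse_entry (A B : R -> @matrix C 2 2) (i j : nat) (x : R) :
  is_inverse A B -> (i < 2)%nat -> (j < 2)%nat ->
  (entry A i 0 x * entry B 0 j x + entry A i 1 x * entry B 1 j x)%C
  = if Nat.eqb i j then RtoC 1 else RtoC 0.
Proof.
  intros H Hi Hj; unfold entry; rewrite <- entry_Mmult by assumption.
  rewrite (proj1 (H x)), Mone_mx2.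
  destruct i as [|[|i]], j as [|[|j]]; try (exfalso; lia); reflexivity.
Qed.

Lemma is_inverse_sym (A B : R -> @matrix C 2 2) : is_inverse A B -> is_inverse B A.
Proof. intros H x; destruct (H x); split; assumption. Qed.

Lemma is_inverse_cancel (A B : R -> @matrix C 2 2) (u v u' v' : C) (x : R) :
  is_inverse A B ->
  u' = (entry B 0 0 x * u + entry B 0 1 x * v)%C ->
  v' = (entry B 1 0 x * u + entry B 1 1 x * v)%C ->
  u = (entry A 0 0 x * u' + entry A 0 1 x * v')%C /\
  v = (entry A 1 0 x * u' + entry A 1 1 x * v')%C.
Proof.
  intros H -> ->.
  assert (E := fun i j Hi Hj => is_inverse_entry A B i j x H Hi Hj).
  split.
  - transitivity ((entry A 0 0 x * entry B 0 0 x + entry A 0 1 x * entry B 1 0 x) * u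
      + (entry A 0 0 x * entry B 0 1 x + entry A 0 1 x * entry B 1 1 x) * v)%C; [|ring].
    rewrite !E by lia; cbn [Nat.eqb]; ring.
  - transitivity ((entry A 1 0 x * entry B 0 0 x + entry A 1 1 x * entry B 1 0 x) * u
      + (entry A 1 0 x * entry B 0 1 x + entry A 1 1 x * entry B 1 1 x) * v)%C; [|ring].
    rewrite !E by lia; cbn [Nat.eqb]; ring.
Qed.

Lemma is_inverse_row_nonzero (A B : R -> @matrix C 2 2) (i : nat) (x : R) :
  is_inverse A B -> (i < 2)%nat -> entry A i 0 x = RtoC 0 -> entry A i 1 x = RtoC 0 -> False.
Proof.
  intros H Hi H0 H1; assert (E := is_inverse_entry A B i i x H Hi Hi).
  rewrite H0, H1, Nat.eqb_refl in E.
  apply (f_equal fst) in E; revert E; cbn; lra.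
Qed.

Lemma is_inverse_col_nonzero (A B : R -> @matrix C 2 2) (j : nat) (x : R) :
  is_inverse A B -> (j < 2)%nat -> entry A 0 j x = RtoC 0 -> entry A 1 j x = RtoC 0 -> False.
Proof.
  intros H Hi H0 H1; assert (E := is_inverse_entry B A j j x (is_inverse_sym _ _ H) Hi Hi).
  rewrite H0, H1, Nat.eqb_refl in E.
  apply (f_equal fst) in E; revert E; cbn; lra.
Qed.

(* [G Gp = Gm D], column by column. *)
Definition columns (lam : R) (g : R -> C) (Gm Gp : R -> @matrix C 2 2) (d1 d2 : R) : Prop :=
  forall (j : nat) (x : R), (j < 2)%nat ->
    (e (- lam) x * entry Gp 0 j x)%C = (e (idx d1 d2 j) x * entry Gm 0 j x)%C /\
    (g x * entry Gp 0 j x + e lam x * entry Gp 1 j x)%C = (e (idx d1 d2 j) x * entry Gm 1 j x)%C.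

Lemma factorization_columns (lam : R) (g : R -> C) (Gm Gp Gpi : R -> @matrix C 2 2) (d1 d2 : R) :
  is_inverse Gp Gpi ->
  (forall x, G_mat lam g x = Mmult (Mmult (Gm x) (diag_e d1 d2 x)) (Gpi x)) ->
  columns lam g Gm Gp d1 d2.
Proof.
  intros Hp HG j x Hj.
  assert (E : Mmult (G_mat lam g x) (Gp x) = Mmult (Gm x) (diag_e d1 d2 x)).
  { rewrite HG, <- Mmult_assoc, (proj2 (Hp x)).
    rewrite (mx2_eta (Gm x)); unfold diag_e; rewrite Mone_mx2, !Mmult_mx2; f_equal; ring. }
  rewrite (mx2_eta (Gp x)), (mx2_eta (Gm x)) in E; unfold G_mat, diag_e in E.
  rewrite !Mmult_mx2 in E; apply mx2_inj in E; destruct E as [E00 [E01 [E10 E11]]].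
  destruct j as [|[|j]]; [| |exfalso; lia]; unfold entry; cbn [idx]; split.
  - etransitivity; [|etransitivity; [exact E00|]]; ring.
  - etransitivity; [|etransitivity; [exact E10|]]; ring.
  - etransitivity; [|etransitivity; [exact E01|]]; ring.
  - etransitivity; [|etransitivity; [exact E11|]]; ring.
Qed.

(* [(f0, f1)] is [Phi] and [(h0, h1)] is [Psi] in an identity [G Phi = e_nu Psi]. *)
Lemma solution_coordinates (lam nu d1 d2 : R) (g f0 f1 h0 h1 : R -> C)
    (Gm Gmi Gp Gpi : R -> @matrix C 2 2) :
  is_inverse Gm Gmi -> is_inverse Gp Gpi -> columns lam g Gm Gp d1 d2 ->
  (forall x, e (- lam) x * f0 x = e nu x * h0 x)%C ->
  (forall x, g x * f0 x + e lam x * f1 x = e nu x * h1 x)%C ->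
  forall i x, (i < 2)%nat ->
    (e (idx d1 d2 i) x * (entry Gpi i 0 x * f0 x + entry Gpi i 1 x * f1 x)
     = e nu x * (entry Gmi i 0 x * h0 x + entry Gmi i 1 x * h1 x))%C.
Proof.
  intros Hm Hp HG E0 E1 i x Hi.
  set (u := (entry Gpi 0 0 x * f0 x + entry Gpi 0 1 x * f1 x)%C).
  set (v := (entry Gpi 1 0 x * f0 x + entry Gpi 1 1 x * f1 x)%C).
  destruct (is_inverse_cancel Gp Gpi (f0 x) (f1 x) u v x Hp eq_refl eq_refl) as [F0 F1].
  destruct (HG 0%nat x ltac:(lia)) as [A0 B0]; destruct (HG 1%nat x ltac:(lia)) as [A1 B1].
  cbn [idx] in A0, B0, A1, B1.
  assert (K0 : (e nu x * h0 x)%C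
    = (entry Gm 0 0 x * (e d1 x * u) + entry Gm 0 1 x * (e d2 x * v))%C).
  { rewrite <- E0, F0.
    transitivity (e (- lam) x * entry Gp 0 0 x * u + e (- lam) x * entry Gp 0 1 x * v)%C; [ring|].
    rewrite A0, A1; ring. }
  assert (K1 : (e nu x * h1 x)%C
    = (entry Gm 1 0 x * (e d1 x * u) + entry Gm 1 1 x * (e d2 x * v))%C).
  { rewrite <- E1, F0, F1.
    transitivity ((g x * entry Gp 0 0 x + e lam x * entry Gp 1 0 x) * u
      + (g x * entry Gp 0 1 x + e lam x * entry Gp 1 1 x) * v)%C; [ring|].
    rewrite B0, B1; ring. }
  destruct (is_inverse_cancel Gmi Gm _ _ _ _ x (is_inverse_sym _ _ Hm) K0 K1) as [L0 L1].
  destruct i as [|[|i]]; [| |exfalso; lia]; cbn [idx].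
  - fold u; rewrite L0; ring.
  - fold v; rewrite L1; ring.
Qed.

Lemma APplus_APin (f : R -> C) : APplus f -> APin Rnonneg f.
Proof. intros [H1 H2]; apply APin_intro; assumption. Qed.

Lemma APminus_APin (f : R -> C) : APminus f -> APin Rnonpos f.
Proof. intros [H1 H2]; apply APin_intro; assumption. Qed.

Lemma APin_combination (S1 S2 S3 : R -> Prop) (f0 f1 h0 h1 : R -> C) :
  APin S1 f0 -> APin S1 f1 -> APin S2 h0 -> APin S2 h1 ->
  (forall a b, S1 a -> S2 b -> S3 (a + b)) ->
  APin S3 (fun x => (f0 x * h0 x + f1 x * h1 x)%C).
Proof.
  intros F0 F1 H0 H1 HS; apply APin_plus; apply (APin_mult S1 S2 S3); assumption.
Qed.

Lemma e_transfer (a b : R) (x y : R -> C) :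
  (forall t, e a t * x t = e b t * y t)%C -> forall t, x t = (e (b - a) t * y t)%C.
Proof.
  intros H t; rewrite e_minus.
  transitivity (/ e a t * (e a t * x t))%C; [field; apply e_neq_0|].
  rewrite H; field; apply e_neq_0.
Qed.

(** [x = e_(b - a) y] has spectrum both in the nonnegative half-line and below [b - a < 0]. *)
Lemma plus_minus_zero (a b : R) (x y : R -> C) :
  APin Rnonneg x -> APin Rnonpos y -> (forall t, e a t * x t = e b t * y t)%C -> b < a ->
  forall t, x t = RtoC 0.
Proof.
  intros Hx Hy H Hab.
  apply (APin_disjoint Rnonneg (fun c => c <= b - a)); [exact Hx| |unfold Rnonneg; intros; lra].
  apply (APin_ext _ (fun t => (e (b - a) t * y t)%C)).
  - intros t; symmetry; revert t; apply e_transfer, H.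
  - apply (APin_e_mult Rnonpos); [exact Hy|unfold Rnonpos; intros; lra].
Qed.

(** The matrix [u = Gp^(-1) Gp'] satisfies [D u = (Gm^(-1) Gm') D'], so its entry [(i, j)] vanishes
    when [d'_j < d_i]. A larger maximum of the [d_i] would produce a zero row, a larger minimum a
    zero column, and [u] is invertible. *)
Lemma factorization_index_le (lam d1 d2 d1' d2' : R) (g : R -> C) :
  AP_factorization (G_mat lam g) d1 d2 -> AP_factorization (G_mat lam g) d1' d2' ->
  Rmax d1 d2 <= Rmax d1' d2' /\ Rmin d1 d2 <= Rmin d1' d2'.
Proof.
  intros [Gm [Gmi [Gp [Gpi [Xm [Xmi [Im [Xp [Xpi [Ip HG]]]]]]]]]]
    [Gm' [Gmi' [Gp' [Gpi' [Xm' [Xmi' [Im' [Xp' [Xpi' [Ip' HG']]]]]]]]]].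
  assert (HC := factorization_columns lam g Gm Gp Gpi d1 d2 Ip HG).
  assert (HC' := factorization_columns lam g Gm' Gp' Gpi' d1' d2' Ip' HG').
  set (u := fun i j x => (entry Gpi i 0 x * entry Gp' 0 j x + entry Gpi i 1 x * entry Gp' 1 j x)%C).
  assert (Hu : forall i j, (i < 2)%nat -> (j < 2)%nat -> idx d1' d2' j < idx d1 d2 i ->
    forall x, u i j x = RtoC 0).
  { intros i j Hi Hj Hlt.
    apply (plus_minus_zero (idx d1 d2 i) (idx d1' d2' j) _
      (fun x => (entry Gmi i 0 x * entry Gm' 0 j x + entry Gmi i 1 x * entry Gm' 1 j x)%C));
      [| | |exact Hlt].
    - apply (APin_combination Rnonneg Rnonneg); try (apply APplus_APin; first [apply Xpi|apply Xp']; lia).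
      unfold Rnonneg; intros; lra.
    - apply (APin_combination Rnonpos Rnonpos); try (apply APminus_APin; first [apply Xmi|apply Xm']; lia).
      unfold Rnonpos; intros; lra.
    - intros x; apply (solution_coordinates lam (idx d1' d2' j) d1 d2 g (entry Gp' 0 j)
        (entry Gp' 1 j) (entry Gm' 0 j) (entry Gm' 1 j) Gm Gmi Gp Gpi Im Ip HC); [| |exact Hi];
        intros t; apply (HC' j t Hj). }
  assert (Hrow : forall i, (i < 2)%nat -> idx d1' d2' 0 < idx d1 d2 i -> idx d1' d2' 1 < idx d1 d2 i -> False).
  { intros i Hi L0 L1.
    assert (U0 := Hu i 0%nat Hi ltac:(lia) L0 0); assert (U1 := Hu i 1%nat Hi ltac:(lia) L1 0).
    unfold u in U0, U1.
    assert (E : forall j, (j < 2)%nat -> entry Gpi i j 0 = RtoC 0).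
    { intros j Hj.
      transitivity ((entry Gpi i 0 0 * entry Gp' 0 0 0 + entry Gpi i 1 0 * entry Gp' 1 0 0) * entry Gpi' 0 j 0
        + (entry Gpi i 0 0 * entry Gp' 0 1 0 + entry Gpi i 1 0 * entry Gp' 1 1 0) * entry Gpi' 1 j 0)%C.
      - transitivity (entry Gpi i 0 0 * (entry Gp' 0 0 0 * entry Gpi' 0 j 0 + entry Gp' 0 1 0 * entry Gpi' 1 j 0)
          + entry Gpi i 1 0 * (entry Gp' 1 0 0 * entry Gpi' 0 j 0 + entry Gp' 1 1 0 * entry Gpi' 1 j 0))%C; [|ring].
        rewrite !(is_inverse_entry Gp' Gpi') by (assumption || lia).
        destruct j as [|[|j]]; [| |exfalso; lia]; cbn [Nat.eqb]; ring.
      - rewrite U0, U1; ring. }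
    apply (is_inverse_row_nonzero Gpi Gp i 0 (is_inverse_sym _ _ Ip) Hi); apply E; lia. }
  assert (Hcol : forall j, (j < 2)%nat -> idx d1' d2' j < idx d1 d2 0 -> idx d1' d2' j < idx d1 d2 1 -> False).
  { intros j Hj L0 L1.
    assert (U0 := Hu 0%nat j ltac:(lia) Hj L0 0); assert (U1 := Hu 1%nat j ltac:(lia) Hj L1 0).
    destruct (is_inverse_cancel Gp Gpi (entry Gp' 0 j 0) (entry Gp' 1 j 0) _ _ 0 Ip
      (eq_sym U0) (eq_sym U1)) as [F0 F1].
    apply (is_inverse_col_nonzero Gp' Gpi' j 0 Ip' Hj); [rewrite F0|rewrite F1]; ring. }
  assert (R0 := Hrow 0%nat ltac:(lia)); assert (R1 := Hrow 1%nat ltac:(lia)).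
  assert (C0 := Hcol 0%nat ltac:(lia)); assert (C1 := Hcol 1%nat ltac:(lia)).
  cbn [idx] in *; split.
  - apply Rnot_lt_le; intros H.
    unfold Rmax in H; destruct (Rle_dec d1 d2), (Rle_dec d1' d2');
      solve [apply R1; lra | apply R0; lra].
  - apply Rnot_lt_le; intros H.
    unfold Rmin in H; destruct (Rle_dec d1 d2), (Rle_dec d1' d2');
      solve [apply C1; lra | apply C0; lra].
Qed.

Lemma factorization_index_unique (lam d1 d2 mu : R) (g : R -> C) :
  0 <= mu -> AP_factorization (G_mat lam g) (- mu) mu -> AP_factorization (G_mat lam g) d1 d2 ->
  (d1 = mu /\ d2 = - mu) \/ (d1 = - mu /\ d2 = mu).
Proof.
  intros Hmu H1 H2.
  destruct (factorization_index_le _ _ _ _ _ _ H1 H2) as [A1 A2].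
  destruct (factorization_index_le _ _ _ _ _ _ H2 H1) as [A3 A4].
  revert A1 A2 A3 A4; unfold Rmax, Rmin.
  destruct (Rle_dec (- mu) mu), (Rle_dec d1 d2); intros; lra.
Qed.

(* Compare determinants: [det Gp = e_(d1 + d2) det Gm] cannot vanish. *)
Lemma index_sum_ge_0 (lam d1 d2 : R) (g : R -> C) (Gm Gp Gpi : R -> @matrix C 2 2) :
  entries_in APminus Gm -> entries_in APplus Gp -> is_inverse Gp Gpi ->
  columns lam g Gm Gp d1 d2 -> 0 <= d1 + d2.
Proof.
  intros Xm Xp Ip HC; apply Rnot_lt_le; intros Hlt.
  assert (P : forall i j, (i < 2)%nat -> (j < 2)%nat -> APin Rnonneg (entry Gp i j))
    by (intros; apply APplus_APin, Xp; assumption).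
  assert (Q : forall i j, (i < 2)%nat -> (j < 2)%nat -> APin Rnonpos (entry Gm i j))
    by (intros; apply APminus_APin, Xm; assumption).
  assert (addp : forall a b, Rnonneg a -> Rnonneg b -> Rnonneg (a + b))
    by (unfold Rnonneg; intros; lra).
  assert (addm : forall a b, Rnonpos a -> Rnonpos b -> Rnonpos (a + b))
    by (unfold Rnonpos; intros; lra).
  set (dp := fun x => (entry Gp 0 0 x * entry Gp 1 1 x - entry Gp 0 1 x * entry Gp 1 0 x)%C).
  set (dm := fun x => (entry Gm 0 0 x * entry Gm 1 1 x - entry Gm 0 1 x * entry Gm 1 0 x)%C).
  assert (Z : forall x, dp x = RtoC 0).
  { apply (plus_minus_zero 0 (d1 + d2) dp dm); [| | |exact Hlt].
    - apply APin_minus; apply (APin_mult Rnonneg Rnonneg); auto.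
    - apply APin_minus; apply (APin_mult Rnonpos Rnonpos); auto.
    - intros x; destruct (HC 0%nat x ltac:(lia)) as [A0 B0].
      destruct (HC 1%nat x ltac:(lia)) as [A1 B1]; cbn [idx] in A0, B0, A1, B1.
      unfold dm; rewrite e_zero, e_plus.
      transitivity (e d1 x * entry Gm 0 0 x * (e d2 x * entry Gm 1 1 x)
        - e d2 x * entry Gm 0 1 x * (e d1 x * entry Gm 1 0 x))%C; [|ring].
      rewrite <- A0, <- A1, <- B0, <- B1, e_opp; unfold dp; field; apply e_neq_0. }
  assert (E := fun i j Hi Hj => is_inverse_entry Gp Gpi i j 0 Ip Hi Hj).
  specialize (Z 0); unfold dp in Z.
  assert (K : RtoC 1 = ((entry Gp 0 0 0 * entry Gp 1 1 0 - entry Gp 0 1 0 * entry Gp 1 0 0)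
    * (entry Gpi 0 0 0 * entry Gpi 1 1 0 - entry Gpi 0 1 0 * entry Gpi 1 0 0))%C).
  { transitivity ((entry Gp 0 0 0 * entry Gpi 0 0 0 + entry Gp 0 1 0 * entry Gpi 1 0 0)
      * (entry Gp 1 0 0 * entry Gpi 0 1 0 + entry Gp 1 1 0 * entry Gpi 1 1 0)
      - (entry Gp 0 0 0 * entry Gpi 0 1 0 + entry Gp 0 1 0 * entry Gpi 1 1 0)
      * (entry Gp 1 0 0 * entry Gpi 0 0 0 + entry Gp 1 1 0 * entry Gpi 1 0 0))%C; [|ring].
    rewrite !E by lia; cbn [Nat.eqb]; ring. }
  rewrite Z in K; apply (f_equal fst) in K; revert K; cbn; lra.
Qed.

(** * Necessity of the conditions at the spectral ends *)

Lemma Omega_nonempty (f : R -> C) (t : R) : AP f -> f t <> RtoC 0 -> exists a, Omega f a.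
Proof.
  intros Hf Ht; destruct (excluded_middle_informative (exists a, Omega f a)) as [|Hn]; [assumption|].
  exfalso; apply Ht.
  assert (H : APin (fun _ => False) f)
    by (apply APin_intro; [exact Hf|intros a Ha; apply Hn; exists a; exact Ha]).
  apply (APin_disjoint _ _ _ H H); auto.
Qed.

(* The coordinate [u_i] of [(e_(lam - a), - p)] has frequencies in [[0, - mu - d_i]], with one end
   excluded, so [u_i <> 0] forces [d_i < - mu]; as [d1 + d2 >= 0], only one [i] is possible. *)
Lemma single_column (lam a b d1 d2 : R) (g p q : R -> C) (Gm Gmi Gp Gpi : R -> @matrix C 2 2) :
  lam <= a + b ->
  APin Rnonneg p -> APin Rnonpos q -> a <= lam -> b <= lam ->
  (forall x, g x = (e a x * p x + e (- b) x * q x)%C) ->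
  entries_in APminus Gm -> entries_in APminus Gmi -> is_inverse Gm Gmi ->
  entries_in APplus Gp -> entries_in APplus Gpi -> is_inverse Gp Gpi ->
  columns lam g Gm Gp d1 d2 ->
  ((a < lam /\ ~ Omega p 0) \/ (b < lam /\ ~ Omega q 0)) ->
  exists (j : nat) (k k' : R) (u v : R -> C), (j < 2)%nat /\
    APin (fun c => c = k) u /\ APin (fun c => c = k') v /\ u 0 <> RtoC 0 /\ v 0 <> RtoC 0 /\
    (a < lam -> ~ Omega p 0 -> APin (fun c => 0 < c) u) /\
    (b < lam -> ~ Omega q 0 -> APin (fun c => c < 0) v) /\
    (forall x, p x = (- (entry Gp 1 j x * u x))%C) /\
    (forall x, q x = (entry Gm 1 j x * v x)%C).
Proof.
  intros Hab Hp Hq Ha Hb Hg Xm Xmi Im Xp Xpi Ip HC Hs.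
  set (mu := a + b - lam); assert (Hmu : 0 <= mu) by (unfold mu; lra).
  set (f0 := e (lam - a)); set (f1 := fun x => (- p x)%C).
  set (h0 := e (- (lam - b))); set (h1 := q).
  (* Coordinates of [Phi] in the columns of [Gp]; [v] below holds those of [G Phi] without its
     factor [e_(-mu)] in the columns of [Gm]. *)
  set (u := fun i x => (entry Gpi i 0 x * f0 x + entry Gpi i 1 x * f1 x)%C).
  set (v := fun i x => (entry Gmi i 0 x * h0 x + entry Gmi i 1 x * h1 x)%C).
  assert (Huv : forall i x, (i < 2)%nat -> (e (idx d1 d2 i) x * u i x = e (- mu) x * v i x)%C).
  { apply (solution_coordinates lam (- mu) d1 d2 g f0 f1 h0 h1 Gm Gmi Gp Gpi Im Ip HC).
    - intros x; unfold f0, h0; rewrite <- !e_plus; f_equal; unfold mu; ring.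
    - intros x; unfold f0, f1, h1; rewrite Hg.
      replace (- mu) with ((lam - a) - b) by (unfold mu; ring).
      replace lam with (a + (lam - a)) at 2 by ring.
      rewrite e_plus, (e_minus (lam - a) b), e_opp; field; apply e_neq_0. }
  assert (Pp : forall i j, (i < 2)%nat -> (j < 2)%nat -> APin Rnonneg (entry Gp i j))
    by (intros; apply APplus_APin, Xp; assumption).
  assert (Ppi : forall i j, (i < 2)%nat -> (j < 2)%nat -> APin Rnonneg (entry Gpi i j))
    by (intros; apply APplus_APin, Xpi; assumption).
  assert (Pm : forall i j, (i < 2)%nat -> (j < 2)%nat -> APin Rnonpos (entry Gm i j))
    by (intros; apply APminus_APin, Xm; assumption).
  assert (Pmi : forall i j, (i < 2)%nat -> (j < 2)%nat -> APin Rnonpos (entry Gmi i j))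
    by (intros; apply APminus_APin, Xmi; assumption).
  assert (Hu : forall i, (i < 2)%nat -> APin Rnonneg (u i)).
  { intros i Hi; apply (APin_combination Rnonneg Rnonneg).
    - apply Ppi; lia.
    - apply Ppi; lia.
    - apply APin_e; unfold Rnonneg; lra.
    - apply APin_opp, Hp.
    - unfold Rnonneg; intros; lra. }
  assert (Hv : forall i, (i < 2)%nat -> APin Rnonpos (v i)).
  { intros i Hi; apply (APin_combination Rnonpos Rnonpos).
    - apply Pmi; lia.
    - apply Pmi; lia.
    - apply APin_e; unfold Rnonpos; lra.
    - exact Hq.
    - unfold Rnonpos; intros; lra. }
  assert (Hu' : a < lam -> ~ Omega p 0 -> forall i, (i < 2)%nat -> APin (fun c => 0 < c) (u i)).
  { intros Ha' Hp0 i Hi; apply (APin_combination Rnonneg (fun c => 0 < c)).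
    - apply Ppi; lia.
    - apply Ppi; lia.
    - apply APin_e; lra.
    - apply APin_opp, APin_intro; [apply (APin_AP _ _ Hp)|]; intros c Hc.
      assert (K := APin_Omega _ _ _ Hp Hc); unfold Rnonneg in K.
      destruct K as [K| <-]; [exact K|contradiction].
    - unfold Rnonneg; intros; lra. }
  assert (Hv' : b < lam -> ~ Omega q 0 -> forall i, (i < 2)%nat -> APin (fun c => c < 0) (v i)).
  { intros Hb' Hq0 i Hi; apply (APin_combination Rnonpos (fun c => c < 0)).
    - apply Pmi; lia.
    - apply Pmi; lia.
    - apply APin_e; lra.
    - apply APin_intro; [apply (APin_AP _ _ Hq)|]; intros c Hc.
      assert (K := APin_Omega _ _ _ Hq Hc); unfold Rnonpos in K.
      destruct K as [K| ->]; [exact K|contradiction].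
    - unfold Rnonpos; intros; lra. }
  assert (Huv' : forall i, (i < 2)%nat -> forall x, u i x = (e (- mu - idx d1 d2 i) x * v i x)%C).
  { intros i Hi; apply e_transfer; intros x; apply Huv, Hi. }
  assert (Hvu' : forall i, (i < 2)%nat -> forall x, v i x = (e (idx d1 d2 i - - mu) x * u i x)%C).
  { intros i Hi; apply e_transfer; intros x; symmetry; apply Huv, Hi. }
  assert (Hzero : forall i, (i < 2)%nat -> - mu <= idx d1 d2 i -> forall x, u i x = RtoC 0).
  { intros i Hi Hd; destruct Hs as [[Ha' Hp0]|[Hb' Hq0]].
    - apply (APin_disjoint (fun c => 0 < c) Rnonpos).
      + apply Hu'; assumption.
      + apply (APin_ext _ _ _ (fun x => eq_sym (Huv' i Hi x))).
        apply (APin_e_mult Rnonpos); [apply Hv, Hi|unfold Rnonpos; intros; lra].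
      + unfold Rnonpos; intros; lra.
    - apply (APin_disjoint Rnonneg (fun c => c < 0)).
      + apply Hu; assumption.
      + apply (APin_ext _ _ _ (fun x => eq_sym (Huv' i Hi x))).
        apply (APin_e_mult (fun c => c < 0)); [apply Hv'; assumption|intros; lra].
      + unfold Rnonneg; intros; lra. }
  assert (Hsum := index_sum_ge_0 lam d1 d2 g Gm Gp Gpi Xm Xp Ip HC).
  assert (HF : forall x, f0 x = (entry Gp 0 0 x * u 0%nat x + entry Gp 0 1 x * u 1%nat x)%C /\
    f1 x = (entry Gp 1 0 x * u 0%nat x + entry Gp 1 1 x * u 1%nat x)%C)
    by (intros x; apply (is_inverse_cancel Gp Gpi _ _ _ _ x Ip); reflexivity).
  assert (HH : forall x, h0 x = (entry Gm 0 0 x * v 0%nat x + entry Gm 0 1 x * v 1%nat x)%C /\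
    h1 x = (entry Gm 1 0 x * v 0%nat x + entry Gm 1 1 x * v 1%nat x)%C)
    by (intros x; apply (is_inverse_cancel Gm Gmi _ _ _ _ x Im); reflexivity).
  assert (Hj : exists j, (j < 2)%nat /\ forall x, f0 x = (entry Gp 0 j x * u j x)%C /\
    f1 x = (entry Gp 1 j x * u j x)%C /\ h1 x = (entry Gm 1 j x * v j x)%C).
  { assert (Hv0 : forall i, (i < 2)%nat -> (forall x, u i x = RtoC 0) -> forall x, v i x = RtoC 0)
      by (intros i Hi Z x; rewrite Hvu', Z by exact Hi; ring).
    (* If [d1 < - mu], then [Hsum] gives [d2 > mu >= - mu]; so one coordinate always vanishes. *)
    destruct (Rle_or_lt (- mu) d1) as [H1|H1].
    - exists 1%nat; split; [lia|]; intros x.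
      assert (Z := Hzero 0%nat ltac:(lia) H1); assert (Z' := Hv0 0%nat ltac:(lia) Z).
      destruct (HF x) as [-> ->]; destruct (HH x) as [_ ->]; rewrite Z, Z'; repeat split; ring.
    - exists 0%nat; split; [lia|]; intros x.
      assert (Z := Hzero 1%nat ltac:(lia) ltac:(cbn [idx]; lra)).
      assert (Z' := Hv0 1%nat ltac:(lia) Z).
      destruct (HF x) as [-> ->]; destruct (HH x) as [_ ->]; rewrite Z, Z'; repeat split; ring. }
  destruct Hj as [j [Hj Hcol]]; set (d := idx d1 d2 j) in *.
  assert (Hu0 : u j 0 <> RtoC 0).
  { intros Z; destruct (Hcol 0) as [K _]; rewrite Z in K.
    apply (e_neq_0 (lam - a) 0); fold f0; rewrite K; ring. }
  assert (Hv0 : v j 0 <> RtoC 0).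
  { intros Z; apply Hu0; rewrite Huv', Z by exact Hj; ring. }
  destruct (Omega_nonempty (u j) 0 (APin_AP _ _ (Hu j Hj)) Hu0) as [k Hk].
  (* The upper ends come from the minus side: [u_j = e_(-mu - d) v_j] and
     [Gp_0j = e_(d + lam) Gm_0j]. *)
  set (A := Rabs (- mu - d) + Rabs (d + lam)).
  assert (HA1 := Rle_abs (- mu - d)); assert (HA2 := Rle_abs (d + lam)).
  assert (HA3 := Rabs_pos (- mu - d)); assert (HA4 := Rabs_pos (d + lam)).
  assert (Honly : forall c, Omega (u j) c -> c = k).
  { intros c Hc; apply (single_frequency (u j) (entry Gp 0 j) A (lam - a)); [| | |exact Hc|exact Hk].
    - apply APin_intro; [apply (APin_AP _ _ (Hu j Hj))|]; intros s Hs'.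
      assert (K1 := APin_Omega _ _ _ (Hu j Hj) Hs'); unfold Rnonneg in K1.
      assert (K2 : s <= - mu - d).
      { apply (APin_Omega (fun s => s <= - mu - d) (u j)); [|exact Hs'].
        apply (APin_ext _ _ _ (fun x => eq_sym (Huv' j Hj x))).
        apply (APin_e_mult Rnonpos); [apply Hv, Hj|unfold Rnonpos; fold d; intros; lra]. }
      rewrite Rabs_pos_eq by exact K1; unfold A; lra.
    - apply APin_intro; [apply (APin_AP _ _ (Pp 0%nat j ltac:(lia) Hj))|]; intros s Hs'.
      assert (K1 := APin_Omega _ _ _ (Pp 0%nat j ltac:(lia) Hj) Hs'); unfold Rnonneg in K1.
      assert (K2 : s <= d + lam).
      { apply (APin_Omega (fun s => s <= d + lam) (entry Gp 0 j)); [|exact Hs'].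
        apply (APin_ext _ (fun x => (e (d - - lam) x * entry Gm 0 j x)%C)).
        - intros x; symmetry; revert x; apply e_transfer; intros x; apply (HC j x Hj).
        - apply (APin_e_mult Rnonpos); [apply Pm; [lia|exact Hj]|unfold Rnonpos; intros; lra]. }
      rewrite Rabs_pos_eq by exact K1; unfold A; lra.
    - intros t; destruct (Hcol t) as [K _]; fold f0; rewrite K; ring. }
  assert (Huk : APin (fun c => c = k) (u j))
    by (apply APin_intro; [apply (APin_AP _ _ (Hu j Hj))|exact Honly]).
  exists j, k, (d - - mu + k), (u j), (v j); split; [exact Hj|split; [exact Huk|split]].
  { apply (APin_ext _ _ _ (fun x => eq_sym (Hvu' j Hj x))).
    apply (APin_e_mult (fun c => c = k)); [exact Huk|fold d; intros; lra]. }
  repeat split; auto.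
  - intros x; destruct (Hcol x) as [_ [K _]]; rewrite <- K; unfold f1; ring.
  - intros x; apply (Hcol x).
Qed.

(** Stated as a spectral gap of [p] or [q] at 0, since [a] and [b] are infima only in the
    application. The exponent is positive (negative for [q]) because a nonzero function cannot have
    spectrum in two disjoint sets. *)
Lemma necessity (lam a b d1 d2 : R) (g p q : R -> C) :
  lam <= a + b -> a <= lam -> b <= lam ->
  APin Rnonneg p -> APin Rnonpos q ->
  (forall x, g x = (e a x * p x + e (- b) x * q x)%C) ->
  AP_factorization (G_mat lam g) d1 d2 ->
  (a < lam -> ~ Omega p 0 -> exists k, 0 < k /\ forall c, Omega p c -> k <= c) /\
  (b < lam -> ~ Omega q 0 -> exists k, k < 0 /\ forall c, Omega q c -> c <= k).
Proof.
  intros Hab Ha Hb Hp Hq Hg [Gm [Gmi [Gp [Gpi [Xm [Xmi [Im [Xp [Xpi [Ip HG]]]]]]]]]].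
  assert (HC := factorization_columns lam g Gm Gp Gpi d1 d2 Ip HG).
  assert (K := single_column lam a b d1 d2 g p q Gm Gmi Gp Gpi Hab Hp Hq Ha Hb Hg
    Xm Xmi Im Xp Xpi Ip HC).
  split; intros Hlt H0.
  - destruct (K (or_introl (conj Hlt H0))) as
      [j [k [k' [u [v [Hj [Hu [_ [Hu0 [_ [Hu' [_ [Ep _]]]]]]]]]]]]].
    specialize (Hu' Hlt H0); exists k; split.
    + destruct (Rlt_or_le 0 k) as [|Hk]; [assumption|exfalso; apply Hu0].
      apply (APin_disjoint _ _ _ Hu Hu'); intros; lra.
    + intros c; apply (APin_Omega (fun c => k <= c)).
      apply (APin_ext _ _ _ (fun x => eq_sym (Ep x))), APin_opp.
      apply (APin_mult Rnonneg (fun c => c = k)); [apply APplus_APin, Xp; lia|exact Hu|].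
      unfold Rnonneg; intros; lra.
  - destruct (K (or_intror (conj Hlt H0))) as
      [j [k [k' [u [v [Hj [_ [Hv [_ [Hv0 [_ [Hv' [_ Eq]]]]]]]]]]]]].
    specialize (Hv' Hlt H0); exists k'; split.
    + destruct (Rlt_or_le k' 0) as [|Hk]; [assumption|exfalso; apply Hv0].
      apply (APin_disjoint _ _ _ Hv Hv'); intros; lra.
    + intros c; apply (APin_Omega (fun c => c <= k')).
      apply (APin_ext _ _ _ (fun x => eq_sym (Eq x))).
      apply (APin_mult Rnonpos (fun c => c = k')); [apply APminus_APin, Xm; lia|exact Hv|].
      unfold Rnonpos; intros; lra.
Qed.

(** * From the data of the theorem to the cut data *)

Lemma APW_Win (f : R -> C) : APW f -> Win (Omega f) f.
Proof. intros [Hf [B HB]]; exists B; apply WBin_intro; assumption. Qed.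

(** Passes absolute convergence from [g] to [g_-] and [g_+], which share the coefficients of [g] on
    their own, disjoint, spectra. *)
Lemma APW_of_bohr_eq (f h : R -> C) :
  AP f -> APW h -> (forall a, Omega f a -> bohr h a = bohr f a) -> APW f.
Proof.
  intros Hf [_ [B HB]] E; split; [exact Hf|]; exists B; intros s Hs Hin.
  rewrite <- (map_ext_in (fun a => Cmod (bohr h a)));
    [|intros a Ha; rewrite E by (apply Hin, Ha); reflexivity].
  apply HB; [exact Hs|]; intros a Ha; unfold Omega; rewrite E by (apply Hin, Ha).
  apply Hin, Ha.
Qed.

Lemma is_factorization_mono (Xm Xm' Xp Xp' : (R -> C) -> Prop) (G : R -> @matrix C 2 2) (d1 d2 : R) :
  (forall f, Xm f -> Xm' f) -> (forall f, Xp f -> Xp' f) ->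
  is_factorization Xm Xp G d1 d2 -> is_factorization Xm' Xp' G d1 d2.
Proof.
  intros Hm Hp [Gm [Gmi [Gp [Gpi [A1 [A2 [A3 [A4 [A5 [A6 A7]]]]]]]]]].
  exists Gm, Gmi, Gp, Gpi.
  split; [intros i j Hi Hj; apply Hm, A1; assumption|].
  split; [intros i j Hi Hj; apply Hm, A2; assumption|].
  split; [exact A3|].
  split; [intros i j Hi Hj; apply Hp, A4; assumption|].
  split; [intros i j Hi Hj; apply Hp, A5; assumption|].
  split; [exact A6|exact A7].
Qed.

Lemma canonical_iff (d1 d2 : R) : canonical d1 d2 <-> d1 = 0 /\ d2 = 0.
Proof.
  assert (K : forall d, (forall x, e d x = RtoC 1) -> d = 0).
  { intros d H; destruct (Req_dec_T d 0) as [|Hd]; [assumption|exfalso].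
    (* At [pi / d] the exponential equals [-1]. *)
    specialize (H (PI / d)); unfold e in H; replace (d * (PI / d)) with PI in H by (field; exact Hd).
    rewrite cos_PI in H; injection H; lra. }
  split.
  - intros H; split; apply K; intros x; specialize (H x); rewrite Mone_mx2 in H;
      apply mx2_inj in H; apply H.
  - intros [-> ->] x; unfold diag_e; rewrite e_zero; reflexivity.
Qed.

(** The real number [a = min (inf E, lam)] replaces an infimum that may be infinite; when [a < lam]
    it is the infimum itself. *)
Lemma glb_cut (E : R -> Prop) (lam : R) :
  0 < lam -> (forall a, E a -> 0 < a) ->
  exists a, 0 <= a <= lam /\ (forall c, E c -> a <= c) /\
    (a < lam -> Glb_Rbar E = Finite a) /\
    (Glb_Rbar E = p_infty /\ a = lam \/ exists r, 0 <= r /\ Glb_Rbar E = Finite r /\ a = Rmin r lam).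
Proof.
  intros Hlam HE; destruct (Glb_Rbar_correct E) as [H1 H2].
  assert (H0 : Rbar_le (Finite 0) (Glb_Rbar E)).
  { apply H2; intros c Hc; cbn; apply Rlt_le, HE, Hc. }
  destruct (Glb_Rbar E) as [r| |]; [| |destruct H0].
  - cbn in H0; exists (Rmin r lam); split; [split; [apply Rmin_glb; lra|apply Rmin_r]|].
    split; [intros c Hc; eapply Rle_trans; [apply Rmin_l|apply (H1 c Hc)]|].
    split; [intros Hlt; f_equal; unfold Rmin in *; destruct (Rle_dec r lam); lra|].
    right; exists r; auto.
  - exists lam; split; [lra|]; split; [intros c Hc; destruct (H1 c Hc)|].
    split; [lra|left; auto].
Qed.

(** By this mirror image, [glb_cut] and [mu_index_cut] treat both ends alike. *)
Lemma eta_minus_glb (f : R -> C) : eta_minus f = Glb_Rbar (fun a => Omega f (- a)).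
Proof.
  symmetry; apply is_glb_Rbar_unique, is_glb_Rbar_opp, Lub_Rbar_correct.
Qed.

Lemma Rbar_le_cut (lam a : R) (ep : Rbar) :
  (ep = p_infty /\ a = lam \/ exists r, 0 <= r /\ ep = Finite r /\ a = Rmin r lam) ->
  (Rbar_le (Finite lam) ep <-> a = lam).
Proof.
  intros [[-> ->]|[r [Hr [-> ->]]]]; cbn; [tauto|].
  unfold Rmin; destruct (Rle_dec r lam); lra.
Qed.

(** The four terms of the minimum arise from expanding [min (ep, lam) + min (em, lam) - lam]. *)
Lemma mu_index_cut (lam a b : R) (ep em : Rbar) :
  0 < lam ->
  (ep = p_infty /\ a = lam \/ exists r, 0 <= r /\ ep = Finite r /\ a = Rmin r lam) ->
  (em = p_infty /\ b = lam \/ exists r, 0 <= r /\ em = Finite r /\ b = Rmin r lam) ->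
  Rbar_le (Finite lam) (Rbar_plus ep em) ->
  lam <= a + b /\ mu_index lam ep em = Finite (a + b - lam) /\
  (a + b - lam = 0 <-> ep = Finite 0 \/ em = Finite 0 \/ Rbar_plus ep em = Finite lam).
Proof.
  assert (Einj : forall r s, Finite r = Finite s <-> r = s)
    by (intros r s; split; [intros K; injection K; auto|intros ->; reflexivity]).
  assert (Einf : forall s, p_infty = Finite s <-> False)
    by (intros s; split; [discriminate|contradiction]).
  intros Hlam [[-> ->]|[r [Hr [-> ->]]]] [[-> ->]|[s [Hs [-> ->]]]]; intros H;
    unfold mu_index; cbn in *; rewrite ?Einj, ?Einf; unfold Rmin;
    try destruct (Rle_dec s (r + s + - lam));
    try destruct (Rle_dec r s); try destruct (Rle_dec r (r + s + - lam));
    repeat match goal with |- context [Rle_dec ?u ?v] => destruct (Rle_dec u v) end;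
    repeat split; intros; lra.
Qed.

Theorem theorem5p4 :
  forall (lam : R) (g g_minus g_plus : R -> C),
    0 < lam ->
    APW g ->
    APminus g_minus ->
    APplus g_plus ->
    (forall x : R, g x = Cplus (g_minus x) (g_plus x)) ->
    ~ Omega g_minus 0 ->
    ~ Omega g_plus 0 ->
    let em := eta_minus g_minus in
    let ep := eta_plus g_plus in
    let mu := mu_index lam ep em in
    let G := G_mat lam g in
    Rbar_le (Finite lam) (Rbar_plus ep em) ->
    (AP_factorable G <->
      (Rbar_in ep (Omega g_plus) \/ Rbar_le (Finite lam) ep) /\
      (Rbar_in (Rbar_opp em) (Omega g_minus) \/ Rbar_le (Finite lam) em)) /\
    (AP_factorable G ->
      APW_factorable G /\
      forall d1 d2 : R, AP_factorization G d1 d2 ->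
        ((Finite d1 = mu /\ Finite d2 = Rbar_opp mu) \/
         (Finite d1 = Rbar_opp mu /\ Finite d2 = mu)) /\
        (canonical d1 d2 <->
          ep = Finite 0 \/ em = Finite 0 \/ Rbar_plus ep em = Finite lam)).
Proof.
  intros lam g gm gp Hlam Hg Hgm Hgp Hsum Hm0 Hp0 em ep mu G Hle.
  assert (Hpos : forall a, Omega gp a -> 0 < a).
  { intros a Ha; destruct (Req_dec_T a 0) as [E|E]; [rewrite E in Ha; exfalso; auto|].
    assert (K := proj2 Hgp a Ha); lra. }
  assert (Hneg : forall a, Omega gm a -> a < 0).
  { intros a Ha; destruct (Req_dec_T a 0) as [E|E]; [rewrite E in Ha; exfalso; auto|].
    assert (K := proj2 Hgm a Ha); lra. }
  assert (Hbohr : forall a, bohr g a = (bohr gm a + bohr gp a)%C).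
  { intros a; rewrite (bohr_ext _ _ a Hsum); apply bohr_plus; [apply Hgm|apply Hgp]. }
  assert (Hnot : forall (f : R -> C) a, ~ Omega f a -> bohr f a = RtoC 0).
  { intros f a H; destruct (excluded_middle_informative (bohr f a = RtoC 0)); [assumption|].
    contradiction. }
  assert (Wp : Win (Omega gp) gp).
  { apply APW_Win, (APW_of_bohr_eq gp g); [apply Hgp|exact Hg|]; intros a Ha.
    rewrite Hbohr, (Hnot gm); [ring|]; intros Ha'.
    specialize (Hpos a Ha); specialize (Hneg a Ha'); lra. }
  assert (Wm : Win (Omega gm) gm).
  { apply APW_Win, (APW_of_bohr_eq gm g); [apply Hgm|exact Hg|]; intros a Ha.
    rewrite Hbohr, (Hnot gp); [ring|]; intros Ha'.
    specialize (Hpos a Ha'); specialize (Hneg a Ha); lra. }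
  assert (Eem : em = Glb_Rbar (fun a => Omega gm (- a))) by apply eta_minus_glb.
  destruct (glb_cut (Omega gp) lam Hlam Hpos) as [a [Ha [Ha1 [Ha2 Ha3]]]].
  destruct (glb_cut (fun a => Omega gm (- a)) lam Hlam) as [b [Hb [Hb1 [Hb2 Hb3]]]].
  { intros c Hc; specialize (Hneg _ Hc); lra. }
  rewrite <- Eem in Hb2, Hb3.
  fold (eta_plus gp) in Ha2, Ha3; fold ep in Ha2, Ha3.
  destruct (mu_index_cut lam a b ep em Hlam Ha3 Hb3 Hle) as [Hab [Hmu Hcan]]; fold mu in Hmu.
  set (p := fun x => (e (- a) x * gp x)%C); set (q := fun x => (e b x * gm x)%C).
  assert (Hpq : forall x, g x = (e a x * p x + e (- b) x * q x)%C).
  { intros x; unfold p, q; rewrite Hsum, !e_opp; field; split; apply e_neq_0. }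
  assert (Hp : Win Rnonneg p).
  { apply (Win_e_mult (Omega gp)); [exact Wp|]; intros c Hc; apply Ha1 in Hc.
    unfold Rnonneg; lra. }
  assert (Hq : Win Rnonpos q).
  { apply (Win_e_mult (Omega gm)); [exact Wm|]; intros c Hc.
    rewrite <- (Ropp_involutive c) in Hc; apply Hb1 in Hc; unfold Rnonpos; lra. }
  assert (Bp : forall c, bohr p c = bohr gp (c + a)).
  { intros c; unfold p; rewrite bohr_e_mult; f_equal; ring. }
  assert (Bq : forall c, bohr q c = bohr gm (c - b)) by (intros c; apply bohr_e_mult).
  assert (Hnec : AP_factorable G ->
    (Rbar_in ep (Omega gp) \/ Rbar_le (Finite lam) ep) /\
    (Rbar_in (Rbar_opp em) (Omega gm) \/ Rbar_le (Finite lam) em)).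
  { intros [d1 [d2 HF]].
    destruct (necessity lam a b d1 d2 g p q Hab (proj2 Ha) (proj2 Hb) (Win_APin _ _ Hp)
      (Win_APin _ _ Hq) Hpq HF) as [Np Nq]; split.
    - destruct (Rle_or_lt lam a) as [H|H].
      { right; apply (Rbar_le_cut lam a ep Ha3); lra. }
      left; rewrite (Ha2 H); exists a; split; [reflexivity|].
      destruct (excluded_middle_informative (Omega gp a)) as [|Hn]; [assumption|exfalso].
      destruct (Np H) as [k [Hk HO]].
      { unfold Omega; rewrite Bp, Rplus_0_l; exact Hn. }
      (* A gap of length [k] above [a] would raise the infimum of [Omega gp] to at least [a + k]. *)
      assert (K : Rbar_le (Finite (a + k)) (Glb_Rbar (Omega gp))).
      { apply Glb_Rbar_correct; intros c Hc; cbn.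
        assert (k <= c - a); [|lra]; apply HO; unfold Omega; rewrite Bp.
        replace (c - a + a) with c by ring; exact Hc. }
      fold (eta_plus gp) in K; fold ep in K; rewrite (Ha2 H) in K; cbn in K; lra.
    - destruct (Rle_or_lt lam b) as [H|H].
      { right; apply (Rbar_le_cut lam b em Hb3); lra. }
      left; rewrite (Hb2 H); exists (- b); split; [reflexivity|].
      destruct (excluded_middle_informative (Omega gm (- b))) as [|Hn]; [assumption|exfalso].
      destruct (Nq H) as [k [Hk HO]].
      { unfold Omega; rewrite Bq; unfold Rminus; rewrite Rplus_0_l; exact Hn. }
      assert (K : Rbar_le (Finite (b - k)) (Glb_Rbar (fun c => Omega gm (- c)))).
      { apply Glb_Rbar_correct; intros c Hc; cbn.
        assert (- c + b <= k); [|lra]; apply HO; unfold Omega; rewrite Bq.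
        replace (- c + b - b) with (- c) by ring; exact Hc. }
      rewrite <- Eem, (Hb2 H) in K; cbn in K; lra. }
  assert (Hsuf : (Rbar_in ep (Omega gp) \/ Rbar_le (Finite lam) ep) /\
    (Rbar_in (Rbar_opp em) (Omega gm) \/ Rbar_le (Finite lam) em) ->
    is_factorization (Win Rnonpos) (Win Rnonneg) G (- (a + b - lam)) (a + b - lam)).
  { intros [Cp Cq]; apply (factorization_exists lam a b g p q); try assumption.
    - destruct (Rle_or_lt lam a) as [H|H]; [left; lra|right].
      destruct Cp as [[c [E Hc]]|Cp]; [|apply (Rbar_le_cut lam a ep Ha3) in Cp; lra].
      rewrite (Ha2 H) in E; injection E as <-; rewrite Bp, Rplus_0_l; exact Hc.
    - destruct (Rle_or_lt lam b) as [H|H]; [left; lra|right].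
      destruct Cq as [[c [E Hc]]|Cq]; [|apply (Rbar_le_cut lam b em Hb3) in Cq; lra].
      rewrite (Hb2 H) in E; injection E as <-.
      rewrite Bq; unfold Rminus; rewrite Rplus_0_l; exact Hc. }
  assert (Hfac : AP_factorable G ->
    is_factorization (Win Rnonpos) (Win Rnonneg) G (- (a + b - lam)) (a + b - lam))
    by (intros H; apply Hsuf, Hnec, H).
  assert (HAPW : is_factorization (Win Rnonpos) (Win Rnonneg) G (- (a + b - lam)) (a + b - lam) ->
    APW_factorization G (- (a + b - lam)) (a + b - lam))
    by (apply is_factorization_mono; [apply Win_APWminus|apply Win_APWplus]).
  assert (HAP : APW_factorization G (- (a + b - lam)) (a + b - lam) ->
    AP_factorization G (- (a + b - lam)) (a + b - lam))
    by (apply is_factorization_mono; intros f Hf; apply Hf).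
  split; [split; [exact Hnec|]|].
  - intros H; exists (- (a + b - lam)), (a + b - lam); apply HAP, HAPW, Hsuf, H.
  - intros H; split.
    + exists (- (a + b - lam)), (a + b - lam); apply HAPW, Hfac, H.
    + intros d1 d2 Hd.
      assert (K := factorization_index_unique lam d1 d2 (a + b - lam) g ltac:(lra)
        (HAP (HAPW (Hfac H))) Hd).
      split.
      * rewrite Hmu; cbn [Rbar_opp].
        destruct K as [[-> ->]|[-> ->]]; [left|right]; split; reflexivity.
      * rewrite canonical_iff, <- Hcan; destruct K as [[-> ->]|[-> ->]]; lra.
Qed.
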